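(* Let $\Omega\in\mathbb{R}^+$, $\mu\in\mathbb{R}\setminus\{0\}$ and set $\lambda=\mu/\Omega$. Then: (i) for every unit vector $u_0\in L^2(S^1)$, the map $A^\Omega=A^\Omega_{u_0}$ is an isometry of $L^2(S^1)$ on $\mathcal{H}_\Omega(SE(2))$, i.e. $A^\Omega_{u_0}\Phi\in\mathcal{H}_\Omega(SE(2))$ and $\|A^\Omega_{u_0}\Phi\|_{\mathcal{H}_\Omega(SE(2))}=\|\Phi\|_{L^2(S^1)}$ for all $\Phi\in L^2(S^1)$; (ii) for $u_0=u^\mu$, where $u^\mu(\varphi)=c_\mu e^{\mu\cos\varphi}$ and $c_\mu$ is the normalization constant such that $\|u^\mu\|_{L^2(S^1)}=1$, the map $A^\Omega=A^\Omega_{u^\mu}$ maps $L^2(S^1)$ onto $\mathcal{H}_\Omega(SE(2))\cap CR^\lambda$.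
   Context: $\mathbb{R}^+=(0,\infty)$. $S^1=\mathbb{R}/2\pi\mathbb{Z}$ carries the measure $d\varphi$ of total mass $2\pi$. $SE(2)=\mathbb{R}^2_q\rtimes S^1_\theta$ is the group of rigid motions of the plane, with law $(q',\theta')\cdot(q,\theta)=(q'+r_{\theta'}q,\theta'+\theta)$, where $r_\theta$ is the counterclockwise rotation by $\theta$. For $\Omega\in\mathbb{R}^+$ the representation $\Pi^\Omega$ of $SE(2)$ on $L^2(S^1)$ is $$\Pi^\Omega(q,\theta)u(\varphi)=e^{-i\Omega(q_1\cos\varphi+q_2\sin\varphi)}u(\varphi-\theta).$$ For $u_0\in L^2(S^1)$, the analysis operator is $A^\Omega_{u_0}\Phi(q,\theta)=\langle\Pi^\Omega(q,\theta)u_0,\Phi\rangle_{L^2(S^1)}$, that is, $$A^\Omega_{u_0}\Phi(q,\theta)=\int_0^{2\pi}\Phi(\varphi)\,e^{i\Omega(q_1\cos\varphi+q_2\sin\varphi)}\,\overline{u_0(\varphi-\theta)}\,d\varphi,\qquad\Phi\in L^2(S^1).$$ Fourier transform: $\mathcal{F}f(k)=\hat f(k)=\frac1{2\pi}\int_{\mathbb{R}^2}e^{-ik\cdot x}f(x)\,dx$, extended to tempered distributions. The pairing $\langle T,\psi\rangle_{\mathcal{S}'\,\mathcal{S}}$ of tempered distributions with Schwartz functions is linear in $T$ and antilinear in $\psi$ (a function $f$ acts by $\psi\mapsto\int f\overline{\psi}$), and $\langle\mathcal{F}^{-1}T,\psi\rangle=\langle T,\mathcal{F}\psi\rangle$ up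 to the evident identification, i.e. $\langle\mathcal{F}^{-1}T,\psi\rangle_{\mathcal{S}'\,\mathcal{S}}=\langle T,\mathcal{F}\psi\rangle_{\mathcal{S}'\,\mathcal{S}}$. For $u\in L^2(S^1)$ let $\hat T^\Omega_u\in\mathcal{S}'(\mathbb{R}^2)$ be given by $\langle\hat T^\Omega_u,\psi\rangle_{\mathcal{S}'\,\mathcal{S}}=\int_0^{2\pi}u(\varphi)\overline{\psi(\Omega\cos\varphi,\Omega\sin\varphi)}\,d\varphi$; the map $u\mapsto\hat T^\Omega_u$ is injective. Define the Hilbert space of distributions $\mathcal{H}_\Omega=\{\mathcal{F}^{-1}\hat T^\Omega_u:u\in L^2(S^1)\}\subset\mathcal{S}'(\mathbb{R}^2)$ with scalar product $\langle\mathcal{F}^{-1}\hat T^\Omega_u,\mathcal{F}^{-1}\hat T^\Omega_v\rangle_{\mathcal{H}_\Omega}=\langle u,v\rangle_{L^2(S^1)}$. Define $\mathcal{H}_\Omega(SE(2))=L^2(S^1,\mathcal{H}_\Omega)$, with scalar product $\langle F,G\rangle_{\mathcal{H}_\Omega(SE(2))}=\int_{S^1}\langle F(\cdot,\theta),G(\cdot,\theta)\rangle_{\mathcal{H}_\Omega}\,d\theta$. For $\lambda\in\mathbb{R}$, a function $F:\mathbb{R}^2_q\times S^1_\theta\to\mathbb{C}$ is said to be $CR^\lambda$ if $(X_2+i\lambda X_1)F=0$, where $X_1=-\sin\theta\,\partial_{q_1}+\cos\theta\,\partial_{q_2}$ and $X_2=\partial_\theta$.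
   Formalization: In (i) the norm equality is corrected to ‖AΦ‖ = 2π‖Φ‖: with the Fourier transform normalized by 1/(2π), AΦ(·,θ) is the inverse transform of density 2πΦ(φ)·conj u₀(φ−θ), so the equality as stated fails for every Φ ≠ 0. *)

(* Defs.v *)
From HB Require Import structures.
From mathcomp Require Import all_boot all_order all_algebra.
From mathcomp Require Import complex.
From mathcomp Require Import all_classical all_reals all_analysis.

Set Implicit Arguments.
Unset Strict Implicit.
Unset Printing Implicit Defensive.

Import Order.TTheory GRing.Theory Num.Theory.
Import numFieldNormedType.Exports.

Local Open Scope classical_set_scope.
Local Open Scope ring_scope.
Local Open Scope complex_scope.

(* A function on S^1 = R/2piZ is a 2pi-periodic function on R, integrated over
   [0, 2pi]; L^2 spaces consist of representatives, to be compared almost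
   everywhere. Complex numbers are R[i] for R : realType. *)

Section ComplexFunctions.
Variable R : realType.
Local Notation C := R[i].

Definition cexpi (t : R) : C := cos t +i* sin t.

Definition cmeasurable d (T : measurableType d) (f : T -> C) : Prop :=
  measurable_fun setT (fun x => complex.Re (f x)) /\
  measurable_fun setT (fun x => complex.Im (f x)).

Definition cintegral d (T : measurableType d) (mu : {measure set T -> \bar R})
    (D : set T) (f : T -> C) : C :=
  Rintegral mu D (fun x => complex.Re (f x)) +i*
  Rintegral mu D (fun x => complex.Im (f x)).

(* Derivative along the vector v of the normed space V. *)
Definition cderivable (V : normedModType R) (f : V -> C) (x v : V) : Prop :=
  derivable (fun y => complex.Re (f y)) x v /\
  derivable (fun y => complex.Im (f y)) x v.

Definition cderive (V : normedModType R) (v : V) (f : V -> C) (x : V) : C :=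
  'D_v (fun y => complex.Re (f y)) x +i* 'D_v (fun y => complex.Im (f y)) x.

Definition cderives (V : normedModType R) (s : seq V) (f : V -> C) : V -> C :=
  foldr (@cderive V) f s.

(* Smoothness relative to a basis B of V: every iterated partial derivative
   along vectors of B exists and is continuous. *)
Definition smooth (V : normedModType R) (B : seq V) (f : V -> C) : Prop :=
  forall s : seq V, {subset s <= B} ->
    [/\ continuous (fun x => complex.Re (cderives s f x)),
        continuous (fun x => complex.Im (cderives s f x)) &
        forall v x, v \in B -> cderivable (cderives s f) x v].

End ComplexFunctions.

Section Circle.
Variable R : realType.
Local Notation C := R[i].
Local Notation leb := (@lebesgue_measure R).

Definition S1 : set R := `[0, pi *+ 2]%classic.

Definition L2S1 (u : R -> C) : Prop :=
  [/\ periodic u (pi *+ 2), cmeasurable u &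
      (\int[leb]_(phi in S1) ((ComplexField.Normc.normc (u phi)) ^+ 2)%:E
         < +oo)%E].

Definition L2ip (u v : R -> C) : C :=
  cintegral leb S1 (fun phi => conjc (u phi) * v phi).

Definition L2norm (u : R -> C) : R := Num.sqrt (complex.Re (L2ip u u)).

End Circle.

Section TemperedDistributions.
Variable R : realType.
Local Notation C := R[i].
Local Notation leb := (@lebesgue_measure R).

Definition basis2 : seq (R * R) := [:: (1, 0); (0, 1)].

Definition seminorm2_le (a b : nat) (s : seq (R * R)) (psi : R * R -> C)
    (M : R) : Prop :=
  forall x : R * R,
    `|x.1| ^+ a * `|x.2| ^+ b * ComplexField.Normc.normc (cderives s psi x)
      <= M.

Definition schwartz2 (psi : R * R -> C) : Prop :=
  smooth basis2 psi /\
  forall (a b : nat) (s : seq (R * R)), {subset s <= basis2} ->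
    exists M : R, seminorm2_le a b s psi M.

Definition planeint (f : R * R -> C) : C :=
  cintegral (leb \x leb)%E setT f.

Definition fourier2 (psi : R * R -> C) (k : R * R) : C :=
  ((pi *+ 2)^-1)%:C *
  planeint (fun x => cexpi (- (k.1 * x.1 + k.2 * x.2)) * psi x).

(* The pairing < T, psi >, antilinear in psi, is T psi; only the values of T on
   Schwartz functions are meaningful, whence the equality tdist_eq. *)
Definition tdist : Type := (R * R -> C) -> C.

Definition tdist_eq (S T : tdist) : Prop :=
  forall psi, schwartz2 psi -> S psi = T psi.

Definition tempered (T : tdist) : Prop :=
  (forall (c : C) (psi1 psi2 : R * R -> C), schwartz2 psi1 -> schwartz2 psi2 ->
     T (fun x => c * psi1 x + psi2 x) = conjc c * T psi1 + T psi2) /\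
  (exists (K : R) (N : nat), forall (psi : R * R -> C) (M : R), schwartz2 psi ->
     (forall (a b : nat) (s : seq (R * R)), (a <= N)%N -> (b <= N)%N ->
        (size s <= N)%N -> {subset s <= basis2} -> seminorm2_le a b s psi M) ->
     ComplexField.Normc.normc (T psi) <= K * M).

Definition tdist_of_fun (f : R * R -> C) : tdist :=
  fun psi => planeint (fun x => f x * conjc (psi x)).

Definition tdist_inv_fourier (T : tdist) : tdist := fun psi => T (fourier2 psi).

End TemperedDistributions.

Section HOmega.
Variable R : realType.
Local Notation C := R[i].
Local Notation leb := (@lebesgue_measure R).
Variable Omega : R.

Definition circle_dist (u : R -> C) : tdist R :=
  fun psi => cintegral leb (@S1 R)
    (fun phi => u phi * conjc (psi (Omega * cos phi, Omega * sin phi))).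

Definition HOmega_dist (u : R -> C) : tdist R :=
  tdist_inv_fourier (circle_dist u).

Definition in_HOmega (T : tdist R) : Prop :=
  tempered T /\ exists2 u, L2S1 u & tdist_eq T (HOmega_dist u).

(* The u such that T = F^-1 T_u, unique almost everywhere when it exists
   (and 0 otherwise). *)
Definition HOmega_density (T : tdist R) : R -> C :=
  xget (fun=> 0) [set u | L2S1 u /\ tdist_eq T (HOmega_dist u)].

Definition HOmega_ip (S T : tdist R) : C :=
  L2ip (HOmega_density S) (HOmega_density T).

Definition HOmega_norm (T : tdist R) : R :=
  Num.sqrt (complex.Re (HOmega_ip T T)).

(* Equality almost everywhere with a Borel function; needed because a class in
   L^2(S^1, H_Omega) fixes the values of its members up to a null set only. *)
Definition ae_cmeasurable (f : R -> C) : Prop :=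
  exists2 g : R -> C, cmeasurable g & {ae leb, forall theta, f theta = g theta}.

(* L^2(S^1, H_Omega). As H_Omega is separable, measurability of F is that of
   all its scalar products with elements of H_Omega. *)
Definition in_HSE2 (F : R -> tdist R) : Prop :=
  [/\ forall theta, tdist_eq (F (theta + pi *+ 2)) (F theta),
      {ae leb, forall theta, in_HOmega (F theta)},
      forall G, in_HOmega G ->
        ae_cmeasurable (fun theta => HOmega_ip G (F theta)) &
      (\int[leb]_(theta in (@S1 R)) ((HOmega_norm (F theta)) ^+ 2)%:E
         < +oo)%E].

Definition HSE2_eq (F G : R -> tdist R) : Prop :=
  {ae leb, forall theta, tdist_eq (F theta) (G theta)}.

Definition HSE2_ip (F G : R -> tdist R) : C :=
  cintegral leb (@S1 R) (fun theta => HOmega_ip (F theta) (G theta)).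

Definition HSE2_norm (F : R -> tdist R) : R :=
  Num.sqrt (complex.Re (HSE2_ip F F)).

(* F(q, theta) as the family theta |-> F(., theta) of distributions. *)
Definition HSE2_of_fun (f : (R * R) * R -> C) : R -> tdist R :=
  fun theta => tdist_of_fun (fun q => f (q, theta)).

End HOmega.

Section CauchyRiemann.
Variable R : realType.
Local Notation C := R[i].
Local Notation leb := (@lebesgue_measure R).

Definition dq1 : (R * R) * R := ((1, 0), 0).
Definition dq2 : (R * R) * R := ((0, 1), 0).
Definition dtheta : (R * R) * R := ((0, 0), 1).
Definition basis3 : seq ((R * R) * R) := [:: dq1; dq2; dtheta].

(* Test functions on R^2 x S^1, Schwartz in q. *)
Definition testSE2 (chi : (R * R) * R -> C) : Prop :=
  [/\ forall q theta, chi (q, theta + pi *+ 2) = chi (q, theta),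
      smooth basis3 chi &
      forall (a b : nat) (s : seq ((R * R) * R)), {subset s <= basis3} ->
        exists M : R, forall p : (R * R) * R,
          `|p.1.1| ^+ a * `|p.1.2| ^+ b *
            ComplexField.Normc.normc (cderives s chi p) <= M].

Definition X1 (chi : (R * R) * R -> C) (p : (R * R) * R) : C :=
  (- sin p.2)%:C * cderive dq1 chi p + (cos p.2)%:C * cderive dq2 chi p.

Definition X2 (chi : (R * R) * R -> C) (p : (R * R) * R) : C :=
  cderive dtheta chi p.

Definition distSE2 (F : R -> tdist R) (chi : (R * R) * R -> C) : C :=
  cintegral leb (@S1 R) (fun theta => F theta (fun q => chi (q, theta))).

(* Distributional X1 F and X2 F: the fields are real and divergence free, so
   integration by parts gives < X F, chi > = - < F, X chi >. *)
Definition dist_X1 (F : R -> tdist R) (chi : (R * R) * R -> C) : C :=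
  - distSE2 F (X1 chi).

Definition dist_X2 (F : R -> tdist R) (chi : (R * R) * R -> C) : C :=
  - distSE2 F (X2 chi).

Definition CR (lambda : R) (F : R -> tdist R) : Prop :=
  forall chi, testSE2 chi ->
    dist_X2 F chi + (0 +i* lambda) * dist_X1 F chi = 0.

End CauchyRiemann.

Section Analysis.
Variable R : realType.
Local Notation C := R[i].

Definition Pi_rep (Omega : R) (q : R * R) (theta : R) (u : R -> C) : R -> C :=
  fun phi => cexpi (- (Omega * (q.1 * cos phi + q.2 * sin phi)))
             * u (phi - theta).

(* With the unitary normalization of the Fourier transform,
   A Phi(., theta) = F^-1 T_u for u(phi) = 2pi Phi(phi) conj(u0(phi - theta)),
   so A multiplies norms by 2pi when H_Omega carries the norm of u. *)
Definition analysis_op (Omega : R) (u0 Phi : R -> C) (p : (R * R) * R) : C :=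
  L2ip (Pi_rep Omega p.1 p.2 u0) Phi.

Definition c_mu (mu : R) : R :=
  (L2norm (fun phi => (expR (mu * cos phi))%:C))^-1.

Definition u_mu (mu : R) : R -> C :=
  fun phi => (c_mu mu * expR (mu * cos phi))%:C.

End Analysis.

(* Main.v *)
Require Import Defs.
From HB Require Import structures.
From mathcomp Require Import all_boot all_order all_algebra.
From mathcomp Require Import complex.
From mathcomp Require Import all_classical all_reals all_analysis.
From mathcomp Require Import measurable_realfun.
From mathcomp Require Import ring lra.
Set Implicit Arguments.
Unset Strict Implicit.
Unset Printing Implicit Defensive.
Import Order.TTheory GRing.Theory Num.Theory.
Import numFieldNormedType.Exports.
Local Open Scope classical_set_scope.
Local Open Scope ring_scope.
Local Open Scope complex_scope.

(** At the angle theta, A Phi is the inverse Fourier transform of the measure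
    carried by the circle of radius Omega with density
    2pi Phi(phi) conj(u0(phi - theta)): exchange the integrals over the plane
    and over the circle (analysis_pairing). The norm of H_Omega being that of
    the density, the isometry amounts to
    int int |Phi(phi)|^2 |u0(phi - theta)|^2 dphi dtheta = |Phi|^2 |u0|^2,
    which is Tonelli's theorem together with the invariance of integrals of
    periodic functions (integral_density_sqr).

    Consider now a field F whose value at theta has the density U(theta, phi).
    On the plane wave of frequency Omega (cos phi, sin phi), X1 is the
    multiplication by i Omega sin(phi - theta). With lambda = mu / Omega, the
    equation (X2 + i lambda X1) F = 0 is thus formally
    d/dtheta U = mu sin(phi - theta) U, whose solutions are
    U(theta, phi) = a(phi) exp(mu cos(phi - theta)). For u0 = u^mu these are
    exactly the densities of the functions A Phi, with a = 2pi c_mu Phi.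

    For A Phi the equation is tested against a function chi, and integration by
    parts in theta under the Fourier integral (theta_parts) makes the two terms
    cancel (CR_analysis).

    For the converse, F is only measurable in theta, and the differential
    equation is used in a weak form. The test functions are Gaussians in q whose
    frequency rotates with theta, multiplied by cos(k theta + beta). They are
    designed so that X2 - i lambda X1 differentiates only the trigonometric
    factor (X2_test_mode) and that their Fourier transforms restrict, on the
    circle, to a multiple of
    cos(k theta + beta) exp(s.(cos phi, sin phi) - mu cos(phi - theta))
    (fourier2_test_mode). The equation then says that, as a function of theta,
    the moment int U(theta, phi) exp(s.(cos phi, sin phi) - mu cos(phi - theta))
    dphi has no nonconstant Fourier coefficient, hence is constant almost
    everywhere (moment_constant). Countably many exponents s separate integrable
    functions on the circle (exp_orthogonal_dense), so that
    U(theta, phi) exp(- mu cos(phi - theta)) is the same function of phi for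
    almost all theta, and Phi is read off from it (CR_surjective).

    Both uniqueness theorems on the circle, for exponentials and for
    trigonometric functions, come from kernels W(cos(phi - alpha))^n that
    concentrate at alpha (peak_orthogonal_ae). *)

Local Notation Re := complex.Re.
Local Notation Im := complex.Im.
Local Notation cabs := (@ComplexField.Normc.normc _).

(** * Directional derivatives, continuity and integrability *)

Section DirectionalDerivatives.
Variables (R : realType) (V : normedModType R).
Implicit Types (f g : V -> R) (p v : V).

Lemma dir_ext f g p v a b : f =1 g -> a = b -> is_derive p v f a -> is_derive p v g b.
Proof. by move=> /funext -> ->. Qed.

Lemma dir_cst (c : R) p v : is_derive p v (fun=> c) 0.
Proof. exact: is_derive_cst. Qed.

Lemma dirD f g p v a b : is_derive p v f a -> is_derive p v g b ->
  is_derive p v (fun x => f x + g x) (a + b).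
Proof. by move=> fa gb; exact: is_deriveD. Qed.

Lemma dirM f g p v a b : is_derive p v f a -> is_derive p v g b ->
  is_derive p v (fun x => f x * g x) (a * g p + f p * b).
Proof.
move=> fa gb; have h := is_deriveM fa gb; apply: (is_derive_eq h).
by rewrite addrC; congr (_ + _); rewrite mulrC.
Qed.

Lemma dirZ (c : R) f p v a : is_derive p v f a ->
  is_derive p v (fun x => c * f x) (c * a).
Proof.
by move=> fa; apply: dir_ext (dirM (dir_cst c p v) fa) => //; rewrite mul0r add0r.
Qed.

(** Through this reduction the chain rule on V becomes the one-variable chain
    rule. *)
Lemma dir_line f p v a :
  is_derive p v f a <-> is_derive (0 : R) (1 : R) (fun h : R => f (h *: v + p)) a.
Proof.
have e : (fun h : R => h^-1 *: ((f \o shift p) (h *: v) - f p)) =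
   (fun h : R => h^-1 *: (((fun h : R => f (h *: v + p)) \o shift 0) (h *: 1)
     - f (0 *: v + p))).
  apply/funext => h /=; rewrite scale0r add0r addr0.
  by rewrite (_ : h *: (1 : R) = h)// /GRing.scale /= mulr1.
by split => -[d1 d2]; split; rewrite /derivable /derive ?e// -e.
Qed.

Lemma dir_comp f (G : R -> R) p v a b :
  is_derive p v f a -> is_derive (f p) (1 : R) G b ->
  is_derive p v (fun x => G (f x)) (b * a).
Proof.
move=> /dir_line fa Gb; apply/dir_line.
apply: (@is_derive1_comp _ G (fun h : R => f (h *: v + p))) => //.
by rewrite scale0r add0r.
Qed.

Lemma dir_cos f p v a : is_derive p v f a ->
  is_derive p v (fun x => cos (f x)) (- sin (f p) * a).
Proof. by move=> fa; apply: (dir_comp fa); exact: is_derive_cos. Qed.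

Lemma dir_sin f p v a : is_derive p v f a ->
  is_derive p v (fun x => sin (f x)) (cos (f p) * a).
Proof. by move=> fa; apply: (dir_comp fa); exact: is_derive_sin. Qed.

Lemma dir_exp f p v a : is_derive p v f a ->
  is_derive p v (fun x => expR (f x)) (expR (f p) * a).
Proof. by move=> fa; apply: (dir_comp fa); exact: is_derive_expR. Qed.

Lemma dir_val f p v a : is_derive p v f a -> 'D_v f p = a.
Proof. by case. Qed.

End DirectionalDerivatives.

Lemma dir_id (R : realType) (x : R) : is_derive x (1 : R) (fun y : R => y) 1.
Proof. exact: is_derive_id. Qed.

Lemma derive_continuous (R : realType) (f : R -> R) (x a : R) :
  is_derive x (1 : R) f a -> {for x, continuous f}.
Proof.
by move=> [d _]; apply: differentiable_continuous; exact/derivable1_diffP.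
Qed.

Section Continuity.
Variables (R : realType) (T : topologicalType).
Implicit Types (f g : T -> R).

Lemma continuousM_fun f g : continuous f -> continuous g ->
  continuous (fun x => f x * g x).
Proof. by move=> cf cg x; apply: cvgM; [exact: cf|exact: cg]. Qed.

Lemma continuousD_fun f g : continuous f -> continuous g ->
  continuous (fun x => f x + g x).
Proof. by move=> cf cg x; apply: cvgD; [exact: cf|exact: cg]. Qed.

Lemma continuous_comp_fun f (G : R -> R) : continuous f -> continuous G ->
  continuous (fun x => G (f x)).
Proof.
move=> cf cG x; have := cvg_comp _ G (cf x) (cG (f x)).
exact.
Qed.

Lemma continuous_cst_fun (c : R) : continuous (fun _ : T => c).
Proof. by move=> x; exact: cvg_cst. Qed.

End Continuity.

Section RealIntegrable.
Variables (R : realType) (d : measure_display) (T : measurableType d).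
Variables (mu : {measure set T -> \bar R}) (D : set T).
Hypothesis mD : measurable D.
Implicit Types (f g : T -> R).

Lemma integrableD_fun f g : mu.-integrable D (EFin \o f) ->
  mu.-integrable D (EFin \o g) ->
  mu.-integrable D (EFin \o (fun x => f x + g x)).
Proof. by move=> fi gi; exact: (integrableD mD fi gi). Qed.

Lemma integrableZ_fun (c : R) f : mu.-integrable D (EFin \o f) ->
  mu.-integrable D (EFin \o (fun x => c * f x)).
Proof. by move=> fi; exact: (integrableZl mD c fi). Qed.

End RealIntegrable.

(** * Integrals depending on a parameter *)

Section ParametricIntegrals.
Variable R : realType.

Lemma integrable_fun_dom d (T : measurableType d) (mu : {measure set T -> \bar R})
    (D : set T) (f g : T -> R) :
  measurable D -> measurable_fun D f -> (forall x, D x -> `|f x| <= g x) ->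
  mu.-integrable D (EFin \o g) -> mu.-integrable D (EFin \o f).
Proof.
move=> mD mf fg ig; apply: (le_integrable mD _ _ ig).
  exact/measurable_EFinP.
move=> x Dx /=; rewrite lee_fin; apply: (le_trans (fg x Dx)).
exact: ler_norm.
Qed.

Section TwoVariables.
Context d1 d2 (T1 : measurableType d1) (T2 : measurableType d2).
Variables (m1 : {sigma_finite_measure set T1 -> \bar R})
          (m2 : {sigma_finite_measure set T2 -> \bar R}).
Variables (D1 : set T1) (D2 : set T2).
Hypotheses (mD1 : measurable D1) (mD2 : measurable D2).

Lemma measurable_ge0_param (f : T1 * T2 -> \bar R) :
  measurable_fun setT f -> (forall z, (0 <= f z)%E) ->
  measurable_fun setT (fun x => (\int[m2]_(y in D2) f (x, y))%E).
Proof.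
move=> mf f0.
pose g z := (f \_ (setT `*` D2)) z.
have mD : measurable ([set: T1] `*` D2) by exact: measurableX.
have mg : measurable_fun setT g.
  by apply/(measurable_restrictT f mD); exact: measurable_funS mf.
have g0 z : (0 <= g z)%E by rewrite /g patchE; case: ifP.
have := measurable_fun_fubini_tonelli_F (m2:=m2) _ mg g0.
rewrite /fubini_F; congr (measurable_fun _ _); apply/funext => x.
rewrite [RHS]integral_mkcond; apply: eq_integral => y _.
rewrite /g !patchE in_setX in_setT /=; done.
Qed.

(** The positive and negative parts are integrated separately; where one of
    the integrals is infinite the value is still a measurable function of the
    two. *)
Lemma measurable_Rintegral_param (f : T1 * T2 -> R) :
  measurable_fun setT f ->
  measurable_fun setT (fun x => \int[m2]_(y in D2) f (x, y)).
Proof.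
move=> mf; rewrite /Rintegral.
apply: measurableT_comp => //.
have mfE : measurable_fun setT (EFin \o f) by exact/measurable_EFinP.
have mp := @measurable_ge0_param (EFin \o f)^\+%E (measurable_funepos mfE)
  (fun=> funepos_ge0 _ _).
have mn := @measurable_ge0_param (EFin \o f)^\-%E (measurable_funeneg mfE)
  (fun=> funeneg_ge0 _ _).
have := emeasurable_funB mp mn.
by congr (measurable_fun _ _); apply/funext => x; rewrite integralE;
  congr (_ - _)%E; apply: eq_integral => y _; rewrite ?funeposE ?funenegE.
Qed.

End TwoVariables.

Section Fubini.
Context d1 d2 (T1 : measurableType d1) (T2 : measurableType d2).
Variables (m1 : {sigma_finite_measure set T1 -> \bar R})
          (m2 : {sigma_finite_measure set T2 -> \bar R}).
Variables (D1 : set T1) (D2 : set T2).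
Hypotheses (mD1 : measurable D1) (mD2 : measurable D2).
Variables (f : T1 * T2 -> R) (g : T1 -> R) (h : T2 -> R).
Hypotheses (mf : measurable_fun setT f)
  (fgh : forall x y, D1 x -> D2 y -> `|f (x, y)| <= g x * h y)
  (ig : m1.-integrable D1 (EFin \o g)) (ih : m2.-integrable D2 (EFin \o h)).

Lemma integrable_sec1 x : D1 x -> m2.-integrable D2 (EFin \o (fun y => f (x, y))).
Proof.
move=> Dx; apply: (@integrable_fun_dom _ _ _ _ _ (fun y => g x * h y)) => //.
- by apply: measurable_funTS; exact: measurable_fun_pair2.
- by move=> y Dy; exact: fgh.
- rewrite (_ : EFin \o _ = (fun y => (g x)%:E * (EFin \o h) y)%E) //.
  exact: integrableZl.
Qed.

Lemma integrable_sec2 y : D2 y -> m1.-integrable D1 (EFin \o (fun x => f (x, y))).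
Proof.
move=> Dy; apply: (@integrable_fun_dom _ _ _ _ _ (fun x => h y * g x)) => //.
- by apply: measurable_funTS; exact: measurable_fun_pair1.
- by move=> x Dx; rewrite mulrC; exact: fgh.
- rewrite (_ : EFin \o _ = (fun x => (h y)%:E * (EFin \o g) x)%E) //.
  exact: integrableZl.
Qed.

Lemma integrable_restrictX :
  (m1 \x m2)%E.-integrable setT (EFin \o (f \_ (D1 `*` D2))).
Proof.
have mD : measurable (D1 `*` D2) by exact: measurableX.
have mfD : measurable_fun setT (EFin \o (f \_ (D1 `*` D2))).
  by apply/measurable_EFinP/(measurable_restrictT f mD); exact: measurable_funS mf.
apply/integrable12ltyP => //.
have ih' : (\int[m2]_(y in D2) `|(h y)%:E| < +oo)%E by case/integrableP : ih.
have ig' : (\int[m1]_(y in D1) `|(g y)%:E| < +oo)%E by case/integrableP : ig.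
have mh : measurable_fun D2 h by apply/measurable_EFinP; case/integrableP : ih.
have mg : measurable_fun D1 g by apply/measurable_EFinP; case/integrableP : ig.
set H := (\int[m2]_(y in D2) `|(h y)%:E|)%E in ih'.
have H0 : (0 <= H)%E by exact: integral_ge0.
apply: (@le_lt_trans _ _ (\int[m1]_(x in D1) (H * `|(g x)%:E|))%E).
  rewrite [leRHS]integral_mkcond; apply: ge0_le_integral => //.
  - by move=> x _; exact: integral_ge0.
  - apply: (@measurable_fun_fubini_tonelli_F _ _ _ _ _ m2
      (fun z => `|(EFin \o (f \_ (D1 `*` D2))) z|%E)) => //.
    exact: measurableT_comp.
  - apply/(measurable_restrictT _ mD1); apply: measurable_funeM.
    by apply/measurable_EFinP; exact: measurableT_comp.
  - move=> x _; rewrite patchE; case: ifPn => [|xD]; last first.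
      rewrite integral0_eq// => y _; rewrite /= patchE in_setX.
      by rewrite (negbTE xD) /= normr0.
    rewrite inE => Dx; rewrite muleC /H -ge0_integralZl//; last first.
      by apply/measurable_EFinP; exact: measurableT_comp.
    rewrite [leRHS]integral_mkcond; apply: ge0_le_integral => //.
    + apply: measurableT_comp => //; exact: measurable_fun_pair2.
    + apply/(measurable_restrictT _ mD2); apply: measurable_funeM.
      by apply/measurable_EFinP; exact: measurableT_comp.
    + move=> y _; rewrite /= !patchE in_setX (mem_set Dx) /=.
      case: ifPn => [|_]; last by rewrite normr0.
      rewrite inE => Dy; rewrite lee_fin -normrM.
      by apply: (le_trans (fgh Dx Dy)); exact: ler_norm.
rewrite ge0_integralZl//.
- by rewrite lte_mul_pinfty// ge0_fin_numE.
- by apply/measurable_EFinP; exact: measurableT_comp.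
Qed.

(** The dominating function being a product, the sections are integrable at
    every point and not only almost everywhere; this is what allows the inner
    integrals to be real numbers. *)
Lemma Rintegral_fubini :
  \int[m1]_(x in D1) \int[m2]_(y in D2) f (x, y) =
  \int[m2]_(y in D2) \int[m1]_(x in D1) f (x, y).
Proof.
have := Fubini integrable_restrictX.
have e1 : (\int[m1]_x \int[m2]_y (EFin \o (f \_ (D1 `*` D2))) (x, y) =
    \int[m1]_(x in D1) (\int[m2]_(y in D2) f (x, y))%:E)%E.
  rewrite [RHS]integral_mkcond; apply: eq_integral => x _.
  rewrite [RHS]patchE; case: ifPn => [|xD]; last first.
    by rewrite integral0_eq// => y _; rewrite /= patchE in_setX (negbTE xD).
  rewrite inE => Dx; rewrite /Rintegral fineK; last first.
    by apply: integrable_fin_num => //; exact: integrable_sec1.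
  rewrite [RHS]integral_mkcond; apply: eq_integral => y _.
  by rewrite /= !patchE in_setX (mem_set Dx) /=; case: ifP.
have e2 : (\int[m2]_y \int[m1]_x (EFin \o (f \_ (D1 `*` D2))) (x, y) =
    \int[m2]_(y in D2) (\int[m1]_(x in D1) f (x, y))%:E)%E.
  rewrite [RHS]integral_mkcond; apply: eq_integral => y _.
  rewrite [RHS]patchE; case: ifPn => [|xD]; last first.
    by rewrite integral0_eq// => x _; rewrite /= patchE in_setX (negbTE xD) andbF.
  rewrite inE => Dy; rewrite /Rintegral fineK; last first.
    by apply: integrable_fin_num => //; exact: integrable_sec2.
  rewrite [RHS]integral_mkcond; apply: eq_integral => x _.
  by rewrite /= !patchE in_setX (mem_set Dy) andbT /=; case: ifP.
by rewrite e1 e2 => e; rewrite /Rintegral e.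
Qed.

Lemma integrable_Rintegral1 :
  m1.-integrable D1 (EFin \o (fun x => \int[m2]_(y in D2) f (x, y))).
Proof.
apply: (@integrable_fun_dom _ _ _ _ _
  (fun x => (\int[m2]_(y in D2) h y) * g x)) => //.
- by apply: measurable_funTS; exact: (measurable_Rintegral_param m2 mD2 mf).
- move=> x Dx; apply: (le_trans (le_normr_Rintegral mD2 (integrable_sec1 Dx))).
  rewrite mulrC -RintegralZl//; apply: le_Rintegral => //.
  + apply: (@integrable_fun_dom _ _ _ _ _ (fun y => g x * h y)) => //.
    * apply: measurable_funTS; apply: measurableT_comp => //.
      exact: measurable_fun_pair2.
    * by move=> y Dy; rewrite normr_id; exact: fgh.
    * rewrite (_ : EFin \o _ = (fun y => (g x)%:E * (EFin \o h) y)%E) //.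
      exact: integrableZl.
  + rewrite (_ : EFin \o _ = (fun y => (g x)%:E * (EFin \o h) y)%E) //.
    exact: integrableZl.
  + by move=> y Dy; exact: fgh.
- rewrite (_ : EFin \o _ =
    (fun x => (\int[m2]_(y in D2) h y)%:E * (EFin \o g) x)%E) //.
  exact: integrableZl.
Qed.

End Fubini.
End ParametricIntegrals.

(** * Complex-valued functions and their integrals *)

Section ComplexArithmetic.
Variable R : realType.
Local Notation C := R[i].
Implicit Types (x y z : C).

Lemma ReD x y : Re (x + y) = Re x + Re y. Proof. by case: x y => [? ?] [? ?]. Qed.
Lemma ImD x y : Im (x + y) = Im x + Im y. Proof. by case: x y => [? ?] [? ?]. Qed.
Lemma ReN x : Re (- x) = - Re x. Proof. by case: x. Qed.
Lemma ImN x : Im (- x) = - Im x. Proof. by case: x. Qed.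
Lemma ReM x y : Re (x * y) = Re x * Re y - Im x * Im y.
Proof. by case: x y => [? ?] [? ?]. Qed.
Lemma ImM x y : Im (x * y) = Re x * Im y + Im x * Re y.
Proof. by case: x y => [? ?] [? ?]. Qed.
Lemma ReJ x : Re (conjc x) = Re x. Proof. by case: x. Qed.
Lemma ImJ x : Im (conjc x) = - Im x. Proof. by case: x. Qed.

Definition cE := (ReD, ImD, ReN, ImN, ReM, ImM, ReJ, ImJ).

Lemma complex_ext x y : Re x = Re y -> Im x = Im y -> x = y.
Proof. by case: x y => [? ?] [? ?] /= -> ->. Qed.

Lemma cabsE x : cabs x = Num.sqrt (Re x ^+ 2 + Im x ^+ 2).
Proof. by case: x. Qed.

Lemma cabs_ge0 x : 0 <= cabs x. Proof. by rewrite cabsE sqrtr_ge0. Qed.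

Lemma cabsM x y : cabs (x * y) = cabs x * cabs y.
Proof. exact: ComplexField.Normc.normcM. Qed.

Lemma cabsD x y : cabs (x + y) <= cabs x + cabs y.
Proof. exact: le_normcD. Qed.

Lemma sqr_cabs x : cabs x ^+ 2 = Re x ^+ 2 + Im x ^+ 2.
Proof. by rewrite cabsE sqr_sqrtr// addr_ge0// sqr_ge0. Qed.

Lemma cabsJ x : cabs (conjc x) = cabs x.
Proof. by rewrite !cabsE ReJ ImJ sqrrN. Qed.

Lemma cabsR (a : R) : cabs a%:C = `|a|.
Proof. by rewrite cabsE /= expr0n addr0 sqrtr_sqr. Qed.

Lemma cabsi (a : R) : cabs (0 +i* a) = `|a|.
Proof. by rewrite cabsE /= expr0n add0r sqrtr_sqr. Qed.

Lemma cabs_Re x : `|Re x| <= cabs x.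
Proof. by rewrite -sqrtr_sqr cabsE ler_wsqrtr// lerDl sqr_ge0. Qed.

Lemma cabs_Im x : `|Im x| <= cabs x.
Proof. by rewrite -sqrtr_sqr cabsE ler_wsqrtr// lerDr sqr_ge0. Qed.

Lemma cabs_le x : cabs x <= `|Re x| + `|Im x|.
Proof.
have := cabsD (Re x)%:C (0 +i* Im x); rewrite cabsR cabsi; apply: le_trans.
by rewrite [X in _ <= cabs X](_ : _ = x)//; apply: complex_ext; rewrite cE /= ?addr0 ?add0r.
Qed.

Lemma cabs_expi (t : R) : cabs (cexpi t) = 1.
Proof. by rewrite cabsE /= cos2Dsin2 sqrtr1. Qed.

Lemma cexpiD (s t : R) : cexpi (s + t) = cexpi s * cexpi t.
Proof. by apply: complex_ext; rewrite cE /= ?cosD ?sinD; ring. Qed.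

Lemma cexpiN (t : R) : cexpi (- t) = conjc (cexpi t).
Proof. by apply: complex_ext; rewrite ?cE /= ?cosN ?sinN. Qed.

End ComplexArithmetic.

Section ComplexMeasurability.
Variable R : realType.
Local Notation C := R[i].
Context d (T : measurableType d).
Implicit Types (f g : T -> C).

Lemma cmeasurable_cst (c : C) : cmeasurable (fun _ : T => c).
Proof. by split; exact: measurable_cst. Qed.

Lemma cmeasurable_real (f : T -> R) :
  measurable_fun setT f -> cmeasurable (fun x => (f x)%:C).
Proof. by move=> mf; split => //=; exact: measurable_cst. Qed.

Lemma cmeasurableD f g :
  cmeasurable f -> cmeasurable g -> cmeasurable (fun x => f x + g x).
Proof.
move=> [f1 f2] [g1 g2]; split.
  by under eq_fun do rewrite ReD; exact: measurable_funD.
by under eq_fun do rewrite ImD; exact: measurable_funD.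
Qed.

Lemma cmeasurableM f g :
  cmeasurable f -> cmeasurable g -> cmeasurable (fun x => f x * g x).
Proof.
move=> [f1 f2] [g1 g2]; split.
  by under eq_fun do rewrite ReM; apply: measurable_funB; exact: measurable_funM.
by under eq_fun do rewrite ImM; apply: measurable_funD; exact: measurable_funM.
Qed.

Lemma cmeasurableJ f : cmeasurable f -> cmeasurable (fun x => conjc (f x)).
Proof.
move=> [f1 f2]; split.
  by under eq_fun do rewrite ReJ.
by under eq_fun do rewrite ImJ; exact: measurableT_comp.
Qed.

Lemma measurable_cos_comp (f : T -> R) :
  measurable_fun setT f -> measurable_fun setT (fun x => cos (f x)).
Proof.
by apply: measurableT_comp; apply: continuous_measurable_fun; exact: continuous_cos.
Qed.

Lemma measurable_sin_comp (f : T -> R) :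
  measurable_fun setT f -> measurable_fun setT (fun x => sin (f x)).
Proof.
by apply: measurableT_comp; apply: continuous_measurable_fun; exact: continuous_sin.
Qed.

Lemma cmeasurable_expi (f : T -> R) :
  measurable_fun setT f -> cmeasurable (fun x => cexpi (f x)).
Proof.
by move=> mf; split; [exact: measurable_cos_comp|exact: measurable_sin_comp].
Qed.

Lemma measurable_cabs f : cmeasurable f -> measurable_fun setT (fun x => cabs (f x)).
Proof.
move=> [f1 f2]; under eq_fun do rewrite cabsE.
have ms : measurable_fun setT (@Num.sqrt R).
  by apply: continuous_measurable_fun; exact: sqrt_continuous.
apply: (measurableT_comp ms).
by apply: measurable_funD; exact: measurable_funX.
Qed.

End ComplexMeasurability.

Lemma cmeasurable_comp (R : realType) d d' (T : measurableType d)
    (T' : measurableType d') (f : T' -> R[i]) (g : T -> T') :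
  cmeasurable f -> measurable_fun setT g -> cmeasurable (fun x => f (g x)).
Proof.
move=> [f1 f2] mg; split; first exact: (measurableT_comp f1 mg).
exact: (measurableT_comp f2 mg).
Qed.

Section ComplexIntegral.
Variable R : realType.
Local Notation C := R[i].
Context d (T : measurableType d).
Variables (mu : {measure set T -> \bar R}) (D : set T).
Hypothesis mD : measurable D.
Implicit Types (f g : T -> C).

Definition cintegrable f : Prop :=
  mu.-integrable D (EFin \o (fun x => Re (f x))) /\
  mu.-integrable D (EFin \o (fun x => Im (f x))).

Lemma cintegrable_dom f (g : T -> R) :
  cmeasurable f -> (forall x, D x -> cabs (f x) <= g x) ->
  mu.-integrable D (EFin \o g) -> cintegrable f.
Proof.
move=> [f1 f2] fg ig; split; apply: (integrable_fun_dom mD _ _ ig).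
- exact: measurable_funTS.
- by move=> x Dx; apply: le_trans (fg x Dx); exact: cabs_Re.
- exact: measurable_funTS.
- by move=> x Dx; apply: le_trans (fg x Dx); exact: cabs_Im.
Qed.

Lemma eq_cintegral f g : (forall x, D x -> f x = g x) ->
  cintegral mu D f = cintegral mu D g.
Proof.
move=> fg; rewrite /cintegral.
by congr (_ +i* _); apply: eq_Rintegral => x /set_mem Dx; rewrite fg.
Qed.

Lemma cintegrableD f g : cintegrable f -> cintegrable g ->
  cintegrable (fun x => f x + g x).
Proof.
move=> [f1 f2] [g1 g2]; split.
  under eq_fun do rewrite ReD; exact: (integrableD mD f1 g1).
under eq_fun do rewrite ImD; exact: (integrableD mD f2 g2).
Qed.

Lemma cintegralD f g : cintegrable f -> cintegrable g ->
  cintegral mu D (fun x => f x + g x) = cintegral mu D f + cintegral mu D g.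
Proof.
move=> [f1 f2] [g1 g2]; apply: complex_ext; rewrite cE /=.
  by under eq_Rintegral do rewrite ReD; exact: RintegralD.
by under eq_Rintegral do rewrite ImD; exact: RintegralD.
Qed.

Let intZ (f : T -> R) (a : R) : mu.-integrable D (EFin \o f) ->
  mu.-integrable D (EFin \o (fun x => a * f x)).
Proof. by move=> fi; exact: (integrableZl mD a fi). Qed.

Lemma cintegrableZ (c : C) f : cintegrable f -> cintegrable (fun x => c * f x).
Proof.
move=> [f1 f2]; split.
  under eq_fun do rewrite ReM.
  exact: (integrableB mD (intZ (Re c) f1) (intZ (Im c) f2)).
under eq_fun do rewrite ImM.
exact: (integrableD mD (intZ (Re c) f2) (intZ (Im c) f1)).
Qed.

Lemma cintegralZ (c : C) f : cintegrable f ->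
  cintegral mu D (fun x => c * f x) = c * cintegral mu D f.
Proof.
move=> [f1 f2]; apply: complex_ext; rewrite cE /=.
  under eq_Rintegral do rewrite ReM.
  rewrite (RintegralB mD (intZ (Re c) f1) (intZ (Im c) f2)).
  by rewrite !RintegralZl.
under eq_Rintegral do rewrite ImM.
rewrite (RintegralD mD (intZ (Re c) f2) (intZ (Im c) f1)).
by rewrite !RintegralZl.
Qed.

Lemma cintegralJ f : cintegrable f ->
  cintegral mu D (fun x => conjc (f x)) = conjc (cintegral mu D f).
Proof.
move=> [f1 f2]; apply: complex_ext; rewrite cE /=.
  by apply: eq_Rintegral => x _; rewrite ReJ.
rewrite -mulN1r -RintegralZl//; apply: eq_Rintegral => x _.
by rewrite ImJ mulN1r.
Qed.

Lemma cintegrableJ f : cintegrable f -> cintegrable (fun x => conjc (f x)).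
Proof.
move=> [f1 f2]; split; first by under eq_fun do rewrite ReJ.
by under eq_fun do rewrite ImJ -mulN1r; exact: intZ.
Qed.

(** The constant 2 is crude: the real and imaginary parts are estimated
    separately, which spares the choice of a phase. *)
Lemma cabs_cintegral_le f (g : T -> R) :
  cmeasurable f -> (forall x, D x -> cabs (f x) <= g x) ->
  mu.-integrable D (EFin \o g) ->
  cabs (cintegral mu D f) <= 2 * \int[mu]_(x in D) g x.
Proof.
move=> mf fg ig; have [f1 f2] := cintegrable_dom mf fg ig.
apply: (le_trans (cabs_le _)); rewrite /= mulr_natl mulr2n.
have aux (h : T -> R) : mu.-integrable D (EFin \o h) ->
    (forall x, D x -> `|h x| <= g x) ->
    `|\int[mu]_(x in D) h x| <= \int[mu]_(x in D) g x.
  move=> ih hg; apply: (le_trans (le_normr_Rintegral mD ih)).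
  apply: le_Rintegral => //; apply: (integrable_fun_dom mD _ _ ig).
    apply: measurableT_comp => //.
    by apply/measurable_EFinP; case/integrableP : ih.
  by move=> x Dx; rewrite normr_id hg.
apply: lerD; apply: aux => // x Dx; apply: le_trans (fg x Dx).
  exact: cabs_Re.
exact: cabs_Im.
Qed.

End ComplexIntegral.

Section ComplexFubini.
Variable R : realType.
Local Notation C := R[i].
Context d1 d2 (T1 : measurableType d1) (T2 : measurableType d2).
Variables (m1 : {sigma_finite_measure set T1 -> \bar R})
          (m2 : {sigma_finite_measure set T2 -> \bar R}).
Variables (D1 : set T1) (D2 : set T2).
Hypotheses (mD1 : measurable D1) (mD2 : measurable D2).

Lemma cmeasurable_cintegral_param (f : T1 * T2 -> C) :
  cmeasurable f -> cmeasurable (fun x => cintegral m2 D2 (fun y => f (x, y))).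
Proof.
move=> [f1 f2]; split => /=.
  exact: (measurable_Rintegral_param m2 mD2 f1).
exact: (measurable_Rintegral_param m2 mD2 f2).
Qed.

Variables (f : T1 * T2 -> C) (g : T1 -> R) (h : T2 -> R).
Hypotheses (mf : cmeasurable f)
  (fgh : forall x y, D1 x -> D2 y -> cabs (f (x, y)) <= g x * h y)
  (ig : m1.-integrable D1 (EFin \o g)) (ih : m2.-integrable D2 (EFin \o h)).

Let fgh1 x y : D1 x -> D2 y -> `|Re (f (x, y))| <= g x * h y.
Proof. by move=> Dx Dy; apply: le_trans (fgh Dx Dy); exact: cabs_Re. Qed.
Let fgh2 x y : D1 x -> D2 y -> `|Im (f (x, y))| <= g x * h y.
Proof. by move=> Dx Dy; apply: le_trans (fgh Dx Dy); exact: cabs_Im. Qed.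

Lemma cintegral_fubini :
  cintegral m1 D1 (fun x => cintegral m2 D2 (fun y => f (x, y))) =
  cintegral m2 D2 (fun y => cintegral m1 D1 (fun x => f (x, y))).
Proof.
case: mf => f1 f2; apply: complex_ext => /=.
  exact: (Rintegral_fubini mD1 mD2 f1 fgh1 ig ih).
exact: (Rintegral_fubini mD1 mD2 f2 fgh2 ig ih).
Qed.

Lemma cintegrable_cintegral1 :
  cintegrable m1 D1 (fun x => cintegral m2 D2 (fun y => f (x, y))).
Proof.
case: mf => f1 f2; split.
  exact: (integrable_Rintegral1 mD1 mD2 f1 fgh1 ig ih).
exact: (integrable_Rintegral1 mD1 mD2 f2 fgh2 ig ih).
Qed.

Lemma cintegrable_sec1 x : D1 x -> cintegrable m2 D2 (fun y => f (x, y)).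
Proof.
case: mf => f1 f2 Dx; split.
  exact: (integrable_sec1 mD2 f1 fgh1 ih Dx).
exact: (integrable_sec1 mD2 f2 fgh2 ih Dx).
Qed.

End ComplexFubini.

(** * Integrals and null sets without measurability *)

Section NonMeasurable.
Variable R : realType.
Context d (T : measurableType d).
Variables (mu : {measure set T -> \bar R}) (D : set T).
Local Open Scope ereal_scope.
Import HBNNSimple.

(** The integral of a nonnegative function is the supremum of the integrals of
    the simple functions below it. Cutting such a simple function off on the
    null set N changes nothing, so that measurability of f and g never enters.
    *)
Lemma le_integral_lower_ae (N : set T) (f g : T -> \bar R) :
  measurable N -> mu N = 0 ->
  (forall x, D x -> 0 <= f x) -> (forall x, D x -> 0 <= g x) ->
  (forall x, D x -> ~ N x -> f x <= g x) ->
  \int[mu]_(x in D) f x <= \int[mu]_(x in D) g x.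
Proof.
move=> mN N0 f0 g0 fg.
rewrite integral_mkcond [leRHS]integral_mkcond !ge0_integralTE//; last 2 first.
- by move=> x; rewrite patchE; case: ifPn => // /set_mem; exact: g0.
- by move=> x; rewrite patchE; case: ifPn => // /set_mem; exact: f0.
apply: ge_ereal_sup => _ [h hf <-].
pose h1 := proj_nnsfun h (measurableC mN).
have -> : sintegral mu h = sintegral mu h1.
  rewrite -!integralT_nnsfun; apply: ge0_ae_eq_integral => //.
  - exact/measurable_EFinP.
  - exact/measurable_EFinP.
  - by move=> x _; rewrite lee_fin.
  - by move=> x _; rewrite lee_fin.
  exists N; split => // x /= /not_implyP[_]; apply: contra_notP => Nx.
  by rewrite /h1 /= mindicE mem_set//= mulr1.
apply: ereal_sup_ubound; exists h1 => // x.
rewrite /h1 /= mindicE patchE; case: ifPn => [/set_mem Dx|xD].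
  have [/set_mem Nx|_] := boolP (x \in ~` N); last by rewrite mulr0 g0.
  rewrite mulr1; apply: (le_trans (hf x)); rewrite patchE (mem_set Dx).
  exact: fg.
have := hf x; rewrite patchE (negbTE xD) !lee_fin => h0.
by rewrite mulr_le0_ge0.
Qed.

Lemma eq_integral_lower_ae (N : set T) (f g : T -> \bar R) :
  measurable N -> mu N = 0 ->
  (forall x, D x -> 0 <= f x) -> (forall x, D x -> 0 <= g x) ->
  (forall x, D x -> ~ N x -> f x = g x) ->
  \int[mu]_(x in D) f x = \int[mu]_(x in D) g x.
Proof.
move=> mN N0 f0 g0 fg; apply/eqP; rewrite eq_le; apply/andP; split.
  by apply: (le_integral_lower_ae mN) => // x Dx Nx; rewrite fg.
by apply: (le_integral_lower_ae mN) => // x Dx Nx; rewrite fg.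
Qed.

Lemma eq_Rintegral_ae (f g : T -> R) :
  {ae mu, forall x, D x -> f x = g x} ->
  (\int[mu]_(x in D) f x)%R = (\int[mu]_(x in D) g x)%R.
Proof.
move=> [N [mN N0 Nfg]].
have fg x : D x -> ~ N x -> f x = g x.
  by move=> Dx; apply: contra_notP => fgx; apply: Nfg => /= /(_ Dx).
rewrite /Rintegral integralE [in RHS]integralE; congr (fine (_ - _)).
  apply: (eq_integral_lower_ae mN) => // x Dx Nx.
  by rewrite !funeposE fg.
apply: (eq_integral_lower_ae mN) => // x Dx Nx.
by rewrite !funenegE fg.
Qed.

End NonMeasurable.

(** A field of distributions is arbitrary on a null set of angles; the values
    there can thus be replaced by those of a measurable representative. *)
Lemma eq_cintegral_ae (R : realType) d (T : measurableType d)
    (mu : {measure set T -> \bar R}) (D : set T) (f g : T -> R[i]) :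
  {ae mu, forall x, D x -> f x = g x} ->
  cintegral mu D f = cintegral mu D g.
Proof.
move=> fg; rewrite /cintegral; congr (_ +i* _); apply: eq_Rintegral_ae;
  by apply: filterS fg => x fgx Dx; rewrite fgx.
Qed.

Section AlmostEverywhere.
Context d (T : measurableType d) (R : realType) (mu : {measure set T -> \bar R}).
Implicit Types (P Q S : T -> Prop).

Lemma ae_imp P Q : {ae mu, forall x, P x} -> (forall x, P x -> Q x) ->
  {ae mu, forall x, Q x}.
Proof. by move=> aP PQ; apply: filterS aP. Qed.

Lemma ae_imp2 P Q S : {ae mu, forall x, P x} -> {ae mu, forall x, Q x} ->
  (forall x, P x -> Q x -> S x) -> {ae mu, forall x, S x}.
Proof. by move=> aP aQ PQS; apply: filterS2 aP aQ. Qed.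

Lemma ae_imp3 P Q S P' : {ae mu, forall x, P x} -> {ae mu, forall x, Q x} ->
  {ae mu, forall x, P' x} ->
  (forall x, P x -> Q x -> P' x -> S x) -> {ae mu, forall x, S x}.
Proof. by move=> aP aQ aP' PQS; apply: filterS3 aP aQ aP'. Qed.

End AlmostEverywhere.

Lemma ae_forall_countable d (T : measurableType d) (R : realType)
    (mu : {measure set T -> \bar R}) (I : countType) (P : I -> T -> Prop) :
  (forall i, {ae mu, forall x, P i x}) -> {ae mu, forall x, forall i, P i x}.
Proof.
move=> aeP; pose Q n x := forall i, unpickle n = Some i -> P i x.
have aeQ n : {ae mu, forall x, Q n x}.
  rewrite /Q; case: (unpickle n) => [i|]; last by apply: aeW => x i.
  by apply: (ae_imp (aeP i)) => x Px _ [<-].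
apply: (ae_imp (ae_foralln aeQ)) => x Qx i.
exact: (Qx (pickle i) i (pickleK i)).
Qed.

(** * Rounding *)

Section FloorSteps.
Variable R : realType.

Definition floor_step (n : nat) (t : R) : R :=
  (Num.floor (n.+1%:R * t))%:~R / n.+1%:R.

Lemma floor_step_dist n t : `|floor_step n t - t| <= n.+1%:R^-1.
Proof.
have n0 : 0 < n.+1%:R :> R by rewrite ltr0n.
have h1 := Num.Theory.floor_le (n.+1%:R * t).
have h2 := Num.Theory.floorD1_gt (n.+1%:R * t).
rewrite intrD in h2.
rewrite -(ler_pM2l n0) mulfV ?gt_eqF// -[X in X * _](gtr0_norm n0) -normrM.
rewrite mulrBr /floor_step mulrCA mulfV ?gt_eqF// mulr1 ler_norml.
set a := (Num.floor _)%:~R in h1 h2 *.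
by apply/andP; split; lra.
Qed.

Lemma floor_step_cvg t : floor_step n t @[n --> \oo] --> t.
Proof.
apply/cvgrPdist_le => /= e e0.
near=> n; rewrite distrC; apply: (le_trans (floor_step_dist n t)).
by apply/ltW; near: n; exact: near_infty_natSinv_lt (PosNum e0).
Unshelve. all: by end_near. Qed.

(** The index takes countably many values, each of them on a measurable set.
    *)
Lemma measurable_floor_select d (T : measurableType d) (s : T -> R)
    (H : int -> T -> R) :
  measurable_fun setT s -> (forall j, measurable_fun setT (H j)) ->
  measurable_fun setT (fun x => H (Num.floor (s x)) x).
Proof.
move=> ms mH _ Y mY; rewrite setTI.
rewrite (_ : _ @^-1` Y = \bigcup_j (s @^-1` `[j%:~R, (j + 1)%:~R[%classic `&`
    (H j) @^-1` Y)); last first.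
  apply/seteqP; split => [x /= Yx|x [j _ [/=]]].
    exists (Num.floor (s x)) => //; split => //=.
    by rewrite in_itv /= Num.Theory.floor_le Num.Theory.floorD1_gt.
  by rewrite in_itv /= => /Num.Theory.floor_def ->.
apply: countable_bigcupT_measurable => // j; apply: measurableI.
  by rewrite -[X in measurable X]setTI; exact: ms.
by rewrite -[X in measurable X]setTI; exact: mH.
Qed.

(** Rounding the first argument gives functions that are continuous in the
    second argument and depend on the first one through a countable partition;
    they converge to f. *)
Lemma continuous_measurable_fun2 (f : R * R -> R) :
  continuous f -> measurable_fun setT f.
Proof.
move=> cf.
have cf2 a : continuous (fun y : R => f (a, y)).
  move=> y.
  have ay : (a, y') @[y' --> y] --> (a, y).
    by apply: (@cvg_pair _ _ _ _ (nbhs a) (nbhs y)); [exact: cvg_cst|exact: cvg_id].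
  have := cvg_comp _ f ay (cf (a, y)).
  exact.
have m2 a : measurable_fun setT (fun z : R * R => f (a, z.2)).
  apply: (measurableT_comp (f := fun y => f (a, y))).
    exact: continuous_measurable_fun.
  exact: measurable_snd.
apply: (@measurable_fun_cvg _ _ _ _ (fun n z => f (floor_step n z.1, z.2))).
  move=> n; apply: (@measurable_floor_select _ _ (fun z : R * R => n.+1%:R * z.1)
    (fun j z => f (j%:~R / n.+1%:R, z.2))) => //.
  by apply: measurable_funM => //; exact: measurable_fst.
move=> [x y] _ /=.
have ay : (floor_step n x, y) @[n --> \oo] --> (x, y).
  apply: (@cvg_pair _ _ _ _ (nbhs x) (nbhs y)); last exact: cvg_cst.
  exact: floor_step_cvg.
have := cvg_comp _ f ay (cf (x, y)).
exact.
Qed.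

End FloorSteps.

(** * The Gaussian on the line *)

Section LineIntegrals.
Variable R : realType.
Local Notation leb := (@lebesgue_measure R).

(** One majorant serves for the Gaussian, for its first moment and for all
    Schwartz functions. *)
Definition lorentz (x : R) : R := (oneDsqr x)^-1.

Lemma oneDsqr_gt0 (x : R) : 0 < oneDsqr x.
Proof. by apply: lt_le_trans (oneDsqr_ge1 x). Qed.

Lemma lorentz_gt0 (x : R) : 0 < lorentz x.
Proof. by rewrite invr_gt0 oneDsqr_gt0. Qed.

Lemma lorentz_ge0 (x : R) : 0 <= lorentz x.
Proof. exact/ltW/lorentz_gt0. Qed.

Lemma continuous_lorentz : continuous lorentz.
Proof. exact: continuous_oneDsqrV. Qed.

Lemma integrable_lorentz : leb.-integrable setT (EFin \o lorentz).
Proof.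
apply/integrableP; split.
  apply/measurable_EFinP; apply: continuous_measurable_fun.
  exact: continuous_lorentz.
under eq_integral do rewrite /= ger0_norm ?lorentz_ge0//.
rewrite ge0_symfun_integralT; last 3 first.
- exact: lorentz_ge0.
- exact: continuous_lorentz.
- by move=> x /=; rewrite /lorentz /oneDsqr sqrrN.
rewrite (_ : [set x | _] = `[0, +oo[%classic); last first.
  by apply/seteqP; split => x /=; rewrite in_itv /= andbT.
by rewrite integral0y_oneDsqr -EFinM ltry.
Qed.

Lemma lorentz_le_inv (x : R) (n : nat) : n.+1%:R <= `|x| -> lorentz x <= n.+1%:R^-1.
Proof.
move=> nx; rewrite /lorentz lef_pV2 ?posrE ?oneDsqr_gt0 ?ltr0n//.
have h1 : 1 <= n.+1%:R :> R by rewrite ler1n.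
apply: (le_trans nx); rewrite /oneDsqr -(real_normK (num_real x)).
by have := le_trans h1 nx; set a := `|x| => a1; nra.
Qed.

Lemma Rdominated_convergence d (T : measurableType d)
    (mu : {measure set T -> \bar R}) (D : set T) (f_ : nat -> T -> R)
    (f g : T -> R) :
  measurable D -> (forall n, measurable_fun D (f_ n)) -> measurable_fun D f ->
  {ae mu, forall x, D x -> f_ n x @[n --> \oo] --> f x} ->
  (forall n x, D x -> `|f_ n x| <= g x) ->
  mu.-integrable D (EFin \o g) ->
  \int[mu]_(x in D) f_ n x @[n --> \oo] --> \int[mu]_(x in D) f x.
Proof.
move=> mD mf_ mf fcvg fg ig.
have [fi _ cv] : [/\ mu.-integrable D (EFin \o f),
    (\int[mu]_(x in D) `|(f_ n x)%:E - (f x)%:E|)%E @[n --> \oo] --> 0%E &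
    (\int[mu]_(x in D) (f_ n x)%:E)%E @[n --> \oo]
      --> (\int[mu]_(x in D) (f x)%:E)%E].
  apply: (@dominated_convergence _ _ _ _ _ mD _ _ (EFin \o g)) => //.
  - by move=> n; exact/measurable_EFinP.
  - exact/measurable_EFinP.
  - by apply: filterS fcvg => x fx Dx; apply: cvg_EFin; [exact: nearW|exact: fx].
  - by apply: aeW => x n Dx; rewrite lee_fin fg.
apply: fine_cvg; rewrite fineK //.
exact: integrable_fin_num.
Qed.

(** The fundamental theorem is applied on [-n, n]; the boundary terms tend to
    0 by the bound on h. *)
Lemma Rintegral_derive0 (h h' : R -> R) (c : R) :
  (forall x : R, is_derive x (1 : R) h (h' x)) -> continuous h' ->
  (forall x, `|h x| <= c * lorentz x) ->
  leb.-integrable setT (EFin \o h') -> \int[leb]_x h' x = 0.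
Proof.
move=> dh ch' hc ih'.
have mh' : measurable_fun setT h' by exact: continuous_measurable_fun.
pose I n := `[- n.+1%:R, n.+1%:R : R]%classic.
have cv : \int[leb]_x ((h' \_ (I n)) x) @[n --> \oo] --> \int[leb]_x h' x.
  apply: (@Rdominated_convergence _ _ leb setT _ _ (fun x => `|h' x|)) => //.
  - move=> n; apply/(measurable_restrictT h' (measurable_itv _)).
    exact: measurable_funS mh'.
  - apply: aeW => x _; apply: cvg_near_cst; near=> n.
    rewrite patchE mem_set// /I /= in_itv /= -ler_norml.
    apply: (@le_trans _ _ n%:R); last by rewrite ler_nat.
    by near: n; exact: nbhs_infty_ger.
  - by move=> n x _; rewrite patchE; case: ifP => // _; rewrite normr0.
  - exact: integrable_norm.
have e n : \int[leb]_x ((h' \_ (I n)) x) = h n.+1%:R - h (- n.+1%:R).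
  rewrite -Rintegral_mkcond /Rintegral /I.
  rewrite (@continuous_FTC2 _ h' h (- n.+1%:R) n.+1%:R).
  - by [].
  - by rewrite -subr_gt0 opprK addr_gt0.
  - exact: continuous_subspaceT.
  - have ch : continuous h.
      by move=> x; apply: differentiable_continuous; apply/derivable1_diffP;
         have [] := dh x.
    split.
    + by move=> x _; have [] := dh x.
    + by apply: cvg_at_right_filter; exact: ch.
    + by apply: cvg_at_left_filter; exact: ch.
  - by move=> x _; rewrite derive1E; have [_ ->] := dh x.
move: cv; under eq_fun do rewrite e; move=> cv; apply: (cvg_unique _ cv) => //.
apply/cvgrPdist_le => /= eps eps0.
have c0 : 0 <= c.
  by have := le_trans (normr_ge0 _) (hc 0); rewrite pmulr_lge0// lorentz_gt0.
have c2 : 0 < eps / (2 * (c + 1)) by rewrite divr_gt0// mulr_gt0//; lra.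
near=> n.
rewrite sub0r normrN; apply: (le_trans (ler_normB _ _)).
have hn (x : R) : `|x| = n.+1%:R -> `|h x| <= eps / 2.
  move=> xn; apply: (le_trans (hc x)).
  apply: (@le_trans _ _ (c * n.+1%:R^-1)).
    by rewrite ler_wpM2l// lorentz_le_inv// xn.
  apply: (@le_trans _ _ (c * (eps / (2 * (c + 1))))).
    rewrite ler_wpM2l//; apply/ltW; near: n.
    exact: near_infty_natSinv_lt (PosNum c2).
  rewrite -subr_ge0 (_ : _ - _ = eps / (2 * (c + 1))); last by field; lra.
  exact: ltW.
rewrite [leRHS](splitr eps); apply: lerD; apply: hn; rewrite ?normrN//.
  by rewrite ger0_norm.
by rewrite ger0_norm.
Unshelve. all: by end_near. Qed.

End LineIntegrals.

Section GaussianTransform.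
Variable R : realType.
Local Notation leb := (@lebesgue_measure R).
Local Notation gauss := (@gauss_fun R).

Lemma gauss_lorentz (x : R) : gauss x <= lorentz x.
Proof.
rewrite /gauss_fun /lorentz /oneDsqr expRN lef_pV2 ?posrE ?expR_gt0//.
  exact: expR_ge1Dx.
exact: oneDsqr_gt0.
Qed.

Lemma xgauss_lorentz (x : R) : `|x| * gauss x <= 2 * lorentz x.
Proof.
rewrite /gauss_fun /lorentz /oneDsqr expRN.
have e0 : 0 < expR (x ^+ 2) by exact: expR_gt0.
have o0 : 0 < 1 + x ^+ 2 by exact: oneDsqr_gt0.
rewrite ler_pdivrMr// mulrAC ler_pdivlMr//.
have h : (1 + x ^+ 2 / 2) ^+ 2 <= expR (x ^+ 2).
  have -> : expR (x ^+ 2) = expR (x ^+ 2 / 2) ^+ 2.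
    by rewrite -expRM_natr; congr expR; field.
  rewrite ler_sqr ?nnegrE ?expR_ge0 ?expR_ge1Dx// addr_ge0// divr_ge0//.
  exact: sqr_ge0.
have := ler_wpM2l (_ : 0 <= 2) h; rewrite ler0n => /(_ isT); apply: le_trans.
rewrite -[x ^+ 2](real_normK (num_real x)).
have := normr_ge0 x; set a := `|x| => a0.
have : 0 <= (a - 1) ^+ 2 by exact: sqr_ge0.
nra.
Qed.

(** As a function of k, the integral G satisfies G' = - (k / 2) G:
    differentiate under the integral sign and integrate x exp(- x^2) by parts.
    So G(k) exp(k^2 / 4) is constant. The phase c lets the cosine and sine
    transforms be treated at once. *)
Lemma gauss_cos_transform (c k : R) :
  \int[leb]_x (gauss x * cos (k * x + c)) =
  cos c * Num.sqrt pi * expR (- k ^+ 2 / 4).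
Proof.
pose G k := \int[leb]_x (gauss x * cos (k * x + c)).
have mphase (f : R -> R) (j : R) : continuous f -> measurable_fun setT (fun x => f (j * x + c)).
  move=> cf; apply: (measurableT_comp (f := f)); first exact: continuous_measurable_fun.
  apply: measurable_funD => //.
have mg : measurable_fun setT gauss by exact: measurable_gauss_fun.
have igc (f : R -> R) (j : R) : continuous f -> (forall x, `|f x| <= 1) ->
    leb.-integrable setT (EFin \o (fun x => gauss x * f (j * x + c))).
  move=> cf f1; apply: (@integrable_fun_dom _ _ _ leb _ _ gauss) => //.
  - by apply: measurable_funM => //; exact: mphase.
  - by move=> x _; rewrite normrM ger0_norm ?gauss_fun_ge0// ler_piMr// gauss_fun_ge0.
  - exact: integrableT_gauss.
have ixg (f : R -> R) (j : R) : continuous f -> (forall x, `|f x| <= 1) ->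
    leb.-integrable setT (EFin \o (fun x => x * gauss x * f (j * x + c))).
  move=> cf f1; apply: (@integrable_fun_dom _ _ _ leb _ _ (fun x => 2 * lorentz x)) => //.
  - by apply: measurable_funM => //; [exact: measurable_funM|exact: mphase].
  - move=> x _; rewrite !normrM; apply: le_trans (xgauss_lorentz x).
    by rewrite (ger0_norm (gauss_fun_ge0 _)) ler_piMr// mulr_ge0// gauss_fun_ge0.
  - exact: (integrableZl _ _ (@integrable_lorentz R)).
have cos1 (x : R) : `|cos x| <= 1 by rewrite ler_norml cos_geN1 cos_le1.
have sin1 (x : R) : `|sin x| <= 1 by rewrite ler_norml sin_geN1 sin_le1.
have ccos := @continuous_cos R. have csin := @continuous_sin R.
have clin (f : R -> R) (j : R) : continuous f -> continuous (fun x : R => f (j * x + c)).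
  move=> cf; apply: (@continuous_comp_fun _ _ (fun x : R => j * x + c)) => //.
  apply: continuousD_fun; last exact: continuous_cst_fun.
  by apply: continuousM_fun; [exact: continuous_cst_fun|move=> x; exact: cvg_id].
have parts k' : \int[leb]_x (x * gauss x * sin (k' * x + c)) = k' / 2 * G k'.
  have := @Rintegral_derive0 R (fun x => gauss x * sin (k' * x + c))
   (fun x => (- 2) * (x * gauss x * sin (k' * x + c)) +
             k' * (gauss x * cos (k' * x + c))) 1.
  rewrite RintegralD//; last 2 first.
    exact: (integrableZl _ _ (ixg _ _ csin sin1)).
    exact: (integrableZl _ _ (igc _ _ ccos cos1)).
  rewrite !RintegralZl//; try exact: (igc _ _ ccos cos1); try exact: (ixg _ _ csin sin1).
  rewrite -/(G k') => H.
  suff : - 2 * \int[leb]_x (x * gauss x * sin (k' * x + c)) + k' * G k' = 0 by lra.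
  apply: H.
  - move=> x; rewrite /gauss_fun.
    apply: dir_ext (dirM (dir_exp (dirZ (-1) (dirM (dir_id x) (dir_id x))))
      (dir_sin (dirD (dirZ k' (dir_id x)) (dir_cst c x (1 : R))))).
    + by move=> y /=; rewrite mulN1r.
    + by rewrite /= (_ : - 1 * (x * x) = - x ^+ 2); ring.
  - apply: continuousD_fun; apply: continuousM_fun.
    + exact: continuous_cst_fun.
    + apply: continuousM_fun; last exact: clin.
      by apply: continuousM_fun; [move=> x; exact: cvg_id|exact: continuous_gauss_fun].
    + exact: continuous_cst_fun.
    + by apply: continuousM_fun; [exact: continuous_gauss_fun|exact: clin].
  - move=> x; rewrite mul1r normrM ger0_norm ?gauss_fun_ge0//.
    by apply: le_trans (gauss_lorentz x); rewrite ler_piMr// gauss_fun_ge0.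
  - apply: integrableD_fun => //; apply: integrableZ_fun => //.
      exact: (ixg _ _ csin sin1).
    exact: (igc _ _ ccos cos1).
have dG k' : is_derive k' (1 : R) G (- (k' / 2) * G k').
  pose F (l x : R) := gauss x * cos (l * x + c).
  have dF l x : is_derive l (1 : R) (F ^~ x) (- (x * gauss x * sin (l * x + c))).
    apply: dir_ext (dirZ (gauss x) (dir_cos (dirD
      (dirM (dir_id l) (dir_cst x l (1 : R))) (dir_cst c l (1 : R))))) => //.
    by rewrite /=; ring.
  have p1 l x : partial1of2 F l x = - (x * gauss x * sin (l * x + c)).
    by rewrite partial1of2E; exact: dir_val (dF l x).
  have kI : `]k' - 1, k' + 1[%classic k' by rewrite /= in_itv /=; lra.
  have i1 l : `]k' - 1, k' + 1[%classic l -> leb.-integrable setT (EFin \o F l).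
    by move=> _; exact: (igc _ _ ccos cos1).
  have i2 (l x : R) : `]k' - 1, k' + 1[%classic l -> setT x -> derivable (F ^~ x) l 1.
    by move=> _ _; have [] := dF l x.
  have i3 (x : R) : 0 <= 2 * lorentz x by rewrite mulr_ge0// lorentz_ge0.
  have i4 := (integrableZl measurableT 2 (@integrable_lorentz R)).
  have i5 (l x : R) : `]k' - 1, k' + 1[%classic l -> setT x ->
      `|partial1of2 F l x| <= 2 * lorentz x.
    move=> _ _; rewrite p1 normrN !normrM; apply: le_trans (xgauss_lorentz x).
    by rewrite (ger0_norm (gauss_fun_ge0 _)) ler_piMr// mulr_ge0// gauss_fun_ge0.
  have H1 := derivable_under_integral measurableT kI i1 i2 i3 i4 i5.
  have H2 := differentiation_under_integral measurableT kI i1 i2 i3 i4 i5.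
  split => //; rewrite -derive1E H2.
  under eq_Rintegral do rewrite p1 -mulN1r.
  by rewrite RintegralZl// ?parts ?mulN1r ?mulNr//; exact: (ixg _ _ csin sin1).
pose K (l : R) := G l * expR (l ^+ 2 / 4).
have dK (l : R) : is_derive l (1 : R) K 0.
  apply: dir_ext (dirM (dG l) (dir_exp (dirZ (4^-1) (dirM (dir_id l) (dir_id l))))).
    by move=> x; rewrite /K; congr (_ * expR _); rewrite mulrC.
  by rewrite /=; field.
have G0 : G 0 = cos c * Num.sqrt pi.
  rewrite /G; under eq_Rintegral do rewrite mul0r add0r.
  rewrite RintegralZr//; last exact: integrableT_gauss.
  by rewrite mulrC /Rintegral integralT_gauss.
have := is_derive_0_is_cst k 0 dK; rewrite /K -/(G k) expr0n mul0r expR0 mulr1 G0.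
move=> <-; rewrite -mulrA -expRD -[LHS]mulr1; congr (_ * _).
by rewrite -[LHS]expR0; congr expR; field.
Qed.

End GaussianTransform.

(** * Complex derivatives and the Fourier transform in the plane *)

Section ComplexDirectional.
Variables (R : realType) (V : normedModType R).
Local Notation C := R[i].
Implicit Types (f g : V -> C) (p v : V).

Definition cdir p v f (l : C) : Prop :=
  is_derive p v (fun x => Re (f x)) (Re l) /\
  is_derive p v (fun x => Im (f x)) (Im l).

Lemma cdir_derivable p v f l : cdir p v f l -> cderivable f p v.
Proof. by move=> [[? _] [? _]]. Qed.

Lemma cdir_val p v f l : cdir p v f l -> cderive v f p = l.
Proof.
by move=> [/dir_val e1 /dir_val e2]; apply: complex_ext; rewrite /cderive /= ?e1 ?e2.
Qed.

Lemma cderivable_dir p v f : cderivable f p v -> cdir p v f (cderive v f p).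
Proof. by move=> [d1 d2]; split; apply: DeriveDef. Qed.

Lemma cdir_ext f g p v a b : f =1 g -> a = b -> cdir p v f a -> cdir p v g b.
Proof. by move=> /funext -> ->. Qed.

Lemma cdirM f g p v a b : cdir p v f a -> cdir p v g b ->
  cdir p v (fun x => f x * g x) (a * g p + f p * b).
Proof.
move=> [f1 f2] [g1 g2]; split.
  apply: dir_ext (dirD (dirM f1 g1) (dirZ (-1) (dirM f2 g2))) => [x|].
    by rewrite ReM mulN1r.
  by rewrite !cE; ring.
apply: dir_ext (dirD (dirM f1 g2) (dirM f2 g1)) => [x|].
  by rewrite ImM.
by rewrite !cE; ring.
Qed.

Lemma cdir_cst (c : C) p v : cdir p v (fun=> c) 0.
Proof. by split; exact: dir_cst. Qed.

Lemma cdirZ (c : C) f p v a : cdir p v f a -> cdir p v (fun x => c * f x) (c * a).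
Proof.
by move=> fa; apply: cdir_ext (cdirM (cdir_cst c p v) fa) => //; rewrite mul0r add0r.
Qed.

Lemma cdir_real (f : V -> R) p v a :
  is_derive p v f a -> cdir p v (fun x => (f x)%:C) a%:C.
Proof. by move=> fa; split => //; exact: dir_cst. Qed.

Lemma cdir_expi (f : V -> R) p v a : is_derive p v f a ->
  cdir p v (fun x => cexpi (f x)) ((0 +i* a) * cexpi (f p)).
Proof.
move=> fa; split => /=.
  by apply: dir_ext (dir_cos fa) => //; rewrite mul0r sub0r mulNr mulrC.
by apply: dir_ext (dir_sin fa) => //; rewrite mul0r add0r mulrC.
Qed.

End ComplexDirectional.

Section ComplexContinuity.
Variables (R : realType) (T : topologicalType).
Implicit Types (f g : T -> R[i]).

Definition ccontinuous f : Prop :=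
  continuous (fun x => Re (f x)) /\ continuous (fun x => Im (f x)).

Lemma ccontinuousD f g : ccontinuous f -> ccontinuous g ->
  ccontinuous (fun x => f x + g x).
Proof.
move=> [f1 f2] [g1 g2]; split.
  by under eq_fun do rewrite ReD; exact: continuousD_fun.
by under eq_fun do rewrite ImD; exact: continuousD_fun.
Qed.

Lemma continuousB_fun (f g : T -> R) : continuous f -> continuous g ->
  continuous (fun x => f x - g x).
Proof. by move=> cf cg x; apply: cvgB; [exact: cf|exact: cg]. Qed.

Lemma ccontinuousM f g : ccontinuous f -> ccontinuous g ->
  ccontinuous (fun x => f x * g x).
Proof.
move=> [f1 f2] [g1 g2]; split.
  by under eq_fun do rewrite ReM; apply: continuousB_fun; exact: continuousM_fun.
by under eq_fun do rewrite ImM; apply: continuousD_fun; exact: continuousM_fun.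
Qed.

Lemma ccontinuous_cst (c : R[i]) : ccontinuous (fun _ : T => c).
Proof. by split; exact: continuous_cst_fun. Qed.

Lemma ccontinuous_expi (f : T -> R) : continuous f ->
  ccontinuous (fun x => cexpi (f x)).
Proof.
move=> cf; split => /=; apply: continuous_comp_fun => //.
  exact: continuous_cos.
exact: continuous_sin.
Qed.

End ComplexContinuity.

Section IntegrationByParts.
Variable R : realType.
Local Notation C := R[i].
Local Notation leb := (@lebesgue_measure R).

Lemma ccontinuous_measurable (f : R -> C) : ccontinuous f -> cmeasurable f.
Proof. by move=> [f1 f2]; split; exact: continuous_measurable_fun. Qed.

Lemma ccontinuous_measurable2 (f : R * R -> C) : ccontinuous f -> cmeasurable f.
Proof. by move=> [f1 f2]; split; exact: continuous_measurable_fun2. Qed.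

Lemma cintegral_derive0 (h h' : R -> C) (c : R) :
  (forall x : R, cdir x (1 : R) h (h' x)) -> ccontinuous h' ->
  (forall x, cabs (h x) <= c * lorentz x) ->
  cintegrable leb setT h' -> cintegral leb setT h' = 0.
Proof.
move=> dh [c1 c2] hc [i1 i2]; apply: complex_ext => /=.
  apply: (@Rintegral_derive0 R (fun x => Re (h x)) _ c) => //.
    by move=> x; have [] := dh x.
  by move=> x; exact: le_trans (cabs_Re _) (hc x).
apply: (@Rintegral_derive0 R (fun x => Im (h x)) _ c) => //.
  by move=> x; have [] := dh x.
by move=> x; exact: le_trans (cabs_Im _) (hc x).
Qed.

Lemma integrable_cst_lorentz (c : R) :
  leb.-integrable setT (EFin \o (fun x => c * lorentz x)).
Proof. by apply: integrableZ_fun => //; exact: integrable_lorentz. Qed.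

Lemma dir_affine (a b x : R) : is_derive x (1 : R) (fun y => a * y + b) a.
Proof.
apply: dir_ext (dirD (dirZ a (dir_id x)) (dir_cst b x (1 : R))) => //.
by rewrite mulr1 addr0.
Qed.

Lemma continuous_affine (a b : R) : continuous (fun x => a * x + b).
Proof. by move=> x; exact: derive_continuous (dir_affine a b x). Qed.

Lemma measurable_affine (a b : R) : measurable_fun setT (fun x : R => a * x + b).
Proof. by apply: continuous_measurable_fun; exact: continuous_affine. Qed.

Lemma cintegral_parts (g g' : R -> C) (a b c c' : R) :
  (forall x : R, cdir x (1 : R) g (g' x)) -> ccontinuous g' ->
  (forall x, cabs (g x) <= c * lorentz x) ->
  (forall x, cabs (g' x) <= c' * lorentz x) ->
  cintegral leb setT (fun x => cexpi (a * x + b) * g' x) =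
  (0 +i* (- a)) * cintegral leb setT (fun x => cexpi (a * x + b) * g x).
Proof.
move=> dg cg' gc gc'.
have cg : ccontinuous g.
  by split=> x; have [d1 d2] := dg x; [exact: derive_continuous d1|exact: derive_continuous d2].
have cexp : ccontinuous (fun x : R => cexpi (a * x + b)).
  by apply: ccontinuous_expi; exact: continuous_affine.
have i1 : cintegrable leb setT (fun x => cexpi (a * x + b) * g x).
  apply: (cintegrable_dom _ _ _ (integrable_cst_lorentz c)) => //.
    by apply: ccontinuous_measurable; exact: ccontinuousM.
  by move=> x _; rewrite cabsM cabs_expi mul1r.
have i2 : cintegrable leb setT (fun x => cexpi (a * x + b) * g' x).
  apply: (cintegrable_dom _ _ _ (integrable_cst_lorentz c')) => //.
    by apply: ccontinuous_measurable; exact: ccontinuousM.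
  by move=> x _; rewrite cabsM cabs_expi mul1r.
have := @cintegral_derive0 (fun x => cexpi (a * x + b) * g x)
  (fun x => (0 +i* a) * (cexpi (a * x + b) * g x) + cexpi (a * x + b) * g' x) c.
have i3 := cintegrableZ measurableT (0 +i* a) i1.
rewrite (cintegralD measurableT i3 i2) (cintegralZ measurableT _ i1) => H.
have {}H : (0 +i* a) * cintegral leb setT (fun x => cexpi (a * x + b) * g x)
    + cintegral leb setT (fun x => cexpi (a * x + b) * g' x) = 0.
  apply: H.
  - move=> x; apply: cdir_ext (cdirM (cdir_expi (dir_affine a b x)) (dg x)) => //.
    by rewrite mulrA.
  - apply: ccontinuousD; last exact: ccontinuousM.
    by apply: ccontinuousM; [exact: ccontinuous_cst|exact: ccontinuousM].
  - by move=> x; rewrite cabsM cabs_expi mul1r.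
  - exact: (cintegrableD measurableT i3 i2).
rewrite (_ : 0 +i* (- a) = - (0 +i* a)); last first.
  by apply: complex_ext; rewrite cE /= ?oppr0.
by rewrite mulNr; apply/eqP; rewrite -addr_eq0 addrC H.
Qed.

End IntegrationByParts.

Section ProductSigmaFinite.
Context d1 d2 (T1 : measurableType d1) (T2 : measurableType d2) (R : realType).
Variable m1 : {sigma_finite_measure set T1 -> \bar R}.
Variable m2 : {sigma_finite_measure set T2 -> \bar R}.
Local Open Scope ereal_scope.

Lemma product_sigma_finite : sigma_finite setT (m1 \x m2).
Proof.
have /sigma_finiteP[F [TF ndF Foo]] := sigma_finiteT m1.
have /sigma_finiteP[G [TG ndG Goo]] := sigma_finiteT m2.
exists (fun n => F n `*` G n).
  rewrite -setXTT TF TG predeqE => -[x y]; split => [[/= [n _ Fnx] [k _ Gky]]|].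
    exists (maxn n k) => //; split.
    - by move: x Fnx; exact/subsetPset/ndF/leq_maxl.
    - by move: y Gky; exact/subsetPset/ndG/leq_maxr.
  by move=> [n _ []/= ? ?]; split; exists n.
move=> k; have [? ?] := Foo k; have [? ?] := Goo k.
split; first exact: measurableX.
by rewrite product_measure1E// lte_mul_pinfty// ge0_fin_numE.
Qed.

(** The product measure, packed with its sigma-finiteness so that the plane
    can itself be a factor in Fubini's theorem. *)
Definition product_sfm : {sigma_finite_measure set (T1 * T2)%type -> \bar R} :=
  HB.pack (m1 \x m2) (Measure_isSigmaFinite.Build _ _ _ (m1 \x m2) product_sigma_finite).

End ProductSigmaFinite.

Section PlaneIntegrals.
Variable R : realType.
Local Notation C := R[i].
Local Notation leb := (@lebesgue_measure R).
Implicit Types (f psi : R * R -> C).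

Definition plane_measure := product_sfm leb leb.

Definition lorentz2 (z : R * R) : R := lorentz z.1 * lorentz z.2.

Lemma lorentz2_ge0 z : 0 <= lorentz2 z.
Proof. by rewrite mulr_ge0// lorentz_ge0. Qed.

Lemma measurable_lorentz : measurable_fun setT (@lorentz R).
Proof. by apply: continuous_measurable_fun; exact: continuous_lorentz. Qed.

Lemma measurable_lorentz2 : measurable_fun setT lorentz2.
Proof.
by apply: measurable_funM; apply: (measurableT_comp measurable_lorentz).
Qed.

Lemma integrable_lorentz2 : (leb \x leb)%E.-integrable setT (EFin \o lorentz2).
Proof.
have := @integrable_restrictX R _ _ _ _ leb leb setT setT measurableT measurableT
  lorentz2 (@lorentz R) (@lorentz R) measurable_lorentz2.
rewrite setXTT patch_setT => H; apply: H; try exact: integrable_lorentz.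
by move=> x y _ _; rewrite ger0_norm// lorentz2_ge0.
Qed.

Lemma integrable_cst_lorentz2 (c : R) :
  (leb \x leb)%E.-integrable setT (EFin \o (fun z => c * lorentz2 z)).
Proof. by apply: integrableZ_fun => //; exact: integrable_lorentz2. Qed.

(** Any decay making the two iterated integrals converge would do; this one
    follows from four of the Schwartz seminorms. *)
Definition decays (c : R) f : Prop :=
  cmeasurable f /\ forall z, cabs (f z) <= c * lorentz2 z.

Lemma decaysJ c f : decays c f -> decays c (fun z => conjc (f z)).
Proof. by move=> [mf fc]; split=> [|z]; [exact: cmeasurableJ|rewrite cabsJ]. Qed.

Lemma decays_expi c f (h : R * R -> R) : measurable_fun setT h -> decays c f ->
  decays c (fun z => cexpi (h z) * f z).
Proof.
move=> mh [mf fc]; split=> [|z]; last by rewrite cabsM cabs_expi mul1r.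
by apply: cmeasurableM => //; exact: cmeasurable_expi.
Qed.

Lemma decays_integrable c f : decays c f -> cintegrable (leb \x leb)%E setT f.
Proof.
move=> [mf fc]; apply: (cintegrable_dom _ _ _ (integrable_cst_lorentz2 c)) => //.
Qed.

Lemma Rintegral_plane (f : R * R -> R) (c : R) : measurable_fun setT f ->
  (forall z, `|f z| <= c * lorentz2 z) ->
  Rintegral (leb \x leb)%E setT f = \int[leb]_x \int[leb]_y f (x, y) /\
  Rintegral (leb \x leb)%E setT f = \int[leb]_y \int[leb]_x f (x, y).
Proof.
move=> mf fc.
have fgh (x y : R) : setT x -> setT y -> `|f (x, y)| <= c * lorentz x * lorentz y.
  by move=> _ _; rewrite -mulrA; exact: fc.
have ig := integrable_cst_lorentz c. have ih := @integrable_lorentz R.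
have H := @integrable_restrictX R _ _ _ _ leb leb setT setT measurableT measurableT
  f _ _ mf fgh ig ih.
rewrite setXTT patch_setT in H.
split; rewrite /Rintegral; congr fine.
  rewrite -(integral12_prod_meas1 H); apply: eq_integral => x _.
  rewrite /fubini_F fineK//; apply: integrable_fin_num => //.
  exact: (integrable_sec1 (m2 := leb) measurableT mf fgh ih).
rewrite -(integral21_prod_meas1 H); apply: eq_integral => y _.
rewrite /fubini_G fineK//; apply: integrable_fin_num => //.
exact: (integrable_sec2 (m1 := leb) measurableT mf fgh ig).
Qed.

Lemma planeint_iter c f : decays c f ->
  planeint f = cintegral leb setT (fun x => cintegral leb setT (fun y => f (x, y))).
Proof.
move=> [[m1 m2] fc]; apply: complex_ext => /=.
  by apply: (proj1 (@Rintegral_plane _ c m1 _)) => z; exact: le_trans (cabs_Re _) (fc z).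
by apply: (proj1 (@Rintegral_plane _ c m2 _)) => z; exact: le_trans (cabs_Im _) (fc z).
Qed.

Lemma planeint_iter_swap c f : decays c f ->
  planeint f = cintegral leb setT (fun y => cintegral leb setT (fun x => f (x, y))).
Proof.
move=> [[m1 m2] fc]; apply: complex_ext => /=.
  by apply: (proj2 (@Rintegral_plane _ c m1 _)) => z; exact: le_trans (cabs_Re _) (fc z).
by apply: (proj2 (@Rintegral_plane _ c m2 _)) => z; exact: le_trans (cabs_Im _) (fc z).
Qed.

Definition lorentz2_mass : R := Rintegral (leb \x leb)%E setT lorentz2.

Lemma cabs_planeint_le c f : decays c f ->
  cabs (planeint f) <= 2 * (c * lorentz2_mass).
Proof.
move=> [mf fc].
have := cabs_cintegral_le (mu := (leb \x leb)%E) measurableT mf (fun x _ => fc x) (integrable_cst_lorentz2 c).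
by rewrite RintegralZl//; exact: integrable_lorentz2.
Qed.

Lemma measurable_dot (k : R * R) :
  measurable_fun setT (fun x : R * R => - (k.1 * x.1 + k.2 * x.2)).
Proof.
apply: measurableT_comp => //; by apply: measurable_funD; apply: measurable_funM.
Qed.

Lemma decays_fourier_integrand c f k : decays c f ->
  decays c (fun x => cexpi (- (k.1 * x.1 + k.2 * x.2)) * f x).
Proof. by apply: decays_expi; exact: measurable_dot. Qed.

Lemma fourier2_bound c f k : decays c f ->
  cabs (fourier2 f k) <= c * (pi^-1 * lorentz2_mass).
Proof.
move=> fc; have p0 : 0 < pi :> R by exact: pi_gt0.
have p2 : 0 <= (pi *+ 2 : R)^-1.
  by rewrite invr_ge0 -mulr_natl mulr_ge0// ltW.
rewrite /fourier2 cabsM cabsR ger0_norm//.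
apply: (le_trans (ler_wpM2l p2 (cabs_planeint_le (decays_fourier_integrand k fc)))).
move: p0; rewrite -(mulr_natl pi); move: (pi : R) => p p0.
by rewrite le_eqVlt; apply/orP; left; apply/eqP; field; exact: lt0r_neq0.
Qed.

Lemma fourier2D c c' f g k a : decays c f -> decays c' g ->
  fourier2 (fun x => a * f x + g x) k = a * fourier2 f k + fourier2 g k.
Proof.
move=> fc gc; rewrite /fourier2 /planeint.
have i1 := decays_integrable (decays_fourier_integrand k fc).
have i2 := decays_integrable (decays_fourier_integrand k gc).
rewrite mulrCA -mulrDr; congr (_ * _).
rewrite -(cintegralZ measurableT a i1).
rewrite -(cintegralD measurableT (cintegrableZ measurableT a i1) i2).
by apply: eq_cintegral => x _; ring.
Qed.

Lemma fourier2_measurable f : cmeasurable f -> cmeasurable (fourier2 f).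
Proof.
move=> mf; apply: cmeasurableM; first exact: cmeasurable_cst.
pose F (z : (R * R) * (R * R)) :=
  cexpi (- (z.1.1 * z.2.1 + z.1.2 * z.2.2)) * f z.2.
suff mF : cmeasurable F.
  have := @cmeasurable_cintegral_param R _ _ _ _ plane_measure setT measurableT F mF.
  exact.
apply: cmeasurableM.
  apply: cmeasurable_expi; apply: measurableT_comp => //.
  apply: measurable_funD; apply: measurable_funM => //.
  - exact: (measurableT_comp measurable_fst measurable_fst).
  - exact: (measurableT_comp measurable_fst measurable_snd).
  - exact: (measurableT_comp measurable_snd measurable_fst).
  - exact: (measurableT_comp measurable_snd measurable_snd).
exact: (cmeasurable_comp mf measurable_snd).
Qed.

Lemma cdir_sec1 f x y l : cdir (x, y) ((1, 0) : R * R) f l ->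
  cdir x (1 : R) (fun t => f (t, y)) l.
Proof.
have e (h : R) : h *: ((1, 0) : R * R) + (x, y) = (h *: (1 : R) + x, y).
  by congr (_, _); rewrite /= scaler0 add0r.
by move=> [/dir_line d1 /dir_line d2]; split; apply/dir_line; under eq_fun do rewrite -e.
Qed.

Lemma cdir_sec2 f x y l : cdir (x, y) ((0, 1) : R * R) f l ->
  cdir y (1 : R) (fun t => f (x, t)) l.
Proof.
have e (h : R) : h *: ((0, 1) : R * R) + (x, y) = (x, h *: (1 : R) + y).
  by congr (_, _); rewrite /= scaler0 add0r.
by move=> [/dir_line d1 /dir_line d2]; split; apply/dir_line; under eq_fun do rewrite -e.
Qed.

Lemma continuous_sec1 (f : R * R -> R) y : continuous f -> continuous (fun x => f (x, y)).
Proof.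
move=> cf x.
have xy : (x', y) @[x' --> x] --> (x, y).
  by apply: (@cvg_pair _ _ _ _ (nbhs x) (nbhs y)); [exact: cvg_id|exact: cvg_cst].
have := cvg_comp _ f xy (cf (x, y)).
exact.
Qed.

Lemma continuous_sec2 (f : R * R -> R) x : continuous f -> continuous (fun y => f (x, y)).
Proof.
move=> cf y.
have xy : (x, y') @[y' --> y] --> (x, y).
  by apply: (@cvg_pair _ _ _ _ (nbhs x) (nbhs y)); [exact: cvg_cst|exact: cvg_id].
have := cvg_comp _ f xy (cf (x, y)).
exact.
Qed.

Lemma decays_sec1 c f y x : decays c f -> cabs (f (x, y)) <= (c * lorentz y) * lorentz x.
Proof. by move=> [_ fc]; rewrite mulrAC -mulrA; exact: fc. Qed.

Lemma decays_sec2 c f y x : decays c f -> cabs (f (x, y)) <= (c * lorentz x) * lorentz y.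
Proof. by move=> [_ fc]; rewrite -mulrA; exact: fc. Qed.

(** Integration by parts along each horizontal line. *)
Lemma fourier2_derive1 c c' f g k : decays c f -> decays c' g -> ccontinuous g ->
  (forall z, cdir z ((1, 0) : R * R) f (g z)) ->
  fourier2 g k = (0 +i* k.1) * fourier2 f k.
Proof.
move=> fc gc [g1 g2] dfg; rewrite /fourier2 mulrCA; congr (_ * _).
rewrite (planeint_iter_swap (decays_fourier_integrand k gc)).
rewrite (planeint_iter_swap (decays_fourier_integrand k fc)).
pose E (z : R * R) := cexpi (- (k.1 * z.2 + k.2 * z.1)) * f (z.2, z.1).
have mE : cmeasurable E.
  have [mEf _] := decays_fourier_integrand k fc.
  have ms : measurable_fun setT (fun z : R * R => (z.2, z.1)).
    by apply: measurable_fun_pair.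
  exact: (cmeasurable_comp mEf ms).
have bE (y x : R) : setT y -> setT x -> cabs (E (y, x)) <= c * lorentz y * lorentz x.
  by move=> _ _; rewrite cabsM cabs_expi mul1r; exact: decays_sec1.
have iE := @cintegrable_cintegral1 R _ _ _ _ leb leb setT setT measurableT measurableT
  E _ _ mE bE (integrable_cst_lorentz c) (@integrable_lorentz R).
rewrite -(cintegralZ measurableT _ iE); apply: eq_cintegral => y _ /=.
have e x : - (k.1 * x + k.2 * y) = - k.1 * x + - (k.2 * y) by ring.
under eq_cintegral do rewrite e.
rewrite /E /=; under [in RHS]eq_cintegral do rewrite e.
rewrite (@cintegral_parts R (fun x => f (x, y)) (fun x => g (x, y)) _ _
  (c * lorentz y) (c' * lorentz y)) ?opprK//.
- by move=> x; apply: cdir_sec1; exact: dfg.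
- by split; [exact: (continuous_sec1 (f := fun z => Re (g z)))|exact: (continuous_sec1 (f := fun z => Im (g z)))].
- by move=> x; exact: decays_sec1.
- by move=> x; exact: decays_sec1.
Qed.

Lemma fourier2_derive2 c c' f g k : decays c f -> decays c' g -> ccontinuous g ->
  (forall z, cdir z ((0, 1) : R * R) f (g z)) ->
  fourier2 g k = (0 +i* k.2) * fourier2 f k.
Proof.
move=> fc gc [g1 g2] dfg; rewrite /fourier2 mulrCA; congr (_ * _).
rewrite (planeint_iter (decays_fourier_integrand k gc)).
rewrite (planeint_iter (decays_fourier_integrand k fc)).
pose E (z : R * R) := cexpi (- (k.1 * z.1 + k.2 * z.2)) * f z.
have mE : cmeasurable E by have [] := decays_fourier_integrand k fc.
have bE (x y : R) : setT x -> setT y -> cabs (E (x, y)) <= c * lorentz x * lorentz y.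
  by move=> _ _; rewrite cabsM cabs_expi mul1r; exact: decays_sec2.
have iE := @cintegrable_cintegral1 R _ _ _ _ leb leb setT setT measurableT measurableT
  E _ _ mE bE (integrable_cst_lorentz c) (@integrable_lorentz R).
rewrite -(cintegralZ measurableT _ iE); apply: eq_cintegral => x _ /=.
have e y : - (k.1 * x + k.2 * y) = - k.2 * y + - (k.1 * x) by ring.
under eq_cintegral do rewrite e.
rewrite /E /=; under [in RHS]eq_cintegral do rewrite e.
rewrite (@cintegral_parts R (fun y => f (x, y)) (fun y => g (x, y)) _ _
  (c * lorentz x) (c' * lorentz x)) ?opprK//.
- by move=> y; apply: cdir_sec2; exact: dfg.
- by split; [exact: (continuous_sec2 (f := fun z => Re (g z)))|exact: (continuous_sec2 (f := fun z => Im (g z)))].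
- by move=> y; exact: decays_sec2.
- by move=> y; exact: decays_sec2.
Qed.

End PlaneIntegrals.

(** * Schwartz functions and test functions *)

Section Schwartz.
Variable R : realType.
Local Notation C := R[i].
Implicit Types (psi : R * R -> C).

Lemma cderives_rcons (V : normedModType R) (s : seq V) v (f : V -> C) :
  cderives (rcons s v) f = cderives s (cderive v f).
Proof. by rewrite /cderives foldr_rcons. Qed.

Lemma smooth_cderive (V : normedModType R) (B : seq V) v (f : V -> C) :
  v \in B -> smooth B f -> smooth B (cderive v f).
Proof.
move=> vB sf s sB; rewrite -cderives_rcons; apply: sf => w.
by rewrite mem_rcons inE => /orP[/eqP ->//|]; exact: sB.
Qed.

Lemma smooth_continuous (V : normedModType R) (B : seq V) (f : V -> C) :
  smooth B f -> ccontinuous f.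
Proof. by move=> /(_ [::]) []. Qed.

Lemma smooth_cdir (V : normedModType R) (B : seq V) v (f : V -> C) x :
  v \in B -> smooth B f -> cdir x v f (cderive v f x).
Proof. by move=> vB /(_ [::]) [] // _ _ /(_ v x vB) /cderivable_dir. Qed.

Lemma decays_ge0 c psi : decays c psi -> 0 <= c.
Proof.
move=> [_ /(_ (0, 0))] h; have := le_trans (cabs_ge0 _) h.
by rewrite pmulr_lge0// /lorentz2 mulr_gt0// lorentz_gt0.
Qed.

(** Each of the four terms of (1 + x^2)(1 + y^2) = 1 + x^2 + y^2 + x^2 y^2 is
    controlled by one seminorm. *)
Lemma seminorms_decays psi (M00 M20 M02 M22 : R) : cmeasurable psi ->
  seminorm2_le 0 0 [::] psi M00 -> seminorm2_le 2 0 [::] psi M20 ->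
  seminorm2_le 0 2 [::] psi M02 -> seminorm2_le 2 2 [::] psi M22 ->
  decays (M00 + M20 + M02 + M22) psi.
Proof.
move=> mpsi h00 h20 h02 h22; split => // -[x y].
have := h00 (x, y); have := h20 (x, y); have := h02 (x, y); have := h22 (x, y).
rewrite /lorentz2 /lorentz /= -invfM ler_pdivlMr; last first.
  by rewrite mulr_gt0// oneDsqr_gt0.
rewrite /= !real_normK ?num_real// ?expr0 ?mul1r ?mulr1 /oneDsqr.
set n := cabs _ => k22 k02 k20 k00.
have -> : n * ((1 + x ^+ 2) * (1 + y ^+ 2)) =
   n + x ^+ 2 * n + y ^+ 2 * n + x ^+ 2 * y ^+ 2 * n by ring.
by apply: lerD => //; apply: lerD => //; exact: lerD.
Qed.

Lemma schwartz2_continuous psi : schwartz2 psi -> ccontinuous psi.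
Proof. by move=> [sm _]; exact: smooth_continuous sm. Qed.

Lemma schwartz2_decays psi : schwartz2 psi -> exists c, decays c psi.
Proof.
move=> sp; have mpsi := ccontinuous_measurable2 (schwartz2_continuous sp).
have sB : {subset [::] <= @basis2 R} by [].
have [_ bd] := sp.
have [M00 h00] := bd 0%N 0%N [::] sB. have [M20 h20] := bd 2%N 0%N [::] sB.
have [M02 h02] := bd 0%N 2%N [::] sB. have [M22 h22] := bd 2%N 2%N [::] sB.
by exists (M00 + M20 + M02 + M22); exact: seminorms_decays.
Qed.

End Schwartz.

Section Slices.
Variable R : realType.
Local Notation C := R[i].
Local Notation V3 := ((R * R) * R)%type.
Implicit Types (chi : V3 -> C).

(** Test functions on R^2 x S^1, up to periodicity in theta. *)
Definition rapid chi : Prop :=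
  smooth (@basis3 R) chi /\
  forall (a b : nat) (s : seq V3), {subset s <= @basis3 R} ->
    exists M : R, forall p : V3,
      `|p.1.1| ^+ a * `|p.1.2| ^+ b * cabs (cderives s chi p) <= M.

Lemma testSE2_rapid chi : testSE2 chi -> rapid chi.
Proof. by case. Qed.

Lemma rapid_cderive v chi : v \in @basis3 R -> rapid chi -> rapid (cderive v chi).
Proof.
move=> vB [sm bd]; split; first exact: smooth_cderive.
move=> a b s sB; have [|M HM] := bd a b (rcons s v).
  by move=> w; rewrite mem_rcons inE => /orP[/eqP ->//|]; exact: sB.
by exists M => z; rewrite -cderives_rcons; exact: HM.
Qed.

Lemma dir_slice (F : V3 -> R) (q v : R * R) (theta a : R) :
  is_derive q v (fun q => F (q, theta)) a <-> is_derive (q, theta) (v, 0 : R) F a.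
Proof.
have e (h : R) : (h *: v + q, theta) = h *: (v, 0) + (q, theta) :> V3.
  by congr (_, _); rewrite /= scaler0 add0r.
have ee : (fun h : R => F (h *: v + q, theta)) =
  (fun h : R => F (h *: (v, 0) + (q, theta))) by apply/funext => h; rewrite e.
split => /dir_line dF; apply/dir_line; first by rewrite -ee.
by move: dF; rewrite -ee.
Qed.

Lemma derive_slice (F : V3 -> R) (q v : R * R) theta :
  'D_v (fun q => F (q, theta)) q = 'D_(v, 0 : R) F (q, theta).
Proof.
have e : (fun h : R => h^-1 *: (((fun q => F (q, theta)) \o shift q) (h *: v)
      - F (q, theta))) =
    (fun h : R => h^-1 *: ((F \o shift (q, theta)) (h *: (v, 0)) - F (q, theta))).
  apply/funext => h /=; congr (_ *: (F (_, _) - _)).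
  by rewrite /= scaler0 add0r.
by rewrite /derive e.
Qed.

Lemma cderive_slice chi (q v : R * R) theta :
  cderive v (fun q => chi (q, theta)) q = cderive (v, 0) chi (q, theta).
Proof.
rewrite /cderive (derive_slice (fun p => Re (chi p))).
by rewrite (derive_slice (fun p => Im (chi p))).
Qed.

Lemma cderives_slice chi s theta :
  cderives s (fun q => chi (q, theta)) =
  (fun q => cderives [seq (v, 0) | v <- s] chi (q, theta)).
Proof.
elim: s => [//|v s IHs] /=; rewrite IHs; apply/funext => q.
exact: (cderive_slice (cderives [seq (v, 0) | v <- s] chi)).
Qed.

Lemma continuous_slice (F : V3 -> R) theta :
  continuous F -> continuous (fun q => F (q, theta)).
Proof.
move=> cF q.
have qt : (q', theta) @[q' --> q] --> (q, theta).
  by apply: (@cvg_pair _ _ _ _ (nbhs q) (nbhs theta)); [exact: cvg_id|exact: cvg_cst].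
have := cvg_comp _ F qt (cF (q, theta)).
exact.
Qed.

Lemma basis3_slice (v : R * R) : v \in @basis2 R -> (v, 0) \in @basis3 R.
Proof. by rewrite !inE => /orP[/eqP ->|/eqP ->]; rewrite eqxx// orbT. Qed.

Lemma rapid_slice chi theta : rapid chi -> schwartz2 (fun q => chi (q, theta)).
Proof.
have sub s : {subset s <= @basis2 R} -> {subset [seq (v, 0 : R) | v <- s] <= @basis3 R}.
  by move=> sB _ /mapP[v /sB vB ->]; exact: basis3_slice.
move=> [sm bd]; split.
  move=> s sB; rewrite cderives_slice; have [c1 c2 d] := sm _ (sub s sB); split.
  - exact: (continuous_slice (F := fun p => Re (cderives _ chi p))).
  - exact: (continuous_slice (F := fun p => Im (cderives _ chi p))).
  move=> v q vB; have [d1 d2] := d (v, 0) (q, theta) (basis3_slice vB).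
  by split; [have /dir_slice [] := DeriveDef d1 erefl|have /dir_slice [] := DeriveDef d2 erefl].
move=> a b s sB; have [M HM] := bd a b _ (sub s sB).
by exists M => q; rewrite cderives_slice; exact: (HM (q, theta)).
Qed.

Lemma rapid_decays chi : rapid chi ->
  exists c, forall theta, decays c (fun q => chi (q, theta)).
Proof.
move=> rc; have [_ bd] := rc; have sB : {subset [::] <= @basis3 R} by [].
have [M00 h00] := bd 0%N 0%N [::] sB. have [M20 h20] := bd 2%N 0%N [::] sB.
have [M02 h02] := bd 0%N 2%N [::] sB. have [M22 h22] := bd 2%N 2%N [::] sB.
exists (M00 + M20 + M02 + M22) => theta; apply: seminorms_decays.
- apply: ccontinuous_measurable2; apply: schwartz2_continuous.
  exact: rapid_slice.
- by move=> q; exact: (h00 (q, theta)).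
- by move=> q; exact: (h20 (q, theta)).
- by move=> q; exact: (h02 (q, theta)).
- by move=> q; exact: (h22 (q, theta)).
Qed.

Lemma dq1_basis3 : @dq1 R \in @basis3 R. Proof. by rewrite !inE eqxx. Qed.
Lemma dq2_basis3 : @dq2 R \in @basis3 R. Proof. by rewrite !inE eqxx orbT. Qed.
Lemma dtheta_basis3 : @dtheta R \in @basis3 R. Proof. by rewrite !inE eqxx !orbT. Qed.

Lemma fourier2_dq1 chi theta k : rapid chi ->
  fourier2 (fun q => cderive (@dq1 R) chi (q, theta)) k =
  (0 +i* k.1) * fourier2 (fun q => chi (q, theta)) k.
Proof.
move=> rc; have rd := rapid_cderive dq1_basis3 rc.
have [c hc] := rapid_decays rc; have [c' hc'] := rapid_decays rd.
apply: (fourier2_derive1 k (hc theta) (hc' theta)).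
  exact: schwartz2_continuous (rapid_slice theta rd).
move=> q; have [d1 d2] := smooth_cdir (q, theta) dq1_basis3 (proj1 rc).
by split; apply/dir_slice.
Qed.

Lemma fourier2_dq2 chi theta k : rapid chi ->
  fourier2 (fun q => cderive (@dq2 R) chi (q, theta)) k =
  (0 +i* k.2) * fourier2 (fun q => chi (q, theta)) k.
Proof.
move=> rc; have rd := rapid_cderive dq2_basis3 rc.
have [c hc] := rapid_decays rc; have [c' hc'] := rapid_decays rd.
apply: (fourier2_derive2 k (hc theta) (hc' theta)).
  exact: schwartz2_continuous (rapid_slice theta rd).
move=> q; have [d1 d2] := smooth_cdir (q, theta) dq2_basis3 (proj1 rc).
by split; apply/dir_slice.
Qed.

End Slices.

(** * Trigonometric multiples of a Gaussian *)

Section TameFunctions.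
Variable R : realType.
Local Notation C := R[i].
Local Notation V3 := ((R * R) * R)%type.
Local Notation gauss := (@gauss_fun R).

(** An algebra of coefficient functions, stable under derivation and of
    polynomial growth in q, large enough to contain the coefficients of the
    test functions built from Gaussians below. *)
Inductive tame : (V3 -> R) -> Prop :=
| tame_cst c : tame (fun=> c)
| tame_q1 : tame (fun p => p.1.1)
| tame_q2 : tame (fun p => p.1.2)
| tame_trig w b : tame (fun p => cos (w * p.2 + b))
| tame_exp a b : tame (fun p => expR (a * cos p.2 + b * sin p.2))
| tameD f g : tame f -> tame g -> tame (fun p => f p + g p)
| tameM f g : tame f -> tame g -> tame (fun p => f p * g p)
| tame_cos f : tame f -> tame (fun p => cos (f p))
| tame_sin f : tame f -> tame (fun p => sin (f p)).

Lemma dir_fst1 (p v : V3) : is_derive p v (fun x : V3 => x.1.1) v.1.1.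
Proof.
apply/dir_line; apply: dir_ext (dir_affine v.1.1 p.1.1 0) => // h /=.
by rewrite mulrC.
Qed.

Lemma dir_fst2 (p v : V3) : is_derive p v (fun x : V3 => x.1.2) v.1.2.
Proof.
apply/dir_line; apply: dir_ext (dir_affine v.1.2 p.1.2 0) => // h /=.
by rewrite mulrC.
Qed.

Lemma dir_snd (p v : V3) : is_derive p v (fun x : V3 => x.2) v.2.
Proof.
apply/dir_line; apply: dir_ext (dir_affine v.2 p.2 0) => // h /=.
by rewrite mulrC.
Qed.

Lemma tame_ext f g : f =1 g -> tame f -> tame g.
Proof. by move=> /funext ->. Qed.

Lemma sin_cos_shift (x : R) : sin x = cos (x + - (pi / 2)).
Proof. by rewrite cosD cosN sinN cos_pihalf sin_pihalf mulr0 mulrN1 opprK add0r. Qed.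

Lemma tame_cos2 : tame (fun p => cos p.2).
Proof. by apply: tame_ext (tame_trig 1 0) => p; rewrite mul1r addr0. Qed.

Lemma tame_sin2 : tame (fun p => sin p.2).
Proof.
by apply: tame_ext (tame_trig 1 (- (pi / 2))) => p; rewrite mul1r -sin_cos_shift.
Qed.

Lemma tame_dir f v : tame f ->
  exists2 f', tame f' & forall p, is_derive p v f (f' p).
Proof.
elim => {f}.
- by move=> c; exists (fun=> 0); [exact: tame_cst|move=> p; exact: dir_cst].
- by exists (fun=> v.1.1); [exact: tame_cst|move=> p; exact: dir_fst1].
- by exists (fun=> v.1.2); [exact: tame_cst|move=> p; exact: dir_fst2].
- move=> w b; exists (fun p => (- (w * v.2)) * cos (w * p.2 + (b + - (pi / 2)))).
    by apply: tameM; [exact: tame_cst|exact: tame_trig].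
  move=> p; apply: dir_ext (dir_cos (dirD (dirZ w (dir_snd p v)) (dir_cst b p v))) => //.
  by rewrite addrA -sin_cos_shift; ring.
- move=> a b; exists (fun p => expR (a * cos p.2 + b * sin p.2) *
    ((- (a * v.2)) * sin p.2 + b * v.2 * cos p.2)).
    apply: tameM; first exact: tame_exp.
    apply: tameD; apply: tameM; try exact: tame_cst; [exact: tame_sin2|exact: tame_cos2].
  move=> p; apply: dir_ext (dir_exp (dirD (dirZ a (dir_cos (dir_snd p v)))
    (dirZ b (dir_sin (dir_snd p v))))) => //.
  by rewrite /=; ring.
- move=> f g tf [f' tf' df] tg [g' tg' dg].
  exists (fun p => f' p + g' p); first exact: tameD.
  by move=> p; exact: dirD.
- move=> f g tf [f' tf' df] tg [g' tg' dg].
  exists (fun p => f' p * g p + f p * g' p).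
    by apply: tameD; exact: tameM.
  by move=> p; exact: dirM.
- move=> f tf [f' tf' df]; exists (fun p => ((-1) * sin (f p)) * f' p).
    by apply: tameM => //; apply: tameM; [exact: tame_cst|exact: tame_sin].
  by move=> p; rewrite mulN1r; exact: dir_cos.
- move=> f tf [f' tf' df]; exists (fun p => cos (f p) * f' p).
    by apply: tameM => //; exact: tame_cos.
  by move=> p; exact: dir_sin.
Qed.

Lemma continuous_snd2 : continuous (fun p : V3 => p.2).
Proof. by move=> p; exact: cvg_snd. Qed.

Lemma continuous_q1 : continuous (fun p : V3 => p.1.1).
Proof.
move=> p; apply: (@continuous_comp _ _ _ (fun x : V3 => x.1) (fun q : R * R => q.1)).
  exact: cvg_fst.
exact: cvg_fst.
Qed.

Lemma continuous_q2 : continuous (fun p : V3 => p.1.2).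
Proof.
move=> p; apply: (@continuous_comp _ _ _ (fun x : V3 => x.1) (fun q : R * R => q.2)).
  exact: cvg_fst.
exact: cvg_snd.
Qed.

Lemma tame_continuous f : tame f -> continuous f.
Proof.
have cos_c := @continuous_cos R. have sin_c := @continuous_sin R.
have c2 (G : R -> R) : continuous G -> continuous (fun p : V3 => G p.2).
  by move=> cG; apply: continuous_comp_fun => //; exact: continuous_snd2.
elim => {f}.
- by move=> c; exact: continuous_cst_fun.
- exact: continuous_q1.
- exact: continuous_q2.
- move=> w b; apply: (c2 (fun t => cos (w * t + b))).
  by apply: continuous_comp_fun => //; exact: continuous_affine.
- move=> a b; apply: (c2 (fun t => expR (a * cos t + b * sin t))).
  apply: continuous_comp_fun; last exact: continuous_expR.
  by apply: continuousD_fun; apply: continuousM_fun => //; exact: continuous_cst_fun.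
- by move=> f g _ cf _ cg; exact: continuousD_fun.
- by move=> f g _ cf _ cg; exact: continuousM_fun.
- by move=> f _ cf; exact: continuous_comp_fun.
- by move=> f _ cf; exact: continuous_comp_fun.
Qed.

Definition weight (p : V3) : R := (1 + `|p.1.1|) * (1 + `|p.1.2|).

Lemma weight_ge1 p : 1 <= weight p.
Proof. by rewrite /weight mulr_ege1// lerDl. Qed.

Lemma tame_growth f : tame f ->
  exists (c : R) (n : nat), 0 <= c /\ forall p, `|f p| <= c * weight p ^+ n.
Proof.
have bdd (g : V3 -> R) (c : R) : (forall p, `|g p| <= c) ->
    exists (c : R) (n : nat), 0 <= c /\ forall p, `|g p| <= c * weight p ^+ n.
  move=> gc; exists c, 0%N; split; first exact: le_trans (gc ((0,0),0)).
  by move=> p; rewrite expr0 mulr1.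
have cos1 (x : R) : `|cos x| <= 1 by rewrite ler_norml cos_geN1 cos_le1.
have sin1 (x : R) : `|sin x| <= 1 by rewrite ler_norml sin_geN1 sin_le1.
elim => {f}.
- by move=> c; exact: (bdd _ `|c|).
- exists 1, 1%N; split => // p; rewrite mul1r expr1 /weight.
  by move: (normr_ge0 p.1.1) (normr_ge0 p.1.2); nra.
- exists 1, 1%N; split => // p; rewrite mul1r expr1 /weight.
  by move: (normr_ge0 p.1.1) (normr_ge0 p.1.2); nra.
- by move=> w b; exact: (bdd _ 1).
- move=> a b; apply: (bdd _ (expR (`|a| + `|b|))) => p.
  rewrite ger0_norm ?expR_ge0// ler_expR; apply: (le_trans (ler_norm _)).
  apply: (le_trans (ler_normD _ _)); rewrite !normrM.
  by apply: lerD; rewrite ler_piMr.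
- move=> f g _ [c [n [c0 fc]]] _ [d [m [d0 gd]]].
  exists (c + d), (n + m)%N; split => [|p]; first exact: addr_ge0.
  apply: (le_trans (ler_normD _ _)); rewrite mulrDl.
  have w1 := weight_ge1 p.
  apply: lerD.
    apply: (le_trans (fc p)); rewrite ler_wpM2l// ler_weXn2l//.
    exact: leq_addr.
  apply: (le_trans (gd p)); rewrite ler_wpM2l// ler_weXn2l//.
  exact: leq_addl.
- move=> f g _ [c [n [c0 fc]]] _ [d [m [d0 gd]]].
  exists (c * d), (n + m)%N; split => [|p]; first exact: mulr_ge0.
  by rewrite normrM exprD mulrACA; exact: ler_pM.
- by move=> f _ _; exact: (bdd _ 1).
- by move=> f _ _; exact: (bdd _ 1).
Qed.

(** From 1 + x <= exp x at x = y / (n + 1), raised to the power n + 1. *)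
Lemma expR_ge_pow (y : R) (n : nat) : 0 <= y ->
  y ^+ n.+1 <= n.+1%:R ^+ n.+1 * expR y.
Proof.
move=> y0.
have n0 : 0 < n.+1%:R :> R by rewrite ltr0n.
have -> : expR y = expR (y / n.+1%:R) ^+ n.+1.
  by rewrite -expRM_natr divfK// gt_eqF.
rewrite -exprMn lerXn2r ?nnegrE ?mulr_ge0 ?expR_ge0 ?ler0n//.
rewrite -ler_pdivrMl// mulrC; apply: le_trans (expR_ge1Dx _).
by rewrite lerDr.
Qed.

Lemma pow_gauss_bounded (n : nat) : exists2 c : R, 0 <= c &
  forall x, (1 + `|x|) ^+ n * gauss x <= c.
Proof.
exists (n.+1%:R ^+ n.+1 * expR 2).
  by rewrite mulr_ge0 ?expR_ge0// exprn_ge0.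
move=> x; have y0 : 0 <= 1 + `|x| by rewrite addr_ge0.
apply: (@le_trans _ _ ((1 + `|x|) ^+ n.+1 * gauss x)).
  rewrite ler_wpM2r ?gauss_fun_ge0// ler_weXn2l// lerDl //.
apply: (@le_trans _ _ (n.+1%:R ^+ n.+1 * expR (1 + `|x|) * gauss x)).
  by rewrite ler_wpM2r ?gauss_fun_ge0// expR_ge_pow.
rewrite -mulrA ler_wpM2l ?exprn_ge0// /gauss_fun -expRD ler_expR.
rewrite -(real_normK (num_real x)); move: `|x| => a.
by have := sqr_ge0 (2 * a - 1); nra.
Qed.

Definition gauss3 (p : V3) : R := gauss p.1.1 * gauss p.1.2.

Lemma gauss3_ge0 p : 0 <= gauss3 p.
Proof. by rewrite mulr_ge0// gauss_fun_ge0. Qed.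

Lemma dir_gauss3 p v : is_derive p v gauss3
  (- 2 * (v.1.1 * p.1.1 + v.1.2 * p.1.2) * gauss3 p).
Proof.
have e x : -1 * (x * x) = - x ^+ 2 :> R by rewrite mulN1r.
apply: dir_ext (dirM (dir_exp (dirZ (-1) (dirM (dir_fst1 p v) (dir_fst1 p v))))
  (dir_exp (dirZ (-1) (dirM (dir_fst2 p v) (dir_fst2 p v))))).
  by move=> x; rewrite /gauss3 /gauss_fun !e.
by rewrite /= !e /gauss3 /gauss_fun; ring.
Qed.

Lemma continuous_gauss3 : continuous gauss3.
Proof.
apply: continuousM_fun; apply: continuous_comp_fun; try exact: continuous_gauss_fun.
  exact: continuous_q1.
exact: continuous_q2.
Qed.

(** Stable under derivation and bounded after multiplication by any polynomial
    in q: one induction replaces the estimation of each iterated derivative.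
    *)
Definition gaussian_class (f : V3 -> C) : Prop :=
  exists P Q : V3 -> R, [/\ tame P, tame Q &
    f = fun p => (P p * gauss3 p) +i* (Q p * gauss3 p)].

Lemma gaussian_class_dir f v : gaussian_class f ->
  (forall p, cdir p v f (cderive v f p)) /\ gaussian_class (cderive v f).
Proof.
move=> [P [Q [tP tQ ->]]].
have [P' tP' dP] := tame_dir v tP. have [Q' tQ' dQ] := tame_dir v tQ.
pose l (p : V3) := - 2 * (v.1.1 * p.1.1 + v.1.2 * p.1.2).
have tl : tame l.
  apply: tameM; first exact: tame_cst.
  by apply: tameD; apply: tameM; try exact: tame_cst; [exact: tame_q1|exact: tame_q2].
have d p : cdir p v (fun p => (P p * gauss3 p) +i* (Q p * gauss3 p))
    (((P' p + P p * l p) * gauss3 p) +i* ((Q' p + Q p * l p) * gauss3 p)).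
  split => /=.
    by apply: dir_ext (dirM (dP p) (dir_gauss3 p v)) => //; rewrite /l; ring.
  by apply: dir_ext (dirM (dQ p) (dir_gauss3 p v)) => //; rewrite /l; ring.
split; first by move=> p; rewrite (cdir_val (d p)).
exists (fun p => P' p + P p * l p), (fun p => Q' p + Q p * l p); split.
- by apply: tameD => //; exact: tameM.
- by apply: tameD => //; exact: tameM.
- by apply/funext => p; rewrite (cdir_val (d p)).
Qed.

Lemma gaussian_class_cderives f s : gaussian_class f -> gaussian_class (cderives s f).
Proof.
by move=> gf; elim: s => //= v s IHs; have [] := gaussian_class_dir v IHs.
Qed.

Lemma gaussian_class_continuous f : gaussian_class f -> ccontinuous f.
Proof.
move=> [P [Q [tP tQ ->]]]; split => /=; apply: continuousM_fun;
  by [exact: tame_continuous|exact: continuous_gauss3].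
Qed.

Lemma gaussian_class_bound f (a b : nat) : gaussian_class f ->
  exists M : R, forall p : V3, `|p.1.1| ^+ a * `|p.1.2| ^+ b * cabs (f p) <= M.
Proof.
move=> [P [Q [/tame_growth[c [n [c0 Pc]]] /tame_growth[d [m [d0 Qd]]] ->]]].
have [k1 k10 H1] := pow_gauss_bounded (a + (n + m)).
have [k2 k20 H2] := pow_gauss_bounded (b + (n + m)).
exists ((c + d) * (k1 * k2)) => p.
have w1 := weight_ge1 p. have g0 := gauss3_ge0 p.
have fb : cabs ((P p * gauss3 p) +i* (Q p * gauss3 p)) <=
    (c + d) * weight p ^+ (n + m) * gauss3 p.
  apply: (le_trans (cabs_le _)); rewrite /= (normrM (P p)) (normrM (Q p)) (ger0_norm g0) -mulrDl.
  rewrite ler_wpM2r// mulrDl; apply: lerD.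
    apply: (le_trans (Pc p)); rewrite ler_wpM2l// ler_weXn2l//.
    exact: leq_addr.
  apply: (le_trans (Qd p)); rewrite ler_wpM2l// ler_weXn2l//.
  exact: leq_addl.
have x1 (x : R) k : `|x| ^+ k <= (1 + `|x|) ^+ k.
  by rewrite lerXn2r ?nnegrE// ?addr_ge0// lerDr.
apply: (@le_trans _ _ ((1 + `|p.1.1|) ^+ a * (1 + `|p.1.2|) ^+ b *
    ((c + d) * weight p ^+ (n + m) * gauss3 p))).
  apply: ler_pM => //; rewrite ?mulr_ge0 ?exprn_ge0 ?cabs_ge0//.
  by apply: ler_pM; rewrite ?exprn_ge0.
rewrite [leLHS](_ : _ = (c + d) * (((1 + `|p.1.1|) ^+ (a + (n + m)) * gauss p.1.1) *
   ((1 + `|p.1.2|) ^+ (b + (n + m)) * gauss p.1.2))); last first.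
  by rewrite /weight /gauss3 exprMn !exprD; ring.
rewrite ler_wpM2l ?addr_ge0//; apply: ler_pM => //;
  by rewrite mulr_ge0 ?gauss_fun_ge0// exprn_ge0// addr_ge0.
Qed.

Lemma gaussian_class_rapid f : gaussian_class f -> rapid f.
Proof.
move=> gf; split.
  move=> s sB; have gs := gaussian_class_cderives s gf.
  have [c1 c2] := gaussian_class_continuous gs; split => // v x _.
  by have [/(_ x) /cdir_derivable] := gaussian_class_dir v gs.
by move=> a b s _; exact: gaussian_class_bound (gaussian_class_cderives s gf).
Qed.

End TameFunctions.

(** * Test modes adapted to the Cauchy-Riemann equation *)

Section GaussianModes.
Variable R : realType.
Local Notation C := R[i].
Local Notation leb := (@lebesgue_measure R).
Local Notation gauss := (@gauss_fun R).

Lemma gauss_transform (a : R) :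
  cintegral leb setT (fun x => cexpi (a * x) * (gauss x)%:C) =
  (Num.sqrt pi * expR (- a ^+ 2 / 4))%:C.
Proof.
have c0 := gauss_cos_transform 0 a; have s0 := gauss_cos_transform (- (pi / 2)) a.
rewrite cosN cos_pihalf !mul0r in s0; rewrite cos0 mul1r in c0.
apply: complex_ext.
  rewrite -[RHS]c0; apply: eq_Rintegral => x _.
  by rewrite ReM /= mulr0 subr0 addr0 mulrC.
rewrite -[RHS]s0; apply: eq_Rintegral => x _.
by rewrite ImM /= mulr0 add0r sin_cos_shift mulrC.
Qed.

Lemma cintegrable_gauss (a : R) :
  cintegrable leb setT (fun x => cexpi (a * x) * (gauss x)%:C).
Proof.
apply: (cintegrable_dom _ _ _ integrableT_gauss) => //.
  apply: cmeasurableM; first by apply: cmeasurable_expi; exact: measurable_funM.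
  by apply: cmeasurable_real; exact: measurable_gauss_fun.
by move=> x _; rewrite cabsM cabs_expi mul1r cabsR ger0_norm// gauss_fun_ge0.
Qed.

Definition gauss_mode (b q : R * R) : C :=
  cexpi (b.1 * q.1 + b.2 * q.2) * (gauss q.1 * gauss q.2)%:C.

Lemma gauss_mode_decays b : decays 1 (gauss_mode b).
Proof.
split => [|z].
  apply: cmeasurableM.
    by apply: cmeasurable_expi; apply: measurable_funD; apply: measurable_funM.
  apply: cmeasurable_real.
  by apply: measurable_funM; apply: (measurableT_comp (@measurable_gauss_fun R)).
rewrite cabsM cabs_expi !mul1r cabsR ger0_norm ?mulr_ge0 ?gauss_fun_ge0//.
by apply: ler_pM; rewrite ?gauss_fun_ge0// gauss_lorentz.
Qed.

Lemma fourier2Z c (f : R * R -> C) k a : decays c f ->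
  fourier2 (fun x => a * f x) k = a * fourier2 f k.
Proof.
move=> fc; rewrite /fourier2 /planeint.
have i1 := decays_integrable (decays_fourier_integrand k fc).
rewrite mulrCA; congr (_ * _); rewrite -(cintegralZ measurableT a i1).
by apply: eq_cintegral => x _; ring.
Qed.

Lemma fourier2_gauss_mode b k : fourier2 (gauss_mode b) k =
  (2^-1 * expR (- ((b.1 - k.1) ^+ 2 + (b.2 - k.2) ^+ 2) / 4))%:C.
Proof.
rewrite /fourier2 (planeint_iter (decays_fourier_integrand k (gauss_mode_decays b))).
have e x y : cexpi (- (k.1 * x + k.2 * y)) * gauss_mode b (x, y) =
    (cexpi ((b.1 - k.1) * x) * (gauss x)%:C) * (cexpi ((b.2 - k.2) * y) * (gauss y)%:C).
  rewrite /gauss_mode /= mulrA -cexpiD mulrACA -cexpiD -rmorphM.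
  by congr (cexpi _ * _); ring.
have inner x : cintegral leb setT
    (fun y => cexpi (- (k.1 * x + k.2 * y)) * gauss_mode b (x, y)) =
    (Num.sqrt pi * expR (- (b.2 - k.2) ^+ 2 / 4))%:C *
    (cexpi ((b.1 - k.1) * x) * (gauss x)%:C).
  rewrite -gauss_transform [RHS]mulrC -(cintegralZ measurableT _ (cintegrable_gauss _)).
  by apply: eq_cintegral => y _; exact: e.
rewrite [X in _ * X = _](_ : _ = cintegral leb setT
    (fun x => (Num.sqrt pi * expR (- (b.2 - k.2) ^+ 2 / 4))%:C *
    (cexpi ((b.1 - k.1) * x) * (gauss x)%:C))); last first.
  by apply: eq_cintegral => x _; exact: inner.
rewrite (cintegralZ measurableT _ (cintegrable_gauss _)) gauss_transform -!rmorphM.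
congr (_%:C); rewrite mulrACA -expRD -expr2 sqr_sqrtr ?pi_ge0// mulrA; congr (_ * expR _).
  have : 0 < pi :> R by exact: pi_gt0.
  rewrite -(mulr_natl pi); move: (pi : R) => p p0.
  by field; exact: lt0r_neq0.
by field.
Qed.

End GaussianModes.

Section TestModes.
Variable R : realType.
Local Notation C := R[i].
Local Notation V3 := ((R * R) * R)%type.
Variables Omega mu : R.
Hypothesis Omega_gt0 : 0 < Omega.
Variable s : R * R.

Let O0 : Omega != 0. Proof. by rewrite gt_eqF. Qed.

(** Let b be this frequency and k = Omega (cos phi, sin phi). In the Fourier
    transform exp(- |b - k|^2 / 4) of the modulated Gaussian, the cross term
    b.k / 2 equals s.(cos phi, sin phi) - mu cos(phi - theta), and |b|^2
    depends on theta alone; mode_amp cancels it up to a constant. *)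
Definition mode_freq (theta : R) : R * R :=
  (2 / Omega * (s.1 - mu * cos theta), 2 / Omega * (s.2 - mu * sin theta)).

Definition mode_amp (theta : R) : R :=
  expR (- (2 * mu * s.1 / Omega ^+ 2) * cos theta + - (2 * mu * s.2 / Omega ^+ 2) * sin theta).

Definition test_mode (w beta : R) (p : V3) : C :=
  (cos (w * p.2 + beta) * mode_amp p.2)%:C * gauss_mode (mode_freq p.2) p.1.

Lemma tame_freq1 : tame (fun p : V3 => (mode_freq p.2).1).
Proof.
apply: tameM; first exact: tame_cst.
apply: tameD; first exact: tame_cst.
apply: tame_ext (tameM (tame_cst (- mu)) (tame_cos2 R)) => p.
by rewrite mulNr.
Qed.

Lemma tame_freq2 : tame (fun p : V3 => (mode_freq p.2).2).
Proof.
apply: tameM; first exact: tame_cst.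
apply: tameD; first exact: tame_cst.
apply: tame_ext (tameM (tame_cst (- mu)) (tame_sin2 R)) => p.
by rewrite mulNr.
Qed.

Definition mode_phase (p : V3) : R :=
  (mode_freq p.2).1 * p.1.1 + (mode_freq p.2).2 * p.1.2.

Lemma tame_phase : tame mode_phase.
Proof.
by apply: tameD; apply: tameM;
  [exact: tame_freq1|exact: tame_q1|exact: tame_freq2|exact: tame_q2].
Qed.

Lemma test_mode_class w beta : gaussian_class (test_mode w beta).
Proof.
have t0 : tame (fun p : V3 => cos (w * p.2 + beta) * mode_amp p.2).
  by apply: tameM; [exact: tame_trig|exact: tame_exp].
exists (fun p => cos (w * p.2 + beta) * mode_amp p.2 * cos (mode_phase p)),
       (fun p => cos (w * p.2 + beta) * mode_amp p.2 * sin (mode_phase p)); split.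
- by apply: tameM => //; apply: tame_cos; exact: tame_phase.
- by apply: tameM => //; apply: tame_sin; exact: tame_phase.
apply/funext => p; apply: complex_ext;
  by rewrite /test_mode /gauss_mode !cE /= /gauss3 /mode_phase; ring.
Qed.

Lemma test_mode_rapid w beta : rapid (test_mode w beta).
Proof. exact: gaussian_class_rapid (test_mode_class w beta). Qed.

Lemma dir_mode_phase p v : is_derive p v mode_phase
  ((mode_freq p.2).1 * v.1.1 + (mode_freq p.2).2 * v.1.2 +
   2 * mu / Omega * v.2 * (sin p.2 * p.1.1 - cos p.2 * p.1.2)).
Proof.
have dc := dir_cos (dir_snd p v). have ds := dir_sin (dir_snd p v).
apply: dir_ext (dirD
  (dirM (dirZ (2 / Omega) (dirD (dir_cst s.1 p v) (dirZ (- mu) dc))) (dir_fst1 p v))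
  (dirM (dirZ (2 / Omega) (dirD (dir_cst s.2 p v) (dirZ (- mu) ds))) (dir_fst2 p v))).
  by move=> x; rewrite /mode_phase /mode_freq /=; ring.
by rewrite /mode_phase /mode_freq /=; ring.
Qed.

Lemma dir_mode_amp p v : is_derive p v (fun p : V3 => mode_amp p.2)
  (mode_amp p.2 * (2 * mu / Omega ^+ 2 * v.2 * (s.1 * sin p.2 - s.2 * cos p.2))).
Proof.
have dc := dir_cos (dir_snd p v). have ds := dir_sin (dir_snd p v).
apply: dir_ext (dir_exp (dirD (dirZ (- (2 * mu * s.1 / Omega ^+ 2)) dc)
   (dirZ (- (2 * mu * s.2 / Omega ^+ 2)) ds))) => //.
by rewrite /mode_amp /=; congr (_ * _); ring.
Qed.

Lemma dir_trig w beta (p v : V3) : is_derive p v (fun p : V3 => cos (w * p.2 + beta))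
  (w * v.2 * cos (w * p.2 + (beta + pi / 2))).
Proof.
apply: dir_ext (dir_cos (dirD (dirZ w (dir_snd p v)) (dir_cst beta p v))) => //.
by rewrite addrA cosDpihalf; ring.
Qed.

Lemma test_mode_cdir w beta p v : cdir p v (test_mode w beta)
  (((w * v.2)%:C * test_mode w (beta + pi / 2) p) +
   ((2 * mu / Omega ^+ 2 * v.2 * (s.1 * sin p.2 - s.2 * cos p.2)
     - 2 * (v.1.1 * p.1.1 + v.1.2 * p.1.2)) +i*
    ((mode_freq p.2).1 * v.1.1 + (mode_freq p.2).2 * v.1.2 +
   2 * mu / Omega * v.2 * (sin p.2 * p.1.1 - cos p.2 * p.1.2))) * test_mode w beta p).
Proof.
apply: cdir_ext (cdirM (cdir_real (dirM (dir_trig w beta p v) (dir_mode_amp p v)))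
  (cdirM (cdir_expi (dir_mode_phase p v)) (cdir_real (dir_gauss3 p v)))) => //.
rewrite /test_mode /gauss_mode -/(mode_phase p) -/(gauss3 p).
move: (cexpi _) => E; move: (gauss3 p) (mode_amp _) => g A.
apply: complex_ext; rewrite !cE /=; ring.
Qed.

(** The amplitude and the frequency are such that mode_amp(theta) exp(i
    b(theta).q - |q|^2) is annihilated by X2 - i (mu / Omega) X1; only the
    derivative of the trigonometric factor is left. *)
Lemma X2_test_mode w beta p :
  X2 (test_mode w beta) p = w%:C * test_mode w (beta + pi / 2) p +
    (0 +i* (mu / Omega)) * X1 (test_mode w beta) p.
Proof.
rewrite /X2 /X1 !(cdir_val (test_mode_cdir w beta p _)) /mode_freq /=.
move: (test_mode w beta p) (test_mode _ _ p) => T T'.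
have := cos2Dsin2 p.2; move: (cos p.2) (sin p.2) => c0 s0 cs.
apply: complex_ext; rewrite !cE /=.
  by field: cs.
by field: cs.
Qed.

Definition mode_const : R :=
  2^-1 * expR (- Omega ^+ 2 / 4 - (s.1 ^+ 2 + s.2 ^+ 2 + mu ^+ 2) / Omega ^+ 2).

Lemma mode_const_gt0 : 0 < mode_const.
Proof. by rewrite mulr_gt0// expR_gt0. Qed.

(** This is exp(s.(cos phi, sin phi)) divided by exp(mu cos(phi - theta)):
    paired with a density U(theta, phi), it leaves the moment in phi of U
    exp(- mu cos(phi - theta)), which is independent of theta for a
    Cauchy-Riemann field. *)
Definition mode_profile (theta phi : R) : R :=
  expR (s.1 * cos phi + s.2 * sin phi - mu * cos (phi - theta)).

Lemma fourier2_test_mode w beta theta phi :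
  fourier2 (fun q => test_mode w beta (q, theta)) (Omega * cos phi, Omega * sin phi) =
  (cos (w * theta + beta) * (mode_const * mode_profile theta phi))%:C.
Proof.
rewrite /test_mode /=.
rewrite (fourier2Z _ (cos (w * theta + beta) * mode_amp theta)%:C
  (gauss_mode_decays (mode_freq theta))) fourier2_gauss_mode /=.
rewrite -rmorphM -[X in X%:C = _]mulrA; congr ((_ * _)%:C).
rewrite /mode_const /mode_profile /mode_amp mulrCA -[RHS]mulrA -!expRD; congr (_ * expR _).
rewrite cosB; have := sin2cos2 phi; have := sin2cos2 theta.
move: (cos phi) (sin phi) (cos theta) (sin theta) => c0 s0 c1 s1 h1 h0.
by field: h0 h1.
Qed.

Lemma gaussian_classZ (P : V3 -> R) (f : V3 -> C) : tame P -> gaussian_class f ->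
  gaussian_class (fun p => (P p)%:C * f p).
Proof.
move=> tP [A [B [tA tB ->]]]; exists (fun p => P p * A p), (fun p => P p * B p).
split; [exact: tameM|exact: tameM|apply/funext => p].
by apply: complex_ext; rewrite !cE /=; ring.
Qed.

Lemma gaussian_classD (f g : V3 -> C) : gaussian_class f -> gaussian_class g ->
  gaussian_class (fun p => f p + g p).
Proof.
move=> [A [B [tA tB ->]]] [A' [B' [tA' tB' ->]]].
exists (fun p => A p + A' p), (fun p => B p + B' p).
split; [exact: tameD|exact: tameD|apply/funext => p].
by apply: complex_ext; rewrite !cE /=; ring.
Qed.

Lemma X1_class (f : V3 -> C) : gaussian_class f -> gaussian_class (X1 f).
Proof.
move=> gf; apply: gaussian_classD; apply: gaussian_classZ.
- by apply: tame_ext (tameM (tame_cst (-1)) (tame_sin2 R)) => p; rewrite mulN1r.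
- by have [] := gaussian_class_dir (@dq1 R) gf.
- exact: tame_cos2.
- by have [] := gaussian_class_dir (@dq2 R) gf.
Qed.

Lemma fourier2_X1 (chi : V3 -> C) theta k : rapid chi ->
  fourier2 (fun q => X1 chi (q, theta)) k =
  (0 +i* (- sin theta * k.1 + cos theta * k.2)) * fourier2 (fun q => chi (q, theta)) k.
Proof.
move=> rc.
have [c1 h1] := rapid_decays (rapid_cderive (dq1_basis3 R) rc).
have [c2 h2] := rapid_decays (rapid_cderive (dq2_basis3 R) rc).
have h3 : decays (`|cos theta| * c2)
    (fun q => (cos theta)%:C * cderive (@dq2 R) chi (q, theta)).
  have [m2 b2] := h2 theta; split => [|z].
    by apply: cmeasurableM => //; exact: cmeasurable_cst.
  by rewrite cabsM cabsR -mulrA ler_wpM2l.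
pose d1 q := cderive (@dq1 R) chi (q, theta). pose d2 q := cderive (@dq2 R) chi (q, theta).
have e1 : fourier2 (fun q => X1 chi (q, theta)) k =
    (- sin theta)%:C * fourier2 d1 k + fourier2 (fun q => (cos theta)%:C * d2 q) k.
  exact: (@fourier2D R c1 (`|cos theta| * c2) d1 (fun q => (cos theta)%:C * d2 q) k
    (- sin theta)%:C (h1 theta) h3).
have e2 : fourier2 (fun q => (cos theta)%:C * d2 q) k = (cos theta)%:C * fourier2 d2 k.
  exact: (@fourier2Z R c2 d2 k (cos theta)%:C (h2 theta)).
have e3 := fourier2_dq1 theta k rc. have e4 := fourier2_dq2 theta k rc.
have H (x y z t u : C) (a b : R) : x = (- a)%:C * y + z -> z = b%:C * t ->
    y = (0 +i* k.1) * u -> t = (0 +i* k.2) * u -> x = (0 +i* (- a * k.1 + b * k.2)) * u.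
  by move=> -> -> -> ->; apply: complex_ext; rewrite !cE /=; ring.
exact: (H _ _ _ _ _ _ _ e1 e2 e3 e4).
Qed.

(** The symbol i k.(- sin theta, cos theta) of X1 equals i Omega sin(phi -
    theta) at k = Omega (cos phi, sin phi). *)
Lemma fourier2_X1_circle (chi : V3 -> C) theta phi : rapid chi ->
  fourier2 (fun q => X1 chi (q, theta)) (Omega * cos phi, Omega * sin phi) =
  (0 +i* (Omega * sin (phi - theta))) *
  fourier2 (fun q => chi (q, theta)) (Omega * cos phi, Omega * sin phi).
Proof.
by move=> rc; rewrite fourier2_X1//=; congr (_ +i* _ * _); rewrite sinB; ring.
Qed.

Lemma cos_int_periodic (k : int) (t b : R) :
  cos (k%:~R * (t + pi *+ 2) + b) = cos (k%:~R * t + b).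
Proof.
have shift n x : cos (x + (pi *+ 2) *+ n) = cos x :> R.
  exact: (periodicn (@cosD2pi R)).
case: k => n.
  rewrite (_ : _ + b = n%:~R * t + b + (pi *+ 2) *+ n) ?shift//.
  by rewrite -(mulr_natl (pi *+ 2) n) -pmulrn; ring.
rewrite -(shift n.+1); congr cos.
by rewrite -(mulr_natl (pi *+ 2) n.+1) NegzE mulrNz -pmulrn; ring.
Qed.

Lemma test_mode_periodic (k : int) beta q theta :
  test_mode k%:~R beta (q, theta + pi *+ 2) = test_mode k%:~R beta (q, theta).
Proof.
rewrite /test_mode /mode_amp /mode_freq /= cos_int_periodic.
by rewrite (@cosD2pi R) (@sinD2pi R).
Qed.

End TestModes.

(** * Integrals of periodic functions *)

Section PeriodicIntegrals.
Variable R : realType.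
Local Notation leb := (@lebesgue_measure R).
Local Open Scope ereal_scope.

(** Lebesgue measure is characterized by its values on half-open intervals,
    which translation preserves. *)
Lemma integral_shift (c : R) (D : set (measurableTypeR R)) (f : R -> \bar R) :
  measurable D -> measurable_fun setT f -> (forall x, 0 <= f x) ->
  \int[leb]_(x in D) f x = \int[leb]_(x in [set x | D (x + c)%R]) f (x + c)%R.
Proof.
move=> mD mf f0.
have mphi : measurable_fun setT (fun x : measurableTypeR R => (x + c)%R : measurableTypeR R).
  exact: measurable_funD.
rewrite -(@ge0_integral_pushforward _ _ (measurableTypeR R) (measurableTypeR R) R
  (fun x => (x + c)%R) mphi leb D f mD)//; last exact: measurable_funTS.
apply: eq_measure_integral => /= A mA _.
apply: lebesgue_measure_unique => //.
move=> _ [[a b] _ <-] /=; rewrite /pushforward.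
rewrite (_ : _ @^-1` _ = `](a - c)%R, (b - c)%R]%classic); last first.
  by apply/seteqP; split => x; rewrite /= !in_itv /= ltrBlDr lerBrDr.
rewrite !lebesgue_measure_itv /= !lte_fin ltrD2r; case: ifP => // _.
by rewrite -!EFinD; congr (_%:E); ring.
Qed.

Lemma integral_reflect (c : R) (D : set (measurableTypeR R)) (f : R -> \bar R) :
  measurable D -> measurable_fun setT f -> (forall x, 0 <= f x) ->
  \int[leb]_(x in D) f x = \int[leb]_(x in [set x | D (c - x)%R]) f (c - x)%R.
Proof.
move=> mD mf f0.
have mphi : measurable_fun setT (fun x : measurableTypeR R => (c - x)%R : measurableTypeR R).
  exact: measurable_funB.
rewrite -(@ge0_integral_pushforward _ _ (measurableTypeR R) (measurableTypeR R) R
  (fun x => (c - x)%R) mphi leb D f mD)//; last exact: measurable_funTS.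
apply: eq_measure_integral => /= A mA _.
apply: lebesgue_measure_unique => //.
move=> _ [[a b] _ <-] /=; rewrite /pushforward.
rewrite (_ : _ @^-1` _ = `[(c - b)%R, (c - a)%R[%classic); last first.
  by apply/seteqP; split => x; rewrite /= !in_itv /= => /andP[h1 h2]; apply/andP; split; lra.
rewrite !lebesgue_measure_itv /= !lte_fin ltrD2l ltrN2; case: ifP => // _.
by rewrite -!EFinD; congr (_%:E); ring.
Qed.

Variables (T : R) (h : R -> \bar R).
Hypotheses (T0 : (0 < T)%R) (mh : measurable_fun setT h) (h0 : forall x, 0 <= h x)
  (hT : forall x, h (x + T)%R = h x).

Let P (x : R) := \int[leb]_(t in `]x, (x + T)%R]) h t.

Let ishift (a b : R) : \int[leb]_(t in `]a, b]) h t =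
  \int[leb]_(t in `](a + T)%R, (b + T)%R]) h t.
Proof.
rewrite [RHS](@integral_shift T)//; under [in RHS]eq_integral do rewrite hT.
by congr (integral _ _ _); apply/seteqP; split => x;
  rewrite /= !in_itv /= ltrD2r lerD2r.
Qed.

Let icat (a b c : R) : (a <= b)%R -> (b <= c)%R ->
  \int[leb]_(t in `]a, c]) h t =
  \int[leb]_(t in `]a, b]) h t + \int[leb]_(t in `]b, c]) h t.
Proof.
move=> ab bc; rewrite -ge0_integral_setU//; last 2 first.
- exact: measurable_funTS.
- apply/disj_setPS => x [/=]; rewrite !in_itv /= => /andP[_ h1] /andP[h2 _]; lra.
congr (integral _ _ _); apply/seteqP; split => x; rewrite /= !in_itv /=.
  by move=> /andP[ax xc]; have [xb|xb] := leP x b; [left|right]; apply/andP.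
by case=> /andP[h1 h2]; apply/andP; split; lra.
Qed.

Let P_shift (x : R) : P (x + T)%R = P x.
Proof. by rewrite /P -ishift. Qed.

Let P_shiftn (x : R) n : P (x + n%:R * T)%R = P x.
Proof.
elim: n => [|n IHn]; first by rewrite mul0r addr0.
by rewrite -natr1 mulrDl mul1r addrA P_shift.
Qed.

(** For 0 <= x < T, cut ]x, x + T] at T and translate the second piece by - T.
    *)
Lemma integral_period (x : R) : P x = P 0.
Proof.
have base (y : R) : (0 <= y < T)%R -> P y = P 0%R.
  move=> /andP[y0 yT]; rewrite /P add0r.
  have h1 : (y <= T)%R by lra. have h2 : (T <= y + T)%R by lra.
  rewrite (icat h1 h2) (icat y0 h1).
  by rewrite addeC; have := ishift 0 y; rewrite add0r => ->.
pose k := Num.floor (x / T)%R.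
have k1 : (k%:~R * T <= x)%R by rewrite -ler_pdivlMr// Num.Theory.floor_le.
have k2 : (x < (k%:~R + 1) * T)%R.
  by rewrite -ltr_pdivrMr// -[1%R]/(1%:~R) -intrD Num.Theory.floorD1_gt.
have by0 : P (x - k%:~R * T)%R = P 0%R by apply: base; apply/andP; split; lra.
rewrite -by0; case: k {k1 k2 by0} => n.
  by rewrite -(P_shiftn (x - _) n) -pmulrn subrK.
by rewrite NegzE mulrNz mulNr opprK -pmulrn P_shiftn.
Qed.

Lemma integral_circle_reflect (c : R) :
  \int[leb]_(t in `[0%R, T]) h (c - t)%R = \int[leb]_(t in `[0%R, T]) h t.
Proof.
have e0 : \int[leb]_(t in `[0%R, T]) h t = P 0%R.
  by rewrite /P add0r; apply/esym/integral_itv_obnd_cbnd; exact: measurable_funTS.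
rewrite e0 -(integral_period (c - T)) /P subrK.
rewrite (integral_itv_obnd_cbnd (f := h)); last exact: measurable_funTS.
rewrite [RHS](@integral_reflect c)//.
congr (integral _ _ _); apply/seteqP; split => x; rewrite /= !in_itv /=;
  by move=> /andP[h1 h2]; apply/andP; split; lra.
Qed.

Lemma integral_circle_rotate (c : R) :
  \int[leb]_(t in `[0%R, T]) h (t - c)%R = \int[leb]_(t in `[0%R, T]) h t.
Proof.
have e0 : \int[leb]_(t in `[0%R, T]) h t = P 0%R.
  by rewrite /P add0r; apply/esym/integral_itv_obnd_cbnd; exact: measurable_funTS.
rewrite e0 -(integral_period (- c)) /P.
rewrite (integral_itv_obnd_cbnd (f := h)); last exact: measurable_funTS.
rewrite [RHS](@integral_shift (- c))//.
congr (integral _ _ _); apply/seteqP; split => x; rewrite /= !in_itv /=;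
  by move=> /andP[h1 h2]; apply/andP; split; lra.
Qed.

End PeriodicIntegrals.

(** * Peaked kernels on the circle *)

Section CircleBasics.
Variable R : realType.
Local Notation leb := (@lebesgue_measure R).
Local Notation S1 := (@S1 R).
Local Notation twopi := (pi *+ 2 : R).

Lemma twopi_gt0 : 0 < twopi.
Proof. by rewrite mulrn_wgt0// pi_gt0. Qed.

Lemma measurable_S1 : measurable (S1 : set (measurableTypeR R)).
Proof. exact: measurable_itv. Qed.

Lemma continuous_integrable_itv (f : R -> R) (a b : R) : continuous f ->
  leb.-integrable `[a, b] (EFin \o f).
Proof.
move=> cf; apply: continuous_compact_integrable; first exact: segment_compact.
exact: continuous_subspaceT.
Qed.

Lemma ae_neq (a : R) : {ae leb, forall x, x <> a}.
Proof.
by exists [set a]; split; [exact: measurable_set1|exact: lebesgue_measure_set1|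
  move=> x /= /contrapT ->].
Qed.

Lemma continuousX_fun (T : topologicalType) (f : T -> R) n : continuous f ->
  continuous (fun x => f x ^+ n).
Proof.
move=> cf; elim: n => [|n IHn].
  by under eq_fun do rewrite expr0; exact: continuous_cst_fun.
by under eq_fun do rewrite exprS; exact: continuousM_fun.
Qed.

Lemma integrable_cst_S1 (c : R) : leb.-integrable S1 (EFin \o (fun _ : R => c)).
Proof. by apply: continuous_integrable_itv; exact: continuous_cst_fun. Qed.

Lemma Rintegral_cst_S1 (c : R) : \int[leb]_(x in S1) c = c * twopi.
Proof.
rewrite Rintegral_cst; last exact: measurable_S1.
rewrite /Defs.S1; have := @lebesgue_measure_itv R `[0, pi *+ 2].
by rewrite /= lte_fin twopi_gt0 sube0 => ->.
Qed.

End CircleBasics.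

Section PeakedKernels.
Variable R : realType.
Local Notation leb := (@lebesgue_measure R).
Local Notation S1 := (@S1 R).
Local Notation twopi := (pi *+ 2 : R).
Variable W : R -> R.
Hypotheses (cW : continuous W) (W0 : forall c, -1 <= c -> 0 <= W c)
  (Wlt : forall c d, -1 <= c -> c < d -> W c < W d).

(** As W is nonnegative and increasing on [-1, 1], these powers concentrate at
    alpha. The cases used are W(c) = exp c and W(c) = 1 + c, whose powers are
    exponentials and polynomials in cos and sin. *)
Definition peak (n : nat) (phi alpha : R) : R := W (cos (phi - alpha)) ^+ n.

Definition peak_mass (n : nat) : R := \int[leb]_(t in S1) W (cos t) ^+ n.

Lemma cos_lt (x y : R) : 0 <= x -> x < y -> y <= pi -> cos y < cos x.
Proof.
move=> x0 xy yp; have y0 : 0 <= y by lra. have xp : x <= pi by lra.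
by rewrite ltr_cos// in_itv /= ?x0 ?y0.
Qed.

Lemma peak_ge0 n phi alpha : 0 <= peak n phi alpha.
Proof. by apply: exprn_ge0; apply: W0; exact: cos_geN1. Qed.

Lemma Wle c d : -1 <= c -> c <= d -> W c <= W d.
Proof. by move=> c1; rewrite le_eqVlt => /predU1P[->//|cd]; apply/ltW/Wlt. Qed.

Lemma continuous_Wcos n : continuous (fun t : R => W (cos t) ^+ n).
Proof.
apply: continuousX_fun; apply: continuous_comp_fun => //; exact: continuous_cos.
Qed.

Lemma continuous_peak n phi : continuous (peak n phi).
Proof.
have := @continuous_comp_fun R R (fun a => -1 * a + phi) (fun t => W (cos t) ^+ n)
  (@continuous_affine R (-1) phi) (@continuous_Wcos n).
rewrite (_ : (fun _ => _) = peak n phi)//; apply/funext => a.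
by rewrite /peak; congr (W (cos _) ^+ _); ring.
Qed.

Lemma peak_massE n phi : \int[leb]_(a in S1) peak n phi a = peak_mass n.
Proof.
rewrite /peak_mass /Rintegral; congr fine.
have := @integral_circle_reflect R twopi (fun t => (W (cos t) ^+ n)%:E) (twopi_gt0 R).
move=> H; apply: H.
- by apply/measurable_EFinP; apply: continuous_measurable_fun; exact: continuous_Wcos.
- by move=> x; rewrite lee_fin exprn_ge0// W0// cos_geN1.
- by move=> x; rewrite cosD2pi.
Qed.

(** The part of the integral over [0, d / 2], where W (cos t) is at least W
    (cos (d / 2)). *)
Lemma peak_mass_ge n d : 0 < d -> d <= 1 ->
  d / 2 * W (cos (d / 2)) ^+ n <= peak_mass n.
Proof.
move=> d0 d1; set c := W _ ^+ n.
have pi2 : 2 <= pi :> R by exact: pi_ge2.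
have c0 : 0 <= c by rewrite exprn_ge0// W0// cos_geN1.
have -> : d / 2 * c = \int[leb]_(t in `[0, d / 2]) c.
  rewrite Rintegral_cst//; have := @lebesgue_measure_itv R `[0, d / 2].
  by rewrite /= lte_fin divr_gt0//= sube0 => ->; rewrite mulrC.
rewrite /peak_mass /Rintegral; apply: fine_le.
- by apply: integrable_fin_num => //; apply: continuous_integrable_itv; exact: continuous_cst_fun.
- apply: integrable_fin_num; first exact: measurable_S1.
  by apply: continuous_integrable_itv; exact: continuous_Wcos.
apply: (@le_trans _ _ (\int[leb]_(t in `[0%R, (d / 2)%R]) (W (cos t) ^+ n)%:E)%E).
  apply: ge0_le_integral => //.
  - apply/measurable_EFinP; apply: measurable_funTS.
    by apply: continuous_measurable_fun; exact: continuous_Wcos.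
  - move=> t /=; rewrite in_itv /= => /andP[t0 td]; rewrite lee_fin.
    rewrite /c lerXn2r ?nnegrE ?W0 ?cos_geN1//.
    apply: Wle; first exact: cos_geN1.
    move: td; rewrite le_eqVlt => /predU1P[->//|td]; apply/ltW.
    by apply: cos_lt; lra.
apply: ge0_subset_integral => //.
- exact: measurable_S1.
- apply/measurable_EFinP; apply: measurable_funTS.
  by apply: continuous_measurable_fun; exact: continuous_Wcos.
- by move=> t _; rewrite lee_fin exprn_ge0// W0// cos_geN1.
- move=> t /=; rewrite /Defs.S1 /= !in_itv /= => /andP[t0 td].
  by rewrite t0 /= -mulr_natl; lra.
Qed.

Lemma peak_off n (phi d : R) (A : set R) : measurable A -> A `<=` S1 ->
  0 < d -> d <= 1 ->
  (forall a, A a -> d <= `|phi - a| <= twopi - d) ->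
  \int[leb]_(a in A) peak n phi a <= twopi * W (cos d) ^+ n.
Proof.
move=> mA AS d0 d1 Ad.
have pi2 : 2 <= pi :> R by exact: pi_ge2.
have iS : leb.-integrable S1 (EFin \o peak n phi).
  by apply: continuous_integrable_itv; exact: continuous_peak.
have iA : leb.-integrable A (EFin \o peak n phi).
  exact: (integrableS (@measurable_S1 R) mA AS iS).
have lS : leb S1 = twopi%:E.
  by rewrite /Defs.S1 lebesgue_measure_itv /= lte_fin twopi_gt0 sube0.
have lA : (leb A <= twopi%:E)%E.
  by rewrite -lS; apply: le_measure; rewrite ?inE//; exact: measurable_S1.
have lAf : leb A \is a fin_num by rewrite ge0_fin_numE// (le_lt_trans lA) ?ltry.
apply: (@le_trans _ _ (\int[leb]_(a in A) (W (cos d) ^+ n))).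
  apply: le_Rintegral => //.
    apply: (integrableS (@measurable_S1 R) mA AS).
    by apply: continuous_integrable_itv; exact: continuous_cst_fun.
  move=> a /Ad /andP[h1 h2]; rewrite /peak lerXn2r ?nnegrE ?W0 ?cos_geN1//.
  apply: Wle; first exact: cos_geN1.
  have -> : cos (phi - a) = cos `|phi - a|.
    by case: (ger0P (phi - a)) => _//; rewrite cosN.
  move: h1 h2; move: `|phi - a| => t h1 h2.
  have tw : twopi = 2 * pi by rewrite mulr_natl.
  have [tp|tp] := leP t pi.
    move: h1; rewrite le_eqVlt => /predU1P[->//|h1]; apply/ltW.
    by apply: cos_lt; lra.
  have -> : cos t = cos (twopi - t) by rewrite -cosN -(@cosD2pi R (- t)) addrC.
  move: h2; rewrite lerBrDr addrC -lerBrDr le_eqVlt => /predU1P[<-//|h2]; apply/ltW.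
  by apply: cos_lt; lra.
rewrite Rintegral_cst// mulrC ler_wpM2r ?exprn_ge0 ?W0 ?cos_geN1//.
by rewrite -lee_fin fineK.
Qed.

Lemma peak_mass_gt0 n : 0 < peak_mass n.
Proof.
apply: lt_le_trans (peak_mass_ge n ltr01 (lexx 1)).
rewrite mulr_gt0// exprn_gt0//; apply: le_lt_trans (Wlt (lexx (-1)) _); first exact: W0.
have pi2 : 2 <= pi :> R by exact: pi_ge2.
by rewrite -cospi; apply: cos_lt; lra.
Qed.

(** Outside a neighbourhood of radius d the n-th peak is at most W(cos d)^n,
    while its mass is at least a multiple of W(cos(d / 2))^n: the ratio
    decreases geometrically. *)
Lemma peak_ratio_cvg (d : R) : 0 < d -> d <= 1 ->
  twopi * W (cos d) ^+ n / peak_mass n @[n --> \oo] --> 0.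
Proof.
move=> d0 d1; have pi2 : 2 <= pi :> R by exact: pi_ge2.
have cc : cos d < cos (d / 2) by apply: cos_lt; lra.
have r0 : 0 <= W (cos d) by apply: W0; exact: cos_geN1.
have r1 : W (cos d) < W (cos (d / 2)) by apply: Wlt => //; exact: cos_geN1.
have r2 : 0 < W (cos (d / 2)) by exact: le_lt_trans r1.
pose z := W (cos d) / W (cos (d / 2)).
have z0 : 0 <= z by rewrite divr_ge0// ltW.
have z1 : `|z| < 1 by rewrite ger0_norm// ltr_pdivrMr// mul1r.
have cz : (twopi / (d / 2)) * z ^+ n @[n --> \oo] --> 0.
  rewrite -[X in _ --> X](mulr0 (twopi / (d / 2))).
  by apply: cvgM; [exact: cvg_cst|exact: cvg_expr].
apply: (squeeze_cvgr _ (cvg_cst 0) cz).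
near=> n; apply/andP; split.
  by rewrite divr_ge0 ?mulr_ge0 ?exprn_ge0// ltW ?twopi_gt0 ?peak_mass_gt0.
rewrite ler_pdivrMr ?peak_mass_gt0//.
apply: (@le_trans _ _ (twopi / (d / 2) * z ^+ n * (d / 2 * W (cos (d / 2)) ^+ n))).
  rewrite /z expr_div_n le_eqVlt; apply/orP; left; apply/eqP.
  have : W (cos (d / 2)) ^+ n != 0 by rewrite expf_neq0// gt_eqF.
  move: (W (cos (d / 2)) ^+ n) (W (cos d) ^+ n) twopi => x y p x0.
  by field; rewrite x0 gt_eqF.
rewrite ler_wpM2l ?peak_mass_ge// mulr_ge0 ?exprn_ge0// divr_ge0 ?divr_ge0//.
  by rewrite ltW ?twopi_gt0.
exact: ltW.
Unshelve. all: by end_near. Qed.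

(** A superposition of peaks which approximates the indicator function of [0,
    b]. *)
Definition peak_avg (n : nat) (b phi : R) : R :=
  (\int[leb]_(a in `[0, b]) peak n phi a) / peak_mass n.

Lemma peak_avg_ge0 n b phi : 0 <= peak_avg n b phi.
Proof.
apply: divr_ge0; last exact/ltW/peak_mass_gt0.
by apply: Rintegral_ge0 => a _; exact: peak_ge0.
Qed.

Lemma peak_split n b phi : 0 <= b -> b <= twopi ->
  peak_mass n = \int[leb]_(a in `[0, b]) peak n phi a +
                \int[leb]_(a in `]b, twopi]) peak n phi a.
Proof.
move=> b0 bp; rewrite -(peak_massE n phi).
have e : S1 = (`[0, b] `|` `]b, twopi])%classic.
  by apply/seteqP; split => x; rewrite /Defs.S1 /= !in_itv /=;
    [move=> /andP[h1 h2]; have [|] := leP x b; [left|right]; apply/andP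
    |case=> /andP[h1 h2]; apply/andP; split; lra].
rewrite e Rintegral_setU//.
  by rewrite -e; apply: continuous_integrable_itv; exact: continuous_peak.
by apply/disj_setPS => x [/=]; rewrite !in_itv /= => /andP[_ h1] /andP[h2 _]; lra.
Qed.

Lemma peak_avg_le1 n b phi : 0 <= b -> b <= twopi -> peak_avg n b phi <= 1.
Proof.
move=> b0 bp; rewrite ler_pdivrMr ?peak_mass_gt0// mul1r (peak_split n phi b0 bp).
by rewrite lerDl Rintegral_ge0// => a _; exact: peak_ge0.
Qed.

Lemma peak_avg_cvg (b phi : R) :
  0 < b -> b < twopi -> 0 < phi -> phi < twopi -> phi != b ->
  peak_avg n b phi @[n --> \oo] --> (if phi < b then 1 else 0 : R).
Proof.
move=> b0 bp p0 p1 pb; have tw : twopi = 2 * pi by rewrite mulr_natl.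
have [lt|ge] := ltP phi b.
- pose d := Num.min 1 (Num.min phi (b - phi)).
  have d0 : 0 < d by rewrite !lt_min ltr01 p0 subr_gt0 lt.
  have [d1 d2 d3] : [/\ d <= 1, d <= phi & d <= b - phi].
    by rewrite /d !ge_min !lexx !orbT.
  have cz := peak_ratio_cvg d0 d1.
  have c1 : 1 - twopi * W (cos d) ^+ n / peak_mass n @[n --> \oo] --> (1 : R).
    by rewrite -[X in _ --> X]subr0; apply: cvgB => //; exact: cvg_cst.
  have c2 : (fun _ : nat => 1 : R) @ \oo --> (1 : R) by exact: cvg_cst.
  apply: (squeeze_cvgr _ c1 c2).
  near=> n; apply/andP; split; last by apply: peak_avg_le1; exact: ltW.
  rewrite lerBlDr -(divff (lt0r_neq0 (peak_mass_gt0 n))) -mulrDl.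
  rewrite ler_pM2r ?invr_gt0 ?peak_mass_gt0// {1}(peak_split n phi (ltW b0) (ltW bp)).
  rewrite lerD2l; apply: peak_off => //.
  + move=> x /=; rewrite /Defs.S1 /= !in_itv /= => /andP[h1 h2].
    by apply/andP; split; lra.
  + move=> x /=; rewrite in_itv /= => /andP[h1 h2].
    by rewrite distrC ger0_norm; [apply/andP; split; lra|lra].
- have {}ge : b < phi by rewrite lt_neqAle eq_sym pb.
  pose d := Num.min 1 (Num.min (phi - b) (twopi - phi)).
  have d0 : 0 < d by rewrite !lt_min ltr01 !subr_gt0 ge p1.
  have [d1 d2 d3] : [/\ d <= 1, d <= phi - b & d <= twopi - phi].
    by rewrite /d !ge_min !lexx !orbT.
  have cz := peak_ratio_cvg d0 d1.
  apply: (squeeze_cvgr _ (cvg_cst 0) cz).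
  near=> n; rewrite peak_avg_ge0 /=.
  rewrite ler_pM2r ?invr_gt0 ?peak_mass_gt0//; apply: peak_off => //.
  + move=> x /=; rewrite /Defs.S1 /= !in_itv /= => /andP[h1 h2].
    by apply/andP; split; lra.
  + move=> x /=; rewrite in_itv /= => /andP[h1 h2].
    by rewrite ger0_norm; [apply/andP; split; lra|lra].
Unshelve. all: by end_near. Qed.

Lemma measurable_peak n : measurable_fun setT (fun z : R * R => peak n z.1 z.2).
Proof.
apply: continuous_measurable_fun2; apply: continuousX_fun.
apply: continuous_comp_fun => //; apply: continuous_comp_fun; last exact: continuous_cos.
by apply: continuousB_fun => z; [exact: cvg_fst|exact: cvg_snd].
Qed.

(** By Fubini, v is orthogonal to the averages of the peaks over [0, b], which
    tend boundedly to the indicator function of [0, b]. *)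
Lemma peak_orthogonal_itv (v : R -> R) (b : R) : measurable_fun setT v ->
  leb.-integrable S1 (EFin \o v) ->
  (forall n alpha, \int[leb]_(phi in S1) (v phi * peak n phi alpha) = 0) ->
  0 < b -> b < twopi -> \int[leb]_(phi in `[0, b]) v phi = 0.
Proof.
move=> mv iv orth b0 bp.
have mS := @measurable_S1 R.
have mavg n : measurable_fun setT (peak_avg n b).
  apply: measurable_funM => //.
  exact: (measurable_Rintegral_param leb (measurable_itv `[0, b]) (measurable_peak n)).
have z n : \int[leb]_(phi in S1) (v phi * peak_avg n b phi) = 0.
  have mF : measurable_fun setT (fun z : R * R => v z.1 * peak n z.1 z.2).
    apply: measurable_funM; last exact: measurable_peak.
    exact: (measurableT_comp mv measurable_fst).
  have pk1 phi a : peak n phi a <= W 1 ^+ n.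
    have w1 : 0 <= W 1 by apply: W0; lra.
    have w2 := W0 (cos_geN1 (phi - a)).
    rewrite /peak lerXn2r ?nnegrE ?w1 ?w2//.
    by apply: Wle; [exact: cos_geN1|exact: cos_le1].
  have bF (x y : R) : S1 x -> `[0, b]%classic y ->
      `|v x * peak n x y| <= `|v x| * W 1 ^+ n.
    by move=> _ _; rewrite normrM ler_wpM2l// ger0_norm ?peak_ge0.
  have i1 : leb.-integrable S1 (EFin \o (fun x => `|v x|)) by exact: integrable_norm.
  have i2 : leb.-integrable `[0, b] (EFin \o (fun _ : R => W 1 ^+ n)).
    by apply: continuous_integrable_itv; exact: continuous_cst_fun.
  have := @Rintegral_fubini R _ _ _ _ leb leb S1 `[0, b]%classic mS (measurable_itv _)
    _ _ _ mF bF i1 i2.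
  under [RHS]eq_Rintegral do rewrite /= orth.
  rewrite Rintegral_cst// mul0r /= => F0.
  transitivity ((peak_mass n)^-1 * \int[leb]_(x in S1) \int[leb]_(y in `[0, b])
    (v x * peak n x y)); last by rewrite F0 mulr0.
  have iF := @integrable_Rintegral1 R _ _ _ _ leb leb S1 `[0, b]%classic mS (measurable_itv _)
    _ _ _ mF bF i1 i2.
  rewrite -RintegralZl//; apply: eq_Rintegral => x _ /=.
  rewrite RintegralZl//; last by apply: continuous_integrable_itv; exact: continuous_peak.
  by rewrite /peak_avg; ring.
have lim1 : \int[leb]_(phi in S1) (v phi * peak_avg n b phi) @[n --> \oo] -->
    \int[leb]_(phi in S1) ((v \_ `[0, b]) phi).
  apply: (@Rdominated_convergence _ _ _ leb S1 _ _ (fun x => `|v x|)) => //.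
  - by move=> n; apply: measurable_funTS; exact: (measurable_funM mv (mavg n)).
  - apply: measurable_funTS; apply/(measurable_restrictT v (measurable_itv _)).
    exact: measurable_funTS.
  - apply: (ae_imp3 (ae_neq 0) (ae_neq b) (ae_neq twopi)) => phi /eqP p0 /eqP pb /eqP p1 S1phi.
      move: S1phi; rewrite /Defs.S1 /= in_itv /= => /andP[h1 h2].
      have {}h1 : 0 < phi by rewrite lt_neqAle eq_sym p0.
      have {}h2 : phi < twopi by rewrite lt_neqAle p1.
      have -> : (v \_ `[0, b]) phi = v phi * (if phi < b then 1 else 0).
        rewrite patchE mem_setE in_itv /= (ltW h1) /= le_eqVlt (negbTE pb) /=.
        by case: ifP; rewrite ?mulr1 ?mulr0.
      by apply: cvgM; [exact: cvg_cst|exact: peak_avg_cvg].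
  - move=> n phi _; rewrite normrM ler_piMr//.
    by rewrite ger0_norm ?peak_avg_ge0// peak_avg_le1// ltW.
  - exact: integrable_norm.
move: lim1; under eq_fun do rewrite z.
move=> lim0; have e0 := cvg_unique _ (cvg_cst 0) lim0.
transitivity (\int[leb]_(phi in S1) (v \_ `[0, b]) phi); last by rewrite -e0.
rewrite -Rintegral_mkcondr; congr (Rintegral _ _ _); rewrite setIidr// => x /=.
by rewrite /Defs.S1 /= !in_itv /= => /andP[h1 h2]; apply/andP; split; lra.
Qed.

(** The primitive of v is 0 on ]0, 2pi[, and its derivative is v almost
    everywhere. *)
Lemma peak_orthogonal_ae (v : R -> R) : measurable_fun setT v ->
  leb.-integrable S1 (EFin \o v) ->
  (forall n alpha, \int[leb]_(phi in S1) (v phi * peak n phi alpha) = 0) ->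
  {ae leb, forall phi, S1 phi -> v phi = 0}.
Proof.
move=> mv iv orth; have mS := @measurable_S1 R.
pose f := v \_ S1.
have intf : leb.-integrable setT (EFin \o f).
  have := (integrable_mkcond (mu := leb) (EFin \o v) mS).1 iv.
  by rewrite -restrict_EFin.
have H := @FTC1Ny R f (fun y => @integrableS _ _ _ leb _ _ _ measurableT (measurable_itv _) (@subsetT _ _) intf)
  (open_integrable_locally openT intf).
pose F (x : R) := \int[leb]_(t in `]-oo, x]%classic) f t.
have F0 (x : R) : 0 < x -> x < twopi -> F x = 0.
  move=> x0 x1; rewrite /F /f -Rintegral_mkcondr.
  rewrite (_ : _ `&` _ = `[0, x]%classic).
    exact: (peak_orthogonal_itv mv iv orth x0 x1).
  apply/seteqP; split => t; rewrite /Defs.S1 /= !in_itv /=.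
    by move=> [h1 /andP[h2 h3]]; rewrite h2.
  by move=> /andP[h2 h3]; split => //; rewrite h2; lra.
have aeH : {ae leb, forall x, derivable F x 1 /\ F^`()%classic x = f x} by exact: H.
apply: (ae_imp3 aeH (ae_neq 0) (ae_neq twopi)) => x [dF dFx] x0 x1 Sx.
have -> : v x = f x by rewrite /f patchE mem_set.
rewrite -dFx; move: Sx; rewrite /Defs.S1 /= in_itv /= => /andP[h1 h2].
have {}h1 : 0 < x by rewrite lt_neqAle eq_sym h1 andbT; exact/eqP.
have {}h2 : x < twopi by rewrite lt_neqAle h2 andbT; exact/eqP.
rewrite derive1E (@near_eq_derive _ _ _ _ (cst 0)) ?derive_cst//.
have xI : x \in `]0, twopi[ by rewrite in_itv /= h1 h2.
near=> y; apply: F0.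
- near: y; exact: lt_nbhsr.
- near: y; exact: lt_nbhsl.
Unshelve. all: by end_near. Qed.

End PeakedKernels.

(** * Uniqueness theorems on the circle *)

Section CircleUniqueness.
Variable R : realType.
Local Notation leb := (@lebesgue_measure R).
Local Notation S1 := (@S1 R).
Variable v : R -> R.
Hypotheses (mv : measurable_fun setT v) (iv : leb.-integrable S1 (EFin \o v)).

Let iSb (f : R -> R) (c : R) : measurable_fun setT f -> (forall x, `|f x| <= c) ->
  leb.-integrable S1 (EFin \o (fun x => v x * f x)).
Proof.
move=> mf fc; apply: (@integrable_fun_dom _ _ _ leb _ _ (fun x => c * `|v x|)).
- exact: measurable_S1.
- by apply: measurable_funTS; exact: measurable_funM.
- by move=> x _; rewrite normrM mulrC ler_wpM2r.
- apply: integrableZ_fun; first exact: measurable_S1.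
  exact: (integrable_norm iv).
Qed.

Lemma expR_cos_sin_bound (a b x : R) :
  expR (a * cos x + b * sin x) <= expR (`|a| + `|b|).
Proof.
rewrite ler_expR; apply: (le_trans (ler_norm _)); apply: (le_trans (ler_normD _ _)).
rewrite !normrM; apply: lerD; rewrite ler_piMr// ler_norml.
  by rewrite cos_geN1 cos_le1.
by rewrite sin_geN1 sin_le1.
Qed.

Lemma continuous_expR_cos_sin (a b : R) :
  continuous (fun x : R => expR (a * cos x + b * sin x)).
Proof.
apply: continuous_comp_fun; last exact: continuous_expR.
apply: continuousD_fun; apply: continuousM_fun; try exact: continuous_cst_fun.
  exact: continuous_cos.
exact: continuous_sin.
Qed.

(** exp(cos(x - alpha))^n = exp(n cos alpha cos x + n sin alpha sin x). *)
Lemma exp_orthogonal_ae :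
  (forall a b, \int[leb]_(x in S1) (v x * expR (a * cos x + b * sin x)) = 0) ->
  {ae leb, forall x, S1 x -> v x = 0}.
Proof.
move=> orth; apply: (@peak_orthogonal_ae R expR (@continuous_expR R)
  (fun c _ => expR_ge0 c) _ v mv iv).
- by move=> c d _ cd; rewrite ltr_expR.
- move=> n alpha; rewrite -[RHS](orth (n%:R * cos alpha) (n%:R * sin alpha)).
  apply: eq_Rintegral => x _; congr (_ * _); rewrite /peak -expRM_natl cosB.
  by congr expR; ring.
Qed.

(** By continuity in the exponent. A countable family is needed because each
    of the equations will hold outside a null set of its own. *)
Lemma exp_orthogonal_dense :
  (forall (i j : int) (n : nat), \int[leb]_(x in S1)
    (v x * expR (i%:~R / n.+1%:R * cos x + j%:~R / n.+1%:R * sin x)) = 0) ->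
  {ae leb, forall x, S1 x -> v x = 0}.
Proof.
move=> orth; apply: exp_orthogonal_ae => a b.
pose f n x := v x * expR (floor_step n a * cos x + floor_step n b * sin x).
pose g (x : R) := expR ((`|a| + 1) + (`|b| + 1)) * `|v x|.
have fsb n (c : R) : `|floor_step n c| <= `|c| + 1.
  have -> : floor_step n c = c + (floor_step n c - c) by rewrite addrC subrK.
  apply: (le_trans (ler_normD _ _)); rewrite lerD2l.
  apply: (le_trans (floor_step_dist n c)).
  by rewrite invf_le1 ?ltr0n// ler1n.
have mE c d : measurable_fun setT (fun x : R => v x * expR (c * cos x + d * sin x)).
  apply: measurable_funM => //; apply: continuous_measurable_fun.
  exact: continuous_expR_cos_sin.
have cv : \int[leb]_(x in S1) f n x @[n --> \oo] -->
    \int[leb]_(x in S1) (v x * expR (a * cos x + b * sin x)).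
  apply: (@Rdominated_convergence _ _ _ leb S1 _ _ g).
  - exact: measurable_S1.
  - by move=> n; apply: measurable_funTS; exact: mE.
  - by apply: measurable_funTS; exact: mE.
  - apply: aeW => x _; apply: cvgM; first exact: cvg_cst.
    have lin : floor_step n a * cos x + floor_step n b * sin x @[n --> \oo] -->
        a * cos x + b * sin x.
      by apply: cvgD; apply: cvgM; (try exact: floor_step_cvg); exact: cvg_cst.
    have := cvg_comp _ expR lin (@continuous_expR R _).
    exact.
  - move=> n x _; rewrite /f /g normrM mulrC ler_wpM2r//.
    rewrite ger0_norm ?expR_ge0//; apply: (le_trans (expR_cos_sin_bound _ _ _)).
    by rewrite ler_expR; apply: lerD; exact: fsb.
  - apply: integrableZ_fun; first exact: measurable_S1.
    exact: (integrable_norm iv).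
have z n : \int[leb]_(x in S1) f n x = 0 by exact: orth.
move: cv; under eq_fun do rewrite z.
by move=> cv; rewrite -(cvg_unique _ (cvg_cst 0) cv).
Qed.

(** (1 + cos(x - alpha))^n is a trigonometric polynomial. *)
Lemma trig_orthogonal_ae :
  (forall (k : int) (b : R), \int[leb]_(x in S1) (v x * cos (k%:~R * x + b)) = 0) ->
  {ae leb, forall x, S1 x -> v x = 0}.
Proof.
move=> orth; apply: (@peak_orthogonal_ae R (fun c => 1 + c)) => //.
- by apply: continuousD_fun => [|x]; [exact: continuous_cst_fun|exact: cvg_id].
- by move=> c c1; lra.
- by move=> c d _ cd; rewrite ltrD2l.
have mcos (a b : R) : measurable_fun setT (fun x : R => cos (a * x + b)).
  by apply: measurable_cos_comp; exact: measurable_affine.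
have cos1 (x : R) : `|cos x| <= 1 by rewrite ler_norml cos_geN1 cos_le1.
(* 1 + cos shifts the frequency by at most one: cos x cos y is half the sum of
   cos (x + y) and cos (x - y). *)
suff H n alpha (k : int) b : \int[leb]_(x in S1)
    (v x * (peak (fun c => 1 + c) n x alpha * cos (k%:~R * x + b))) = 0.
  move=> n alpha; rewrite -[RHS](H n alpha 0 0); apply: eq_Rintegral => x _.
  by rewrite mul0r addr0 cos0 mulr1.
elim: n k b => [|n IHn] k b.
  rewrite -[RHS](orth k b); apply: eq_Rintegral => x _.
  by rewrite /peak expr0 mul1r.
have mp m : measurable_fun setT (fun x : R => peak (fun c => 1 + c) m x alpha).
  apply: measurable_funX; apply: measurable_funD => //.
  by apply: measurable_cos_comp; exact: measurable_funB.
have ic (j : int) (c : R) : leb.-integrable S1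
    (EFin \o (fun x => v x * (peak (fun c => 1 + c) n x alpha * cos (j%:~R * x + c)))).
  apply: (@iSb _ (2 ^+ n)).
    by apply: measurable_funM => //; exact: mcos.
  move=> x; rewrite normrM -[leRHS]mulr1; apply: ler_pM => //.
  rewrite /peak normrX lerXn2r ?nnegrE// ger0_norm.
    by have := cos_le1 (x - alpha); lra.
  by have := cos_geN1 (x - alpha); lra.
have e x : v x * (peak (fun c => 1 + c) n.+1 x alpha * cos (k%:~R * x + b)) =
   v x * (peak (fun c => 1 + c) n x alpha * cos (k%:~R * x + b)) +
   (2^-1 * (v x * (peak (fun c => 1 + c) n x alpha * cos ((k + 1)%:~R * x + (b - alpha)))) +
    2^-1 * (v x * (peak (fun c => 1 + c) n x alpha * cos ((k - 1)%:~R * x + (b + alpha))))).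
  have -> : (k + 1)%:~R * x + (b - alpha) = (k%:~R * x + b) + (x - alpha) :> R.
    by rewrite intrD; ring.
  have -> : (k - 1)%:~R * x + (b + alpha) = (k%:~R * x + b) - (x - alpha) :> R.
    by rewrite intrD mulrNz; ring.
  rewrite /peak exprS; move: (_ * x + b) (x - alpha) => y z.
  by rewrite cosD cosB; move: (_ ^+ n) => p; field.
under eq_Rintegral do rewrite e.
have i3 (j : int) (c : R) := integrableZ_fun (@measurable_S1 R) 2^-1 (ic j c).
rewrite RintegralD//; [|exact: measurable_S1|exact: (integrableD_fun (@measurable_S1 R) (i3 _ _) (i3 _ _))].
rewrite RintegralD//; last exact: measurable_S1.
rewrite !RintegralZl//; try exact: measurable_S1.
by rewrite !IHn !mulr0 !addr0.
Qed.

End CircleUniqueness.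

(** * Densities on the circle and the space H_Omega *)

Section SquareIntegrable.
Variable R : realType.
Local Notation C := R[i].
Local Notation leb := (@lebesgue_measure R).
Local Notation S1 := (@S1 R).
Local Notation mS1 := (@measurable_S1 R).
Implicit Types (u v : R -> C).

Lemma L2S1_integrable_sqr u : L2S1 u ->
  leb.-integrable S1 (EFin \o (fun x => cabs (u x) ^+ 2)).
Proof.
move=> [_ mu fu]; apply/integrableP; split.
  apply/measurable_EFinP; apply: measurable_funTS; apply: measurable_funX.
  exact: measurable_cabs.
under eq_integral do rewrite /= ger0_norm ?sqr_ge0//.
exact: fu.
Qed.

Lemma L2S1_integrable_abs u : L2S1 u -> leb.-integrable S1 (EFin \o (fun x => cabs (u x))).
Proof.
move=> Lu; have [_ mu _] := Lu.
apply: (@integrable_fun_dom _ _ _ leb _ _ (fun x => 1 + cabs (u x) ^+ 2)).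
- exact: mS1.
- by apply: measurable_funTS; exact: measurable_cabs.
- move=> x _; rewrite ger0_norm ?cabs_ge0//.
  by have := sqr_ge0 (cabs (u x) - 1); have := cabs_ge0 (u x); nra.
- apply: integrableD_fun; [exact: mS1|exact: integrable_cst_S1|exact: L2S1_integrable_sqr].
Qed.

Lemma cintegrable_mul_bounded u (k : R -> C) (c : R) : cmeasurable u ->
  leb.-integrable S1 (EFin \o (fun x => cabs (u x))) ->
  cmeasurable k -> (forall x, cabs (k x) <= c) ->
  cintegrable leb S1 (fun x => u x * k x).
Proof.
move=> mu iu mk kc.
apply: (cintegrable_dom mS1 (g := fun x => c * cabs (u x))).
- exact: cmeasurableM.
- by move=> x _; rewrite cabsM mulrC ler_wpM2r// cabs_ge0.
- by apply: integrableZ_fun; [exact: mS1|exact: iu].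
Qed.

Lemma L2S1_mul u (k : R -> C) (c : R) : L2S1 u -> periodic k (pi *+ 2) ->
  cmeasurable k -> (forall x, cabs (k x) <= c) -> L2S1 (fun x => u x * k x).
Proof.
move=> Lu pk mk kc; have [pu mu _] := Lu; split.
- by move=> x; rewrite pu pk.
- exact: cmeasurableM.
have c0 : 0 <= c by exact: le_trans (cabs_ge0 _) (kc 0).
have : leb.-integrable S1 (EFin \o (fun x => cabs (u x * k x) ^+ 2)).
  apply: (@integrable_fun_dom _ _ _ leb _ _ (fun x => c ^+ 2 * cabs (u x) ^+ 2)).
  - exact: mS1.
  - apply: measurable_funTS; apply: measurable_funX.
    by apply: measurable_cabs; exact: cmeasurableM.
  - move=> x _; rewrite ger0_norm ?sqr_ge0// cabsM exprMn mulrC ler_wpM2r ?sqr_ge0//.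
    by rewrite lerXn2r ?nnegrE ?cabs_ge0.
  - by apply: integrableZ_fun; [exact: mS1|exact: L2S1_integrable_sqr].
move=> /integrableP[_]; under eq_integral do rewrite /= ger0_norm ?sqr_ge0//.
by [].
Qed.

Lemma complex_exp_orthogonal u : cmeasurable u ->
  leb.-integrable S1 (EFin \o (fun x => cabs (u x))) ->
  (forall (i j : int) (n : nat), cintegral leb S1 (fun x => u x *
    (expR (i%:~R / n.+1%:R * cos x + j%:~R / n.+1%:R * sin x))%:C) = 0) ->
  {ae leb, forall x, S1 x -> u x = 0}.
Proof.
move=> mu iu orth; have [m1 m2] := mu.
have i1 : leb.-integrable S1 (EFin \o (fun x => Re (u x))).
  apply: (integrable_fun_dom mS1 _ _ iu); first exact: measurable_funTS.
  by move=> x _; exact: cabs_Re.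
have i2 : leb.-integrable S1 (EFin \o (fun x => Im (u x))).
  apply: (integrable_fun_dom mS1 _ _ iu); first exact: measurable_funTS.
  by move=> x _; exact: cabs_Im.
have r0 : {ae leb, forall x, S1 x -> Re (u x) = 0}.
  apply: exp_orthogonal_dense => // i j n.
  have /(congr1 (@complex.Re R)) := orth i j n; rewrite /= => <-.
  by apply: eq_Rintegral => x _; rewrite ReM /= mulr0 subr0.
have r1 : {ae leb, forall x, S1 x -> Im (u x) = 0}.
  apply: exp_orthogonal_dense => // i j n.
  have /(congr1 (@complex.Im R)) := orth i j n; rewrite /= => <-.
  by apply: eq_Rintegral => x _; rewrite ImM /= mulr0 add0r.
by apply: (ae_imp2 r0 r1) => x x1 x2 Sx; apply: complex_ext; rewrite ?x1 ?x2.
Qed.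

Lemma L2ip_ae u u' v v' :
  {ae leb, forall x, S1 x -> u x = u' x} -> {ae leb, forall x, S1 x -> v x = v' x} ->
  L2ip u v = L2ip u' v'.
Proof.
move=> uu vv; apply: eq_cintegral_ae.
by apply: (ae_imp2 uu vv) => x x1 x2 Sx; rewrite x1// x2.
Qed.

Lemma L2ip_self u : Re (L2ip u u) = \int[leb]_(x in S1) cabs (u x) ^+ 2.
Proof. by apply: eq_Rintegral => x _; rewrite !cE sqr_cabs; ring. Qed.

Lemma sqr_sqrt_L2ip u : Num.sqrt (Re (L2ip u u)) ^+ 2 = \int[leb]_(x in S1) cabs (u x) ^+ 2.
Proof.
rewrite L2ip_self sqr_sqrtr//; apply: Rintegral_ge0 => x _; exact: sqr_ge0.
Qed.

End SquareIntegrable.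

Section HOmegaSpace.
Variable R : realType.
Local Notation C := R[i].
Local Notation leb := (@lebesgue_measure R).
Local Notation S1 := (@S1 R).
Local Notation mS1 := (@measurable_S1 R).
Variable Omega : R.
Hypothesis Omega_gt0 : 0 < Omega.
Implicit Types (u v : R -> C) (psi : R * R -> C).

Definition on_circle psi (phi : R) : C :=
  conjc (fourier2 psi (Omega * cos phi, Omega * sin phi)).

Lemma HOmega_distE u psi :
  HOmega_dist Omega u psi = cintegral leb S1 (fun phi => u phi * on_circle psi phi).
Proof. by []. Qed.

Lemma on_circle_measurable psi : cmeasurable psi -> cmeasurable (on_circle psi).
Proof.
move=> mpsi; apply: cmeasurableJ.
apply: (cmeasurable_comp (g := fun phi : R => (Omega * cos phi, Omega * sin phi))
  (fourier2_measurable mpsi)).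
apply: measurable_fun_pair; apply: measurable_funM => //.
  by apply: continuous_measurable_fun; exact: continuous_cos.
by apply: continuous_measurable_fun; exact: continuous_sin.
Qed.

Lemma on_circle_bound c psi phi : decays c psi ->
  cabs (on_circle psi phi) <= c * (pi^-1 * lorentz2_mass R).
Proof. by move=> dc; rewrite cabsJ; exact: fourier2_bound. Qed.

Lemma on_circleD c c' psi psi' a phi : decays c psi -> decays c' psi' ->
  on_circle (fun x => a * psi x + psi' x) phi =
  conjc a * on_circle psi phi + on_circle psi' phi.
Proof.
by move=> d d'; rewrite /on_circle (fourier2D _ _ d d') rmorphD rmorphM.
Qed.

Lemma HOmega_dist_ae u v : {ae leb, forall x, S1 x -> u x = v x} ->
  forall psi, HOmega_dist Omega u psi = HOmega_dist Omega v psi.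
Proof.
move=> uv psi; rewrite !HOmega_distE; apply: eq_cintegral_ae.
by apply: (ae_imp uv) => x h Sx; rewrite h.
Qed.

Section Density.
Variable u : R -> C.
Hypotheses (mu : cmeasurable u)
  (iu : leb.-integrable S1 (EFin \o (fun x => cabs (u x)))).

Lemma HOmega_integrable c psi : decays c psi ->
  cintegrable leb S1 (fun phi => u phi * on_circle psi phi).
Proof.
move=> dc; apply: (cintegrable_mul_bounded mu iu).
  by apply: on_circle_measurable; case: dc.
by move=> x; exact: on_circle_bound dc.
Qed.

Lemma HOmega_distD c c' psi psi' a : decays c psi -> decays c' psi' ->
  HOmega_dist Omega u (fun x => a * psi x + psi' x) =
  conjc a * HOmega_dist Omega u psi + HOmega_dist Omega u psi'.
Proof.
move=> d d'; rewrite !HOmega_distE.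
have i1 := HOmega_integrable d. have i2 := HOmega_integrable d'.
rewrite -(cintegralZ mS1 (conjc a) i1) -(cintegralD mS1 (cintegrableZ mS1 (conjc a) i1) i2).
by apply: eq_cintegral => x _; rewrite (on_circleD _ _ d d'); ring.
Qed.

Lemma tempered_HOmega : tempered (HOmega_dist Omega u).
Proof.
split.
  move=> a psi psi' /schwartz2_decays[c d] /schwartz2_decays[c' d'].
  exact: (HOmega_distD a d d').
pose I := \int[leb]_(x in S1) cabs (u x).
exists (2 * (4 * (pi^-1 * lorentz2_mass R) * I)), 2%N => psi M sp bd.
have mpsi := ccontinuous_measurable2 (schwartz2_continuous sp).
have sB : {subset [::] <= @basis2 R} by [].
have d := seminorms_decays mpsi (bd 0%N 0%N [::] isT isT isT sB)
  (bd 2%N 0%N [::] isT isT isT sB) (bd 0%N 2%N [::] isT isT isT sB)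
  (bd 2%N 2%N [::] isT isT isT sB).
set c := M + M + M + M in d.
have iK := integrableZ_fun mS1 (c * (pi^-1 * lorentz2_mass R)) iu.
have mK : cmeasurable (fun phi => u phi * on_circle psi phi).
  by apply: cmeasurableM => //; exact: on_circle_measurable.
have := cabs_cintegral_le (mu := leb) mS1 mK _ iK.
rewrite RintegralZl//; last exact: mS1.
move=> H; apply: (le_trans (H _)).
  move=> x _; rewrite cabsM mulrC ler_wpM2r ?cabs_ge0//.
  exact: on_circle_bound.
by rewrite /c -/I le_eqVlt; apply/orP; left; apply/eqP; ring.
Qed.

End Density.

Lemma in_HOmega_dist u : L2S1 u -> in_HOmega Omega (HOmega_dist Omega u).
Proof.
move=> Lu; have [_ mu _] := Lu; split; last by exists u.
by apply: tempered_HOmega => //; exact: L2S1_integrable_abs.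
Qed.

(** At mu = 0 and theta = 0 the Fourier transform of a test mode restricts, on
    the circle, to a multiple of exp(s.(cos phi, sin phi)). *)
Definition exp_test (s : R * R) (q : R * R) : C := test_mode Omega 0 s 0 0 (q, 0).

Lemma exp_test_schwartz s : schwartz2 (exp_test s).
Proof. exact: (rapid_slice 0 (test_mode_rapid Omega 0 s 0 0)). Qed.

Lemma on_circle_exp_test s phi : on_circle (exp_test s) phi =
  (mode_const Omega 0 s)%:C * (expR (s.1 * cos phi + s.2 * sin phi))%:C.
Proof.
rewrite /on_circle /exp_test fourier2_test_mode// mul0r addr0 cos0 mul1r.
rewrite /mode_profile mul0r subr0 rmorphM; apply: complex_ext; rewrite !cE /=; ring.
Qed.

(** Schwartz functions whose Fourier transforms restrict to exponentials on
    the circle suffice to separate densities. *)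
Lemma HOmega_dist_inj u v : L2S1 u -> L2S1 v ->
  tdist_eq (HOmega_dist Omega u) (HOmega_dist Omega v) ->
  {ae leb, forall x, S1 x -> u x = v x}.
Proof.
move=> Lu Lv uv; have [_ mu _] := Lu; have [_ mv _] := Lv.
have iu := L2S1_integrable_abs Lu. have iv := L2S1_integrable_abs Lv.
pose w x := u x + (-1) * v x.
have mw : cmeasurable w.
  by apply: cmeasurableD => //; apply: cmeasurableM => //; exact: cmeasurable_cst.
have iw : leb.-integrable S1 (EFin \o (fun x => cabs (w x))).
  apply: (@integrable_fun_dom _ _ _ leb _ _ (fun x => cabs (u x) + cabs (v x))).
  - exact: mS1.
  - by apply: measurable_funTS; exact: measurable_cabs.
  - move=> x _; rewrite ger0_norm ?cabs_ge0//; apply: (le_trans (cabsD _ _)).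
    by rewrite cabsM -(rmorphN1 (real_complex R)) cabsR normrN1 mul1r.
  - by apply: integrableD_fun => //; exact: mS1.
suff : {ae leb, forall x, S1 x -> w x = 0}.
  move=> aw; apply: (ae_imp aw) => x wx Sx; have := wx Sx.
  by rewrite /w mulN1r => /eqP; rewrite subr_eq0 => /eqP.
apply: complex_exp_orthogonal => // i j n.
pose s : R * R := (i%:~R / n.+1%:R, j%:~R / n.+1%:R).
have := uv _ (exp_test_schwartz s); rewrite !HOmega_distE.
have [c d] := schwartz2_decays (exp_test_schwartz s).
have i1 := HOmega_integrable mu iu d. have i2 := HOmega_integrable mv iv d.
move=> e.
have k0 : (mode_const Omega 0 s)%:C != 0 :> C.
  rewrite -(rmorph0 (real_complex R)) (inj_eq (@complexI R)).
  by rewrite gt_eqF// mode_const_gt0.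
apply: (mulfI k0); rewrite mulr0.
have iE : cintegrable leb S1 (fun x => w x * (expR (s.1 * cos x + s.2 * sin x))%:C).
  apply: (cintegrable_mul_bounded mw iw (c := expR (`|s.1| + `|s.2|))).
    apply: cmeasurable_real; apply: continuous_measurable_fun.
    exact: continuous_expR_cos_sin.
  by move=> x; rewrite cabsR ger0_norm ?expR_ge0// expR_cos_sin_bound.
rewrite -(cintegralZ mS1 _ iE).
transitivity (cintegral leb S1 (fun phi => u phi * on_circle (exp_test s) phi) +
  (-1) * cintegral leb S1 (fun phi => v phi * on_circle (exp_test s) phi)).
  rewrite -(cintegralZ mS1 _ i2) -(cintegralD mS1 i1 (cintegrableZ mS1 _ i2)).
  by apply: eq_cintegral => x _; rewrite on_circle_exp_test /w; ring.
by rewrite e mulN1r subrr.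
Qed.

Lemma HOmega_densityP (T : tdist R) : in_HOmega Omega T ->
  L2S1 (HOmega_density Omega T) /\
  tdist_eq T (HOmega_dist Omega (HOmega_density Omega T)).
Proof.
move=> [_ [u Lu Tu]]; rewrite /HOmega_density; case: xgetP => [v _ //|].
by move=> /(_ u) /not_andP[].
Qed.

Lemma HOmega_density_ae (T : tdist R) u : in_HOmega Omega T -> L2S1 u ->
  tdist_eq T (HOmega_dist Omega u) ->
  {ae leb, forall x, S1 x -> HOmega_density Omega T x = u x}.
Proof.
move=> inT Lu Tu; have [Lv Tv] := HOmega_densityP inT.
by apply: HOmega_dist_inj => // psi sp; rewrite -Tv// Tu.
Qed.

Lemma HOmega_ipE (S T : tdist R) u v : in_HOmega Omega S -> in_HOmega Omega T ->
  L2S1 u -> L2S1 v -> tdist_eq S (HOmega_dist Omega u) ->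
  tdist_eq T (HOmega_dist Omega v) -> HOmega_ip Omega S T = L2ip u v.
Proof.
by move=> iS iT Lu Lv Su Tv; apply: L2ip_ae; exact: HOmega_density_ae.
Qed.

End HOmegaSpace.

(** * The analysis operator *)

Section Tonelli.
Context d1 d2 (T1 : measurableType d1) (T2 : measurableType d2) (R : realType).
Variables (m1 : {sigma_finite_measure set T1 -> \bar R})
          (m2 : {sigma_finite_measure set T2 -> \bar R}).
Variables (D1 : set T1) (D2 : set T2).
Hypotheses (mD1 : measurable D1) (mD2 : measurable D2).
Local Open Scope ereal_scope.

Lemma tonelli_on (f : T1 * T2 -> \bar R) : measurable_fun setT f ->
  (forall z, 0 <= f z) ->
  \int[m1]_(x in D1) \int[m2]_(y in D2) f (x, y) =
  \int[m2]_(y in D2) \int[m1]_(x in D1) f (x, y).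
Proof.
move=> mf f0; have mD : measurable (D1 `*` D2) by exact: measurableX.
have mg : measurable_fun setT (f \_ (D1 `*` D2)).
  by apply/(measurable_restrictT f mD); exact: measurable_funS mf.
have g0 z : 0 <= (f \_ (D1 `*` D2)) z by rewrite patchE; case: ifP.
have := fubini_tonelli (m1 := m1) (m2 := m2) _ mg g0.
have -> : \int[m1]_x \int[m2]_y (f \_ (D1 `*` D2)) (x, y) =
    \int[m1]_(x in D1) \int[m2]_(y in D2) f (x, y).
  rewrite [RHS]integral_mkcond; apply: eq_integral => x _.
  rewrite [RHS]patchE; case: ifPn => xD.
    rewrite [RHS]integral_mkcond; apply: eq_integral => y _.
    by rewrite !patchE in_setX xD.
  by rewrite integral0_eq// => y _; rewrite patchE in_setX (negbTE xD).
have -> // : \int[m2]_y \int[m1]_x (f \_ (D1 `*` D2)) (x, y) =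
    \int[m2]_(y in D2) \int[m1]_(x in D1) f (x, y).
rewrite [RHS]integral_mkcond; apply: eq_integral => y _.
rewrite [RHS]patchE; case: ifPn => yD.
  rewrite [RHS]integral_mkcond; apply: eq_integral => x _.
  by rewrite !patchE in_setX yD andbT.
by rewrite integral0_eq// => x _; rewrite patchE in_setX (negbTE yD) andbF.
Qed.

End Tonelli.

Section PeriodicAlmostEverywhere.
Variable R : realType.
Local Notation leb := (@lebesgue_measure R).
Local Notation S1 := (@S1 R).
Local Notation twopi := (pi *+ 2 : R).

Lemma lebesgue_shift (A : set (measurableTypeR R)) (c : R) : measurable A ->
  measurable [set x : measurableTypeR R | A (x + c)] /\
  leb [set x : measurableTypeR R | A (x + c)] = leb A.
Proof.
move=> mA.
have mphi : measurable_fun setT (fun x : measurableTypeR R => (x + c)%R : measurableTypeR R).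
  exact: measurable_funD.
have mAc : measurable [set x : measurableTypeR R | A (x + c)].
  by rewrite -[X in measurable X]setTI; exact: mphi.
split => //.
have := @integral_shift R c A (cst 1%E) mA (measurable_cst _) (fun=> lee01).
by rewrite !integral_cst// !mul1e => ->.
Qed.

(** The translates of a null set by the multiples of 2pi form a null set, and
    every point is congruent to one of [0, 2pi]. *)
Lemma ae_periodic (P : R -> Prop) : (forall x, P (x + twopi) <-> P x) ->
  {ae leb, forall x, S1 x -> P x} -> {ae leb, forall x, P x}.
Proof.
move=> pP [N [mN N0 NP]].
pose M (k : int) := [set x : measurableTypeR R | N (x + k%:~R * twopi)].
have Mk k : measurable (M k) /\ leb (M k) = 0%E.
  by have [h1 h2] := lebesgue_shift (k%:~R * twopi) mN; split=> //; rewrite h2.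
pose F (n : nat) : set (measurableTypeR R) := if unpickle n is Some k then M k else set0.
have F0 n : leb.-negligible (F n).
  rewrite /F; case: (unpickle n) => [k|]; last exact: negligible_set0.
  by have [h1 h2] := Mk k; exact/negligibleP.
have := negligible_bigcup F0; apply: negligibleS => x /= Px.
have Pn n y : P (y + n%:R * twopi) <-> P y.
  elim: n => [|n IHn]; first by rewrite mul0r addr0.
  by rewrite -natr1 mulrDl mul1r addrA pP.
have Pk (k : int) y : P (y + k%:~R * twopi) <-> P y.
  case: k => n; first exact: Pn.
  rewrite NegzE mulrNz mulNr -(Pn n.+1 (y - _)) -pmulrn subrK.
  by [].
have t0 := twopi_gt0 R.
have [k Sx] : exists k : int, S1 (x + k%:~R * twopi).
  exists (- Num.floor (x / twopi)); rewrite /Defs.S1 /= in_itv /= mulrNz mulNr.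
  have k1 : (Num.floor (x / twopi))%:~R * twopi <= x.
    by rewrite -ler_pdivlMr// Num.Theory.floor_le.
  have k2 : x < ((Num.floor (x / twopi))%:~R + 1) * twopi.
    by rewrite -ltr_pdivrMr// -[1%R]/(1%:~R) -intrD Num.Theory.floorD1_gt.
  move: k1 k2; move: (_ %:~R : R) => z k1 k2.
  by apply/andP; split; [lra|rewrite mulrDl mul1r in k2; lra].
exists (pickle k); first by [].
rewrite /F pickleK /M.
by apply: NP => /= /(_ Sx) /Pk.
Qed.

End PeriodicAlmostEverywhere.

Section AnalysisOperator.
Variable R : realType.
Local Notation C := R[i].
Local Notation leb := (@lebesgue_measure R).
Local Notation S1 := (@S1 R).
Local Notation mS1 := (@measurable_S1 R).
Local Notation twopi := (pi *+ 2 : R).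
Variable Omega : R.
Hypothesis Omega_gt0 : 0 < Omega.
Variables (u0 Phi : R -> C).
Hypotheses (Lu0 : L2S1 u0) (LPhi : L2S1 Phi).

Let pu0 : periodic u0 twopi. Proof. by case: Lu0. Qed.
Let mu0 : cmeasurable u0. Proof. by case: Lu0. Qed.
Let mPhi : cmeasurable Phi. Proof. by case: LPhi. Qed.

Lemma conjcM (a b : C) : conjc (a * b) = conjc a * conjc b.
Proof. exact: rmorphM. Qed.

Lemma conjc_invol (z : C) : conjc (conjc z) = z.
Proof. by apply: complex_ext; rewrite ?ReJ ?ImJ ?opprK. Qed.

(** The factor 2pi comes from the unitary normalization of the Fourier
    transform. *)
Definition analysis_density (theta phi : R) : C :=
  (twopi)%:C * (Phi phi * conjc (u0 (phi - theta))).

Lemma cmeasurable_shift (theta : R) : cmeasurable (fun phi : R => u0 (phi - theta)).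
Proof. by apply: (cmeasurable_comp mu0); exact: measurable_funB. Qed.

Lemma cmeasurable_u0_diff : cmeasurable (fun z : R * R => u0 (z.2 - z.1)).
Proof. by apply: (cmeasurable_comp mu0); exact: measurable_funB. Qed.

Lemma cmeasurable_density2 :
  cmeasurable (fun z : R * R => analysis_density z.1 z.2).
Proof.
apply: cmeasurableM; first exact: cmeasurable_cst.
apply: cmeasurableM; first exact: (cmeasurable_comp mPhi measurable_snd).
by apply: cmeasurableJ; exact: cmeasurable_u0_diff.
Qed.

Lemma cmeasurable_density theta : cmeasurable (analysis_density theta).
Proof.
apply: cmeasurableM; first exact: cmeasurable_cst.
by apply: cmeasurableM => //; apply: cmeasurableJ; exact: cmeasurable_shift.
Qed.

Let sqr_u0 (t : R) : \bar R := (cabs (u0 t) ^+ 2)%:E.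

Let msqr : measurable_fun setT sqr_u0.
Proof.
by apply/measurable_EFinP; apply: measurable_funX; exact: measurable_cabs.
Qed.

Let sqr0 t : (0 <= sqr_u0 t)%E. Proof. by rewrite lee_fin sqr_ge0. Qed.
Let sqrT t : sqr_u0 (t + twopi) = sqr_u0 t. Proof. by rewrite /sqr_u0 pu0. Qed.

Lemma integrable_shift_sqr theta :
  leb.-integrable S1 (EFin \o (fun phi => cabs (u0 (phi - theta)) ^+ 2)).
Proof.
apply/integrableP; split.
  apply/measurable_EFinP; apply: measurable_funTS; apply: measurable_funX.
  exact: (measurable_cabs (cmeasurable_shift theta)).
under eq_integral do rewrite /= ger0_norm ?sqr_ge0//.
rewrite (integral_circle_rotate (twopi_gt0 R) msqr sqr0 sqrT theta).
by case: Lu0.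
Qed.

Lemma integrable_density_abs theta :
  leb.-integrable S1 (EFin \o (fun phi => cabs (analysis_density theta phi))).
Proof.
apply: (@integrable_fun_dom _ _ _ leb _ _
   (fun phi => twopi * (cabs (Phi phi) ^+ 2 + cabs (u0 (phi - theta)) ^+ 2))).
- exact: mS1.
- by apply: measurable_funTS; exact: (measurable_cabs (cmeasurable_density theta)).
- move=> phi _; rewrite ger0_norm ?cabs_ge0// /analysis_density !cabsM cabsR cabsJ.
  rewrite (ger0_norm (ltW (twopi_gt0 R))) (ler_wpM2l (ltW (twopi_gt0 R)))//.
  move: (cabs_ge0 (Phi phi)) (cabs_ge0 (u0 (phi - theta))).
  by move: (cabs _) (cabs _) => a b a0 b0; have := sqr_ge0 (a - b); nra.
- apply: integrableZ_fun; first exact: mS1.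
  apply: integrableD_fun; first exact: mS1.
    exact: L2S1_integrable_sqr.
  exact: integrable_shift_sqr.
Qed.

(** Fubini on the product of the plane and the circle: integrating over the
    plane first produces the Fourier transform of psi on the circle. *)
Lemma analysis_pairing theta c psi : decays c psi ->
  HSE2_of_fun (analysis_op Omega u0 Phi) theta psi =
  HOmega_dist Omega (analysis_density theta) psi.
Proof.
move=> dc; have [mpsi cpsi] := dc.
pose B phi := Phi phi * conjc (u0 (phi - theta)).
pose F (z : (R * R) * R) := (cexpi (Omega * (z.1.1 * cos z.2 + z.1.2 * sin z.2)) *
   conjc (psi z.1)) * B z.2.
have mB : cmeasurable B.
  by apply: cmeasurableM => //; apply: cmeasurableJ; exact: cmeasurable_shift.
have iB : leb.-integrable S1 (EFin \o (fun phi => cabs (B phi))).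
  have := integrableZ_fun mS1 twopi^-1 (integrable_density_abs theta).
  apply: eq_integrable; first exact: mS1.
  move=> x _ /=; rewrite /analysis_density cabsM cabsR ger0_norm ?ltW ?twopi_gt0//.
  by rewrite mulKf// gt_eqF ?twopi_gt0.
have mF : cmeasurable F.
  apply: cmeasurableM; last exact: (cmeasurable_comp mB measurable_snd).
  apply: cmeasurableM; last first.
    by apply: cmeasurableJ; exact: (cmeasurable_comp mpsi measurable_fst).
  apply: cmeasurable_expi; apply: measurable_funM => //.
  apply: measurable_funD; apply: measurable_funM.
  - exact: (measurableT_comp measurable_fst measurable_fst).
  - by apply: measurable_cos_comp; exact: measurable_snd.
  - exact: (measurableT_comp measurable_snd measurable_fst).
  - by apply: measurable_sin_comp; exact: measurable_snd.
have bF (q : R * R) (phi : R) : setT q -> S1 phi ->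
    cabs (F (q, phi)) <= (c * lorentz2 q) * cabs (B phi).
  by move=> _ _; rewrite !cabsM cabs_expi mul1r cabsJ -cabsM ler_wpM2r ?cabs_ge0.
have fub := @cintegral_fubini R _ _ _ _ (plane_measure R) leb setT S1 measurableT mS1
  F _ _ mF bF (integrable_cst_lorentz2 c) iB.
transitivity (cintegral (plane_measure R) setT
    (fun q => cintegral leb S1 (fun phi => F (q, phi)))).
  apply: eq_cintegral => q _; rewrite /analysis_op /L2ip mulrC.
  have iq : cintegrable leb S1 (fun phi => conjc (Pi_rep Omega q theta u0 phi) * Phi phi).
    apply: (cintegrable_dom mS1 (g := fun x => cabs (B x))) => //.
    - apply: cmeasurableM => //; apply: cmeasurableJ; apply: cmeasurableM.
        apply: cmeasurable_expi; apply: measurableT_comp => //.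
        apply: measurable_funM => //; apply: measurable_funD; apply: measurable_funM => //.
          by apply: continuous_measurable_fun; exact: continuous_cos.
        by apply: continuous_measurable_fun; exact: continuous_sin.
      exact: cmeasurable_shift.
    - by move=> x _; rewrite cabsM cabsJ cabsM cabs_expi mul1r /B cabsM cabsJ mulrC.
  rewrite -(cintegralZ mS1 _ iq); apply: eq_cintegral => phi _.
  rewrite /Pi_rep conjcM cexpiN conjc_invol /F /B /=; ring.
rewrite fub HOmega_distE; apply: eq_cintegral => phi _.
have dq := decays_expi (h := fun q : R * R => - (Omega * cos phi * q.1 + Omega * sin phi * q.2)) _ dc.
have {}dq := dq (measurable_dot (Omega * cos phi, Omega * sin phi)).
have iq := decays_integrable (decaysJ dq).
rewrite /on_circle /fourier2 conjcM /analysis_density -/(B phi).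
rewrite -(cintegralJ measurableT (decays_integrable dq)).
have tp : twopi != 0 by rewrite gt_eqF ?twopi_gt0.
transitivity (B phi * planeint (fun z => conjc (cexpi (- (Omega * cos phi * z.1 + Omega * sin phi * z.2)) * psi z))).
  rewrite -(cintegralZ measurableT (B phi) iq); apply: eq_cintegral => q _.
  rewrite /F conjcM cexpiN conjc_invol mulrC /=; congr (_ * (cexpi _ * _)); ring.
rewrite mulrA; congr (_ * _).
rewrite (_ : conjc (twopi^-1)%:C = (twopi^-1)%:C); last first.
  by apply: complex_ext; rewrite /= ?oppr0.
rewrite mulrAC -rmorphM mulfV// rmorph1 mul1r //.
Qed.

(** Possibly infinite on a null set of angles, since the product of two square
    integrable functions need not be square integrable. *)
Definition density_sqr (theta : R) : \bar R :=
  (\int[leb]_(phi in S1) (cabs (Phi phi) ^+ 2 * cabs (u0 (phi - theta)) ^+ 2)%:E)%E.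

Let joint (z : R * R) : \bar R := (cabs (Phi z.2) ^+ 2 * cabs (u0 (z.2 - z.1)) ^+ 2)%:E.

Let mjoint : measurable_fun setT joint.
Proof.
apply/measurable_EFinP; apply: measurable_funM; apply: measurable_funX.
  by apply: (measurableT_comp (measurable_cabs mPhi)); exact: measurable_snd.
exact: (measurable_cabs cmeasurable_u0_diff).
Qed.

Let joint0 z : (0 <= joint z)%E.
Proof. by rewrite lee_fin mulr_ge0// sqr_ge0. Qed.

Lemma density_sqr_ge0 theta : (0 <= density_sqr theta)%E.
Proof. by apply: integral_ge0 => phi _; exact: (joint0 (theta, phi)). Qed.

Lemma measurable_density_sqr : measurable_fun setT density_sqr.
Proof. exact: (@measurable_ge0_param R _ _ _ _ leb S1 mS1 joint mjoint joint0). Qed.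

Definition sqr_norm (u : R -> C) : R := \int[leb]_(phi in S1) cabs (u phi) ^+ 2.

Lemma sqr_normE u : L2S1 u ->
  (\int[leb]_(phi in S1) (cabs (u phi) ^+ 2)%:E)%E = (sqr_norm u)%:E.
Proof.
move=> Lu; rewrite /sqr_norm /Rintegral fineK//.
by apply: integrable_fin_num; [exact: mS1|exact: L2S1_integrable_sqr].
Qed.

Lemma sqr_norm_ge0 u : 0 <= sqr_norm u.
Proof. by apply: Rintegral_ge0 => x _; exact: sqr_ge0. Qed.

(** Tonelli: for fixed phi, the integral over theta of |u0(phi - theta)|^2 is
    the squared norm of u0. *)
Lemma integral_density_sqr :
  (\int[leb]_(theta in S1) density_sqr theta = (sqr_norm Phi * sqr_norm u0)%:E)%E.
Proof.
rewrite (@tonelli_on _ _ _ _ R leb leb S1 S1 mS1 mS1 joint mjoint joint0).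
transitivity (\int[leb]_(phi in S1) ((sqr_norm u0)%:E * (cabs (Phi phi) ^+ 2)%:E))%E.
  apply: eq_integral => phi _; rewrite /joint /=.
  under eq_integral do rewrite EFinM.
  rewrite ge0_integralZl//.
  - by rewrite (integral_circle_reflect (twopi_gt0 R) msqr sqr0 sqrT phi) sqr_normE// muleC.
  - exact: mS1.
  - apply: measurable_funTS; apply: (measurableT_comp msqr).
    exact: measurable_funB.
  - by move=> x _; rewrite lee_fin sqr_ge0.
  - by rewrite lee_fin sqr_ge0.
rewrite ge0_integralZl//.
- by rewrite sqr_normE// -EFinM mulrC.
- exact: mS1.
- apply/measurable_EFinP; apply: measurable_funTS; apply: measurable_funX.
  exact: measurable_cabs.
- by move=> x _; rewrite lee_fin sqr_ge0.
- by rewrite lee_fin sqr_norm_ge0.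
Qed.

Lemma density_sqr_periodic theta : density_sqr (theta + twopi) = density_sqr theta.
Proof.
apply: eq_integral => phi _; congr (_ * cabs _ ^+ 2)%:E.
by rewrite -[in RHS](subrK twopi (phi - theta)) pu0; congr (u0 _); ring.
Qed.

Lemma density_sqr_ae : {ae leb, forall theta, (density_sqr theta < +oo)%E}.
Proof.
apply: ae_periodic => [x|]; first by rewrite density_sqr_periodic.
have iG : leb.-integrable S1 density_sqr.
  apply/integrableP; split; first exact: measurable_funTS measurable_density_sqr.
  under eq_integral do rewrite gee0_abs ?density_sqr_ge0//.
  by rewrite integral_density_sqr ltry.
have h0 := integrable_ae mS1 iG; apply: (ae_imp h0) => x h Sx.
by have := h Sx; rewrite ge0_fin_numE ?density_sqr_ge0.
Qed.

Lemma density_periodic theta : periodic (analysis_density theta) twopi.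
Proof.
move=> phi; rewrite /analysis_density.
have [pPhi _ _] := LPhi; rewrite pPhi (_ : phi + twopi - theta = phi - theta + twopi).
  by rewrite pu0.
by ring.
Qed.

Lemma density_L2 theta : (density_sqr theta < +oo)%E -> L2S1 (analysis_density theta).
Proof.
move=> fin; split; [exact: density_periodic|exact: cmeasurable_density|].
have -> : (\int[leb]_(phi in S1) (cabs (analysis_density theta phi) ^+ 2)%:E =
   (twopi ^+ 2)%:E * density_sqr theta)%E.
  rewrite -ge0_integralZl//; last 4 first.
  - exact: mS1.
  - by apply: measurable_funTS; exact: (measurable_fun_pair2 theta mjoint).
  - by move=> x _; exact: (joint0 (theta, x)).
  - by rewrite lee_fin sqr_ge0.
  apply: eq_integral => x _; rewrite -EFinM /analysis_density !cabsM cabsR cabsJ.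
  by rewrite ger0_norm ?ltW ?twopi_gt0// !exprMn.
by rewrite lte_mul_pinfty// lee_fin sqr_ge0.
Qed.

End AnalysisOperator.

(** * The isometry *)

Section AnalysisIsometry.
Variable R : realType.
Local Notation C := R[i].
Local Notation leb := (@lebesgue_measure R).
Local Notation S1 := (@S1 R).
Local Notation mS1 := (@measurable_S1 R).
Local Notation twopi := (pi *+ 2 : R).
Variable Omega : R.
Hypothesis Omega_gt0 : 0 < Omega.
Variables (u0 Phi : R -> C).
Hypotheses (Lu0 : L2S1 u0) (LPhi : L2S1 Phi).
Local Notation dens := (analysis_density u0 Phi).
Local Notation F := (HSE2_of_fun (analysis_op Omega u0 Phi)).

Lemma decaysD (c c' : R) (f g : R * R -> C) a : decays c f -> decays c' g ->
  decays (cabs a * c + c') (fun x => a * f x + g x).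
Proof.
move=> [mf fc] [mg gc]; split => [|z].
  by apply: cmeasurableD => //; apply: cmeasurableM => //; exact: cmeasurable_cst.
apply: (le_trans (cabsD _ _)); rewrite mulrDl; apply: lerD => //.
by rewrite cabsM -mulrA ler_wpM2l// cabs_ge0.
Qed.

Lemma analysis_tdist_eq theta : tdist_eq (F theta) (HOmega_dist Omega (dens theta)).
Proof.
by move=> psi /schwartz2_decays[c d]; exact: (analysis_pairing Omega Lu0 LPhi theta d).
Qed.

Lemma tempered_analysis theta : tempered (F theta).
Proof.
have md := cmeasurable_density Lu0 LPhi theta.
have id := integrable_density_abs Lu0 LPhi theta.
split.
  move=> a psi psi' /schwartz2_decays[c d] /schwartz2_decays[c' d'].
  rewrite (analysis_pairing Omega Lu0 LPhi theta (decaysD a d d')).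
  rewrite (analysis_pairing Omega Lu0 LPhi theta d) (analysis_pairing Omega Lu0 LPhi theta d').
  exact: (HOmega_distD Omega md id a d d').
have [_ [K [N KN]]] := tempered_HOmega Omega md id.
exists K, N => psi M sp bd; rewrite (analysis_tdist_eq theta sp).
exact: KN.
Qed.

Definition good theta : Prop := (density_sqr u0 Phi theta < +oo)%E.

Lemma good_ae : {ae leb, forall theta, good theta}.
Proof. exact: density_sqr_ae. Qed.

Lemma good_L2 theta : good theta -> L2S1 (dens theta).
Proof. exact: density_L2. Qed.

Lemma good_in_HOmega theta : good theta -> in_HOmega Omega (F theta).
Proof.
move=> gt; split; first exact: tempered_analysis.
by exists (dens theta); [exact: good_L2|exact: analysis_tdist_eq].
Qed.

Lemma sqr_norm_density theta : good theta ->
  (sqr_norm (dens theta))%:E = ((twopi ^+ 2)%:E * density_sqr u0 Phi theta)%E.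
Proof.
move=> gt; rewrite -(sqr_normE (good_L2 gt)).
have [_ mP _] := LPhi; have ms := cmeasurable_shift Lu0 theta.
rewrite -ge0_integralZl//.
- apply: eq_integral => x _; rewrite -EFinM /analysis_density !cabsM cabsR cabsJ.
  by rewrite (ger0_norm (ltW (twopi_gt0 R))) !exprMn.
- exact: mS1.
- apply/measurable_EFinP; apply: measurable_funTS.
  by apply: measurable_funM; apply: measurable_funX; exact: measurable_cabs.
- by move=> x _; rewrite lee_fin mulr_ge0// sqr_ge0.
- by rewrite lee_fin sqr_ge0.
Qed.

Lemma good_ip theta : good theta ->
  HOmega_ip Omega (F theta) (F theta) = L2ip (dens theta) (dens theta).
Proof.
move=> gt; have iF := good_in_HOmega gt; have Ld := good_L2 gt.
have te := analysis_tdist_eq theta.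
exact: (HOmega_ipE Omega_gt0 iF iF Ld Ld te te).
Qed.

Lemma good_norm theta : good theta ->
  ((HOmega_norm Omega (F theta)) ^+ 2)%:E =
  ((twopi ^+ 2)%:E * density_sqr u0 Phi theta)%E.
Proof.
move=> gt; rewrite /HOmega_norm good_ip// sqr_sqrt_L2ip.
exact: sqr_norm_density.
Qed.

Lemma integral_norm_analysis :
  (\int[leb]_(theta in S1) ((HOmega_norm Omega (F theta)) ^+ 2)%:E =
   (twopi ^+ 2 * (sqr_norm Phi * sqr_norm u0))%:E)%E.
Proof.
have [N [mN N0 gN]] := good_ae.
rewrite (@eq_integral_lower_ae _ _ _ leb S1 N _
  (fun theta => (twopi ^+ 2)%:E * density_sqr u0 Phi theta)%E mN N0).
- rewrite ge0_integralZl//.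
  + by rewrite integral_density_sqr// -EFinM.
  + exact: mS1.
  + by apply: measurable_funTS; exact: measurable_density_sqr.
  + by move=> x _; exact: density_sqr_ge0.
  + by rewrite lee_fin sqr_ge0.
- by move=> x _; rewrite lee_fin sqr_ge0.
- by move=> x _; rewrite mule_ge0 ?lee_fin ?sqr_ge0 ?density_sqr_ge0.
- by move=> x _ Nx; apply: good_norm; apply: contrapT => ngx; apply: Nx; exact: gN.
Qed.

(** The scalar product with an element of H_Omega is an integral in phi of a
    function that is jointly measurable in theta and phi; this gives
    measurability. *)
Lemma analysis_in_HSE2 : in_HSE2 Omega F.
Proof.
split.
- move=> theta psi sp; rewrite !analysis_tdist_eq//; congr (HOmega_dist Omega _ psi).
  apply/funext => phi; rewrite /analysis_density; congr (_ * (_ * conjc _)).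
  have [pu0 _ _] := Lu0.
  by rewrite -[in RHS](subrK twopi (phi - theta)) pu0; congr (u0 _); ring.
- by apply: (ae_imp good_ae) => theta; exact: good_in_HOmega.
- move=> G iG; have [LG _] := HOmega_densityP iG.
  exists (fun theta => L2ip (HOmega_density Omega G) (dens theta)).
    have [_ mG _] := LG.
    pose K (z : R * R) := conjc (HOmega_density Omega G z.2) * analysis_density u0 Phi z.1 z.2.
    have mK : cmeasurable K.
      apply: cmeasurableM; last exact: cmeasurable_density2.
      by apply: cmeasurableJ; exact: (cmeasurable_comp mG measurable_snd).
    exact: (@cmeasurable_cintegral_param R _ _ _ _ leb S1 mS1 K mK).
  apply: (ae_imp good_ae) => theta gt; apply: L2ip_ae; first exact: aeW.
  exact: (HOmega_density_ae Omega_gt0 (good_in_HOmega gt) (good_L2 gt)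
    (analysis_tdist_eq theta)).
- by rewrite integral_norm_analysis ltry.
Qed.

Lemma analysis_HSE2_norm :
  HSE2_norm Omega F = twopi * Num.sqrt (sqr_norm Phi * sqr_norm u0).
Proof.
have t0 := twopi_gt0 R.
have -> : HSE2_norm Omega F =
   Num.sqrt (\int[leb]_(theta in S1) (HOmega_norm Omega (F theta)) ^+ 2).
  rewrite /HSE2_norm; congr Num.sqrt; apply: eq_Rintegral => theta _.
  by rewrite /HOmega_norm /HOmega_ip sqr_sqrt_L2ip L2ip_self.
rewrite /Rintegral integral_norm_analysis /= sqrtrM ?sqr_ge0//.
by rewrite sqrtr_sqr ger0_norm// ltW.
Qed.

End AnalysisIsometry.

Section AnalysisIsometryUnit.
Variable R : realType.
Local Notation C := R[i].
Local Notation twopi := (pi *+ 2 : R).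

Lemma L2normE (u : R -> C) : L2norm u = Num.sqrt (sqr_norm u).
Proof. by rewrite /L2norm L2ip_self. Qed.

Lemma analysis_norm_unit (Omega : R) (u0 Phi : R -> C) : 0 < Omega -> L2S1 u0 ->
  L2norm u0 = 1 -> L2S1 Phi ->
  HSE2_norm Omega (HSE2_of_fun (analysis_op Omega u0 Phi)) = twopi * L2norm Phi.
Proof.
move=> O0 Lu0 u1 LPhi; rewrite analysis_HSE2_norm//.
by rewrite sqrtrM ?sqr_norm_ge0// -!L2normE u1 mulr1.
Qed.

End AnalysisIsometryUnit.

(** * Integration by parts in theta *)

Section UniformDecay.
Variable R : realType.
Local Notation C := R[i].
Local Notation leb := (@lebesgue_measure R).
Local Notation V3 := ((R * R) * R)%type.
Local Notation S1 := (@S1 R).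
Local Notation mS1 := (@measurable_S1 R).
Local Notation twopi := (pi *+ 2 : R).
Implicit Types (chi : V3 -> C).

Lemma continuous_measurable_fun3 (f : V3 -> R) : continuous f -> measurable_fun setT f.
Proof.
move=> cf.
have m2 a : measurable_fun setT (fun z : V3 => f (z.1, a)).
  have h := @continuous_measurable_fun2 R (fun q => f (q, a)) (@continuous_slice R f a cf).
  exact: (measurableT_comp h measurable_fst).
apply: (@measurable_fun_cvg _ _ _ _ (fun n z => f (z.1, floor_step n z.2))).
  move=> n; apply: (@measurable_floor_select _ _ _ (fun z : V3 => n.+1%:R * z.2)
    (fun j z => f (z.1, j%:~R / n.+1%:R))) => //.
  by apply: measurable_funM => //; exact: measurable_snd.
move=> [x y] _ /=.
have ay : (x, floor_step n y) @[n --> \oo] --> (x, y).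
  apply: (@cvg_pair _ _ _ _ (nbhs x) (nbhs y)); first exact: cvg_cst.
  exact: floor_step_cvg.
have := cvg_comp _ f ay (cf (x, y)).
exact.
Qed.

(** Joint measurability, with a decay in q that is uniform in theta. *)
Definition udecays (c : R) chi : Prop :=
  cmeasurable chi /\ forall theta, decays c (fun q => chi (q, theta)).

Lemma rapid_udecays chi : rapid chi -> exists c, udecays c chi.
Proof.
move=> rc; have [c d] := rapid_decays rc; exists c; split => //.
have [c1 c2] := smooth_continuous (proj1 rc).
by split; exact: continuous_measurable_fun3.
Qed.

Lemma udecays_X1 chi : rapid chi -> exists c, udecays c (X1 chi).
Proof.
move=> rc.
have [c1 [m1 d1]] := rapid_udecays (rapid_cderive (dq1_basis3 R) rc).
have [c2 [m2 d2]] := rapid_udecays (rapid_cderive (dq2_basis3 R) rc).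
have msnd : measurable_fun setT (fun p : V3 => p.2) by exact: measurable_snd.
have mX : cmeasurable (X1 chi).
  apply: cmeasurableD; apply: cmeasurableM => //; apply: cmeasurable_real.
    by apply: measurableT_comp => //; exact: measurable_sin_comp.
  exact: measurable_cos_comp.
exists (c1 + c2); split => // theta; split.
  by apply: (cmeasurable_comp mX); exact: measurable_pair2.
move=> q; have [_ e1] := d1 theta; have [_ e2] := d2 theta.
have main (A B : C) (a b l : R) : `|a| <= 1 -> `|b| <= 1 -> cabs A <= c1 * l ->
    cabs B <= c2 * l -> cabs (a%:C * A + b%:C * B) <= (c1 + c2) * l.
  move=> ha hb hA hB; apply: (le_trans (cabsD _ _)); rewrite mulrDl !cabsM !cabsR.
  by apply: lerD; [apply: le_trans hA|apply: le_trans hB]; rewrite ler_piMl// cabs_ge0.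
apply: (@main _ _ (- sin theta) (cos theta) (lorentz2 q) _ _ (e1 q) (e2 q)).
  by rewrite normrN ler_norml sin_geN1 sin_le1.
by rewrite ler_norml cos_geN1 cos_le1.
Qed.

Lemma on_circle_joint (Omega : R) c chi : udecays c chi ->
  cmeasurable (fun z : R * R => on_circle Omega (fun q => chi (q, z.1)) z.2).
Proof.
move=> [mchi _]; apply: cmeasurableJ; apply: cmeasurableM; first exact: cmeasurable_cst.
pose K (z : (R * R) * (R * R)) := cexpi (- (Omega * cos z.1.2 * z.2.1 + Omega * sin z.1.2 * z.2.2))
  * chi (z.2, z.1.1).
suff mK : cmeasurable K.
  have := @cmeasurable_cintegral_param R _ _ _ _ (plane_measure R) setT measurableT K mK.
  exact.
have m12 : measurable_fun setT (fun z : (R * R) * (R * R) => z.1.2).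
  exact: (measurableT_comp measurable_snd measurable_fst).
have m11 : measurable_fun setT (fun z : (R * R) * (R * R) => z.1.1).
  exact: (measurableT_comp measurable_fst measurable_fst).
apply: cmeasurableM.
  apply: cmeasurable_expi; apply: measurableT_comp => //.
  apply: measurable_funD; apply: measurable_funM.
  - by apply: measurable_funM => //; exact: measurable_cos_comp.
  - exact: (measurableT_comp measurable_fst measurable_snd).
  - by apply: measurable_funM => //; exact: measurable_sin_comp.
  - exact: (measurableT_comp measurable_snd measurable_snd).
apply: (cmeasurable_comp mchi).
by apply: measurable_fun_pair => //; exact: measurable_snd.
Qed.

Lemma cintegral_circle_derive (h h' : R -> C) :
  (forall x : R, cdir x (1 : R) h (h' x)) -> ccontinuous h' -> h twopi = h 0 ->
  cintegral leb S1 h' = 0.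
Proof.
have main (f f' : R -> R) : (forall x : R, is_derive x (1 : R) f (f' x)) ->
    continuous f' -> f twopi = f 0 -> \int[leb]_(x in S1) f' x = 0.
  move=> df cf' ff; rewrite /Rintegral /Defs.S1.
  have cf : continuous f by move=> x; exact: derive_continuous (df x).
  rewrite (@continuous_FTC2 _ f' f 0 twopi (twopi_gt0 R)).
  - by rewrite ff /= subrr.
  - exact: continuous_subspaceT.
  - split.
    + by move=> x _; have [] := df x.
    + by apply: cvg_at_right_filter; exact: cf.
    + by apply: cvg_at_left_filter; exact: cf.
  - by move=> x _; rewrite derive1E; exact: dir_val (df x).
move=> dh [c1 c2] hh; apply: complex_ext => /=.
  apply: (main (fun x => Re (h x))) => [x| |]; rewrite ?hh//.
  by have [] := dh x.
apply: (main (fun x => Im (h x))) => [x| |]; rewrite ?hh//.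
by have [] := dh x.
Qed.

Lemma cdir_theta (q : R * R) (theta : R) chi l : cdir (q, theta) (@dtheta R) chi l ->
  cdir theta (1 : R) (fun t => chi (q, t)) l.
Proof.
have e (h : R) : h *: @dtheta R + (q, theta) = (q, h *: (1 : R) + theta).
  by congr (_, _); rewrite /= scaler0 add0r.
by move=> [/dir_line d1 /dir_line d2]; split; apply/dir_line; under eq_fun do rewrite -e.
Qed.

Lemma continuous_theta (f : V3 -> R) (q : R * R) :
  continuous f -> continuous (fun t => f (q, t)).
Proof.
move=> cf t.
have qt : (q, t') @[t' --> t] --> (q, t).
  by apply: (@cvg_pair _ _ _ _ (nbhs q) (nbhs t)); [exact: cvg_cst|exact: cvg_id].
have := cvg_comp _ f qt (cf (q, t)).
exact.
Qed.

(** Fubini brings the integral over the circle inside the Fourier integral,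
    where the boundary terms at 0 and 2pi cancel by periodicity. *)
Lemma theta_parts chi (rho rho' : R -> R) (k : R * R) : testSE2 chi ->
  (forall t : R, is_derive t (1 : R) rho (rho' t)) -> continuous rho' ->
  rho twopi = rho 0 ->
  cintegral leb S1 (fun t => (rho t)%:C * fourier2 (fun q => cderive (@dtheta R) chi (q, t)) k) =
  - cintegral leb S1 (fun t => (rho' t)%:C * fourier2 (fun q => chi (q, t)) k).
Proof.
move=> tc drho crho' rhoT; have rc := testSE2_rapid tc.
have [pchi _ _] := tc.
have rd := rapid_cderive (dtheta_basis3 R) rc.
set dchi := cderive (@dtheta R) chi in rd *.
have [c [mc dc]] := rapid_udecays rc. have [c' [mc' dc']] := rapid_udecays rd.
have crho : continuous rho by move=> x; exact: derive_continuous (drho x).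
have mrho : measurable_fun setT rho by exact: continuous_measurable_fun.
have mrho' : measurable_fun setT rho' by exact: continuous_measurable_fun.
pose E (q : R * R) : C := cexpi (- (k.1 * q.1 + k.2 * q.2)).
have mE : cmeasurable E by apply: cmeasurable_expi; exact: measurable_dot.
have swap (f : V3 -> C) (r : R -> R) (a : R) : cmeasurable f ->
    (forall theta, decays a (fun q => f (q, theta))) -> continuous r ->
    [/\ cintegrable leb S1 (fun t => (r t)%:C * fourier2 (fun q => f (q, t)) k),
        cintegral leb S1 (fun t => (r t)%:C * fourier2 (fun q => f (q, t)) k) =
          (twopi^-1)%:C * cintegral (plane_measure R) setT
             (fun q => cintegral leb S1 (fun t => (r t)%:C * (E q * f (q, t)))),
        cintegrable (plane_measure R) setT
             (fun q => cintegral leb S1 (fun t => (r t)%:C * (E q * f (q, t)))) &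
        forall q, cintegrable leb S1 (fun t => (r t)%:C * (E q * f (q, t)))].
  move=> mf df cr.
  have mr : measurable_fun setT r by exact: continuous_measurable_fun.
  pose K (z : (R * R) * R) := (r z.2)%:C * (E z.1 * f z).
  have mK : cmeasurable K.
    apply: cmeasurableM.
      by apply: cmeasurable_real; apply: (measurableT_comp mr); exact: measurable_snd.
    by apply: cmeasurableM => //; exact: (cmeasurable_comp mE measurable_fst).
  have bK (q : R * R) (t : R) : setT q -> S1 t -> cabs (K (q, t)) <= (a * lorentz2 q) * `|r t|.
    move=> _ _; rewrite /K !cabsM cabsR cabs_expi mul1r mulrC ler_wpM2r//.
    by have [_] := df t; exact.
  have ir : leb.-integrable S1 (EFin \o (fun t => `|r t|)).
    by apply: integrable_norm; exact: continuous_integrable_itv.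
  have il := integrable_cst_lorentz2 a.
  have fub := @cintegral_fubini R _ _ _ _ (plane_measure R) leb setT S1 measurableT mS1
    K _ _ mK bK il ir.
  have if1 := @cintegrable_cintegral1 R _ _ _ _ (plane_measure R) leb setT S1 measurableT mS1
    K _ _ mK bK il ir.
  have e t : (r t)%:C * fourier2 (fun q => f (q, t)) k =
      (twopi^-1)%:C * cintegral (plane_measure R) setT (fun q => K (q, t)).
    rewrite /fourier2 mulrCA; congr (_ * _).
    have i0 := decays_integrable (decays_fourier_integrand k (df t)).
    by rewrite -(cintegralZ measurableT _ i0); exact: eq_cintegral.
  have i2 : cintegrable leb S1 (fun t => (r t)%:C * fourier2 (fun q => f (q, t)) k).
    apply: (cintegrable_dom mS1 (g := fun t => (a * (pi^-1 * lorentz2_mass R)) * `|r t|)).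
    - under eq_fun do rewrite e.
      apply: cmeasurableM; first exact: cmeasurable_cst.
      pose K' (z : R * (R * R)) := K (z.2, z.1).
      have mK' : cmeasurable K'.
        apply: (cmeasurable_comp mK).
        by apply: measurable_fun_pair; [exact: measurable_snd|exact: measurable_fst].
      exact: (@cmeasurable_cintegral_param R _ _ _ _ (plane_measure R) setT measurableT K' mK').
    - move=> t _; rewrite cabsM cabsR mulrC ler_wpM2r//.
      exact: fourier2_bound (df t).
    - by apply: integrableZ_fun; [exact: mS1|exact: ir].
  split => //.
  - under eq_cintegral do rewrite e.
    have i3 : cintegrable leb S1 (fun t => cintegral (plane_measure R) setT (fun q => K (q, t))).
      have := cintegrableZ mS1 (twopi)%:C i2; under eq_fun do rewrite e mulrA -rmorphM.
      rewrite mulfV ?gt_eqF ?twopi_gt0//.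
      by under eq_fun do rewrite rmorph1 mul1r.
    by rewrite (cintegralZ mS1 _ i3) -fub.
  - move=> q.
    exact: (cintegrable_sec1 mS1 mK bK ir (I : setT q)).
have [i1 e1 j1 s1] := swap dchi rho c' mc' dc' crho.
have [i2 e2 j2 s2] := swap chi rho' c mc dc crho'.
apply/eqP; rewrite -addr_eq0 e1 e2 -mulrDr -(cintegralD measurableT j1 j2).
rewrite [cintegral _ _ _](_ : _ = 0) ?mulr0//.
transitivity (cintegral (plane_measure R) setT (fun=> 0)); last first.
  by apply: complex_ext; rewrite /= Rintegral_cst// mul0r.
apply: eq_cintegral => q _; rewrite -(cintegralD mS1 (s1 q) (s2 q)).
have [cc1 cc2] := smooth_continuous (proj1 rc).
have [cd1 cd2] := smooth_continuous (proj1 rd).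
have cchi : ccontinuous (fun t => chi (q, t)).
  by split; [exact: (continuous_theta (f := fun p => Re (chi p)))|
             exact: (continuous_theta (f := fun p => Im (chi p)))].
have cdchi : ccontinuous (fun t => dchi (q, t)).
  by split; [exact: (continuous_theta (f := fun p => Re (dchi p)))|
             exact: (continuous_theta (f := fun p => Im (dchi p)))].
have creal (r : R -> R) : continuous r -> ccontinuous (fun t => (r t)%:C).
  by move=> cr; split => //=; exact: continuous_cst_fun.
apply: (cintegral_circle_derive (h := fun t => E q * ((rho t)%:C * chi (q, t)))).
- move=> t.
  have dt := cdir_theta (smooth_cdir (q, t) (dtheta_basis3 R) (proj1 rc)).
  apply: cdir_ext (cdirZ (E q) (cdirM (cdir_real (drho t)) dt)) => //.
  rewrite /dchi; ring.
- by apply: ccontinuousD; apply: ccontinuousM; try exact: creal;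
    apply: ccontinuousM => //; exact: ccontinuous_cst.
- by rewrite rhoT -[in LHS](add0r twopi) pchi.
Qed.

End UniformDecay.

(** * The range satisfies the Cauchy-Riemann equation *)

Section CauchyRiemannRange.
Variable R : realType.
Local Notation C := R[i].
Local Notation leb := (@lebesgue_measure R).
Local Notation V3 := ((R * R) * R)%type.
Local Notation S1 := (@S1 R).
Local Notation mS1 := (@measurable_S1 R).
Local Notation twopi := (pi *+ 2 : R).
Variable mu : R.
Implicit Types (chi : V3 -> C).

Let cmu := c_mu mu.

Lemma expR_cos_bound (x : R) : expR (mu * cos x) <= expR `|mu|.
Proof.
have := expR_cos_sin_bound mu 0 x.
by rewrite mul0r addr0 normr0 addr0.
Qed.

Lemma continuous_expR_cos : continuous (fun x : R => expR (mu * cos x)).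
Proof.
have := @continuous_expR_cos_sin R mu 0.
by under eq_fun do rewrite mul0r addr0.
Qed.

Lemma L2S1_expR_cos (a : R) : L2S1 (fun x => (a * expR (mu * cos x))%:C).
Proof.
have ca : continuous (fun x : R => a * expR (mu * cos x)).
  by apply: continuousM_fun; [exact: continuous_cst_fun|exact: continuous_expR_cos].
split.
- by move=> x; rewrite cosD2pi.
- by apply: cmeasurable_real; exact: continuous_measurable_fun.
- have c2 : continuous (fun x : R => (a * expR (mu * cos x)) ^+ 2) by exact: continuousX_fun.
  have i2 := continuous_integrable_itv 0 (pi *+ 2) c2.
  have [_ fin] := integrableP _ _ _ i2.
  apply: le_lt_trans fin; apply: ge0_le_integral.
  + exact: mS1.
  + by move=> x _; rewrite lee_fin sqr_ge0.
  + apply/measurable_EFinP; apply: measurable_funTS; apply: measurable_funX.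
    by apply: measurable_cabs; apply: cmeasurable_real; exact: continuous_measurable_fun.
  + apply/measurable_EFinP; apply: measurable_funTS; apply: measurableT_comp => //.
    exact: continuous_measurable_fun.
  + by move=> x _; rewrite lee_fin cabsR real_normK ?num_real// ler_norm.
Qed.

Lemma L2S1_u_mu : L2S1 (u_mu mu).
Proof. exact: L2S1_expR_cos. Qed.

Lemma c_mu_gt0 : 0 < cmu.
Proof.
rewrite /cmu /c_mu invr_gt0 L2normE sqrtr_gt0.
have c2 : continuous (fun x : R => expR (mu * cos x) ^+ 2).
  by apply: continuousX_fun; exact: continuous_expR_cos.
have -> : sqr_norm (fun x : R => (expR (mu * cos x))%:C) =
   \int[leb]_(x in S1) (expR (mu * cos x) ^+ 2).
  by apply: eq_Rintegral => x _; rewrite cabsR real_normK ?num_real.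
have i2 := continuous_integrable_itv 0 (pi *+ 2) c2.
have h : \int[leb]_(x in S1) (expR (- `|mu|) ^+ 2) <= \int[leb]_(x in S1) (expR (mu * cos x) ^+ 2).
  apply: le_Rintegral => //; first exact: mS1.
    exact: integrable_cst_S1.
  move=> x _; rewrite lerXn2r ?nnegrE ?expR_ge0// ler_expR.
  by apply: lerNnormlW; rewrite normrM ler_piMr// ler_norml cos_geN1 cos_le1.
apply: lt_le_trans h; rewrite Rintegral_cst_S1.
by rewrite mulr_gt0 ?exprn_gt0 ?expR_gt0// twopi_gt0.
Qed.

(** The function u^mu(phi - theta) seen from a fixed phi: at the angle theta,
    A Phi has the density 2pi Phi(phi) times this. *)
Definition profile (phi theta : R) : R := cmu * expR (mu * cos (phi - theta)).

Lemma dir_profile (phi theta : R) :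
  is_derive theta (1 : R) (profile phi) (mu * sin (phi - theta) * profile phi theta).
Proof.
have d1 : is_derive theta (1 : R) (fun t => phi - t) (-1).
  apply: dir_ext (dirD (dir_cst phi theta (1 : R)) (dirZ (-1) (dir_id theta))) => [t|].
    by rewrite mulN1r.
  by rewrite add0r mulr1.
apply: dir_ext (dirZ cmu (dir_exp (dirZ mu (dir_cos d1)))) => //.
rewrite /profile; ring.
Qed.

Lemma continuous_profile phi : continuous (profile phi).
Proof. by move=> x; exact: derive_continuous (dir_profile phi x). Qed.

Lemma continuous_profile' phi :
  continuous (fun t : R => mu * sin (phi - t) * profile phi t).
Proof.
apply: continuousM_fun; last exact: continuous_profile.
apply: continuousM_fun; first exact: continuous_cst_fun.
apply: continuous_comp_fun; last exact: continuous_sin.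
by under eq_fun do rewrite addrC -mulN1r; exact: continuous_affine.
Qed.

Lemma profile_bound phi theta : `|profile phi theta| <= cmu * expR `|mu|.
Proof.
rewrite normrM (gtr0_norm c_mu_gt0) (gtr0_norm (expR_gt0 _)).
by rewrite ler_wpM2l ?expR_cos_bound// ltW// c_mu_gt0.
Qed.

Variable Omega : R.
Hypothesis Omega_gt0 : 0 < Omega.
Variable Phi : R -> C.
Hypothesis LPhi : L2S1 Phi.
Local Notation F := (HSE2_of_fun (analysis_op Omega (u_mu mu) Phi)).
Local Notation circ phi := (Omega * cos phi, Omega * sin phi).

Definition profile_pairing (chi : V3 -> C) (phi : R) : C :=
  cintegral leb S1 (fun t => (profile phi t)%:C * fourier2 (fun q => chi (q, t)) (circ phi)).

(** Fubini on S^1 x S^1 reduces the equation to integrals over theta, one for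
    each phi. *)
Lemma distSE2_swap c chi : udecays c chi ->
  cintegrable leb S1
    (fun phi => ((twopi)%:C * Phi phi) * conjc (profile_pairing chi phi)) /\
  distSE2 F chi = cintegral leb S1
    (fun phi => ((twopi)%:C * Phi phi) * conjc (profile_pairing chi phi)).
Proof.
move=> ud; have [mchi dchi] := ud; have [_ mPhi _] := LPhi.
pose G theta phi := on_circle Omega (fun q => chi (q, theta)) phi.
pose K (z : R * R) := analysis_density (u_mu mu) Phi z.2 z.1 * G z.2 z.1.
have mswap : measurable_fun setT (fun z : R * R => (z.2, z.1)).
  by apply: measurable_fun_pair; [exact: measurable_snd|exact: measurable_fst].
have mG : cmeasurable (fun z : R * R => G z.1 z.2) := on_circle_joint Omega ud.
have mK : cmeasurable K.
  apply: cmeasurableM.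
    exact: (cmeasurable_comp (cmeasurable_density2 L2S1_u_mu LPhi) mswap).
  exact: (cmeasurable_comp mG mswap).
pose B := cmu * expR `|mu| * (c * (pi^-1 * lorentz2_mass R)).
have cm0 := c_mu_gt0; have t0 := twopi_gt0 R.
have c0 := decays_ge0 (dchi 0).
have bG theta phi : cabs (G theta phi) <= c * (pi^-1 * lorentz2_mass R).
  exact: (on_circle_bound Omega phi (dchi theta)).
have densE theta phi : analysis_density (u_mu mu) Phi theta phi =
    ((twopi)%:C * Phi phi) * (profile phi theta)%:C.
  have e : u_mu mu (phi - theta) = (profile phi theta)%:C by [].
  rewrite /analysis_density e; move: (profile _ _) (Phi _) => a z.
  by apply: complex_ext; rewrite !cE /=; ring.
have bK (phi theta : R) : S1 phi -> S1 theta -> cabs (K (phi, theta)) <=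
    (twopi * cabs (Phi phi)) * B.
  move=> _ _; rewrite /K /= densE !cabsM !cabsR (gtr0_norm t0).
  rewrite -[leLHS]mulrA; apply: ler_wpM2l; first by rewrite mulr_ge0 ?cabs_ge0// ltW.
  exact: (ler_pM (normr_ge0 _) (cabs_ge0 _) (profile_bound phi theta) (bG theta phi)).
have iP : leb.-integrable S1 (EFin \o (fun phi => twopi * cabs (Phi phi))).
  by apply: integrableZ_fun; [exact: mS1|exact: L2S1_integrable_abs].
have iB := integrable_cst_S1 B.
have fub := @cintegral_fubini R _ _ _ _ leb leb S1 S1 mS1 mS1 K _ _ mK bK iP iB.
have if1 := @cintegrable_cintegral1 R _ _ _ _ leb leb S1 S1 mS1 mS1 K _ _ mK bK iP iB.
have inner phi : cintegral leb S1 (fun theta => K (phi, theta)) =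
    ((twopi)%:C * Phi phi) * conjc (profile_pairing chi phi).
  pose h t := (profile phi t)%:C * fourier2 (fun q => chi (q, t)) (circ phi).
  have hJ t : conjc (h t) = (profile phi t)%:C * G t phi.
    by rewrite /h conjcM; congr (_ * _); apply: complex_ext; rewrite /= ?oppr0.
  have mh : cmeasurable h.
    have mhJ : cmeasurable (fun t => conjc (h t)).
      under eq_fun do rewrite hJ.
      apply: cmeasurableM.
        by apply: cmeasurable_real; apply: continuous_measurable_fun; exact: continuous_profile.
      exact: (cmeasurable_comp mG (measurable_pair2 phi)).
    by have := cmeasurableJ mhJ; under eq_fun do rewrite conjc_invol.
  have ih : cintegrable leb S1 h.
    apply: (@cintegrable_dom _ _ _ leb S1 mS1 h (fun=> B) mh _ iB) => t _.
    have -> : cabs (h t) = `|profile phi t| * cabs (G t phi).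
      by rewrite -[LHS]cabsJ (congr1 (fun z : C => cabs z) (hJ t)) cabsM cabsR.
    exact: (ler_pM (normr_ge0 _) (cabs_ge0 _) (profile_bound phi t) (bG t phi)).
  rewrite /profile_pairing -/h -(cintegralJ mS1 ih) -(cintegralZ mS1 _ (cintegrableJ mS1 ih)).
  apply: eq_cintegral => t _; rewrite hJ /K /= densE mulrA //.
split; first by move: if1; under eq_fun do rewrite inner.
have -> : distSE2 F chi =
    cintegral leb S1 (fun theta => cintegral leb S1 (fun phi => K (phi, theta))).
  apply: eq_cintegral => theta _.
  by rewrite (analysis_pairing Omega L2S1_u_mu LPhi theta (dchi theta)) HOmega_distE.
by rewrite -fub; apply: eq_cintegral => phi _; exact: inner.
Qed.

(** Integration by parts moves X2 onto the profile, whose derivative in theta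
    is mu sin(phi - theta) times itself, while X1 multiplies Fourier
    transforms by i Omega sin(phi - theta). The two pairings are therefore
    multiples of the same integral. *)
Lemma profile_pairing_X chi phi : mu != 0 -> testSE2 chi ->
  profile_pairing (X1 chi) phi = (0 +i* (- (Omega / mu))) * profile_pairing (X2 chi) phi.
Proof.
move=> mu0 tc; have rc := testSE2_rapid tc.
have per : profile phi twopi = profile phi 0.
  rewrite /profile subr0; congr (_ * expR (_ * _)).
  by rewrite -[in RHS](subrK twopi phi) cosD2pi.
have [c ud] := rapid_udecays rc; have [mchi dchi] := ud.
have e2 : profile_pairing (X2 chi) phi = - cintegral leb S1 (fun t =>
    (mu * sin (phi - t) * profile phi t)%:C * fourier2 (fun q => chi (q, t)) (circ phi)).
  exact: (theta_parts (circ phi) tc (dir_profile phi) (@continuous_profile' phi) per).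
pose h t := (mu * sin (phi - t) * profile phi t)%:C * fourier2 (fun q => chi (q, t)) (circ phi).
have ih : cintegrable leb S1 h.
  have mG := on_circle_joint Omega ud.
  have mf : cmeasurable (fun t : R => fourier2 (fun q => chi (q, t)) (circ phi)).
    have := cmeasurableJ (cmeasurable_comp mG (measurable_pair2 phi)).
    by under eq_fun do rewrite /on_circle conjc_invol.
  have cp : continuous (fun t => `|mu * sin (phi - t) * profile phi t|).
    by move=> x; apply: cvg_norm; exact: continuous_profile'.
  apply: (@cintegrable_dom _ _ _ leb S1 mS1 h
    (fun t => (c * (pi^-1 * lorentz2_mass R)) * `|mu * sin (phi - t) * profile phi t|)).
  - apply: cmeasurableM => //; apply: cmeasurable_real; apply: continuous_measurable_fun.
    exact: continuous_profile'.
  - move=> t _; rewrite /h cabsM cabsR mulrC ler_wpM2r//.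
    exact: fourier2_bound (dchi t).
  - apply: integrableZ_fun; first exact: mS1.
    exact: continuous_integrable_itv.
rewrite e2 -/h mulrN -mulNr -(cintegralZ mS1 _ ih); apply: eq_cintegral => t _.
rewrite (fourier2_X1_circle Omega t phi rc) /h.
move: (fourier2 _ _) => z; apply: complex_ext; rewrite !cE /=; field; exact: mu0.
Qed.

Lemma CR_analysis : mu != 0 -> CR (mu / Omega) F.
Proof.
move=> mu0 chi tc; have rc := testSE2_rapid tc.
have [c1 u1] := udecays_X1 rc.
have [c2 u2] := rapid_udecays (rapid_cderive (dtheta_basis3 R) rc).
have [_ A1] := distSE2_swap u1; have [i2 A2] := distSE2_swap u2.
have key : distSE2 F (X1 chi) = (0 +i* (Omega / mu)) * distSE2 F (X2 chi).
  rewrite A1 [distSE2 F (X2 chi)]A2 -(cintegralZ mS1 _ i2); apply: eq_cintegral => phi _.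
  have -> := profile_pairing_X phi mu0 tc.
  rewrite conjcM mulrCA; congr (_ * _).
  by apply: complex_ext; rewrite /= ?opprK.
rewrite /dist_X2 /dist_X1 key; move: (distSE2 F (X2 chi)) => z.
have O0 : Omega != 0 by rewrite gt_eqF.
by apply: complex_ext; rewrite !cE /=; field; rewrite O0 mu0.
Qed.

End CauchyRiemannRange.

(** * Moments of a field of densities *)

Section KernelMoments.
Variable R : realType.
Local Notation C := R[i].
Local Notation leb := (@lebesgue_measure R).
Local Notation S1 := (@S1 R).
Local Notation mS1 := (@measurable_S1 R).
Local Notation twopi := (pi *+ 2 : R).
Variable Omega : R.
Hypothesis Omega_gt0 : 0 < Omega.
Variable F : R -> tdist R.
Hypothesis iF : in_HSE2 Omega F.
Local Notation U theta := (HOmega_density Omega (F theta)).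

Variables (k : R -> R -> R) (c : R).
Hypotheses (k_theta : forall phi, continuous (fun t => k t phi))
  (k_phi : forall t, continuous (k t))
  (k_per : forall t, periodic (k t) twopi)
  (k_bound : forall t phi, `|k t phi| <= c).

Definition moment theta : C := cintegral leb S1 (fun phi => U theta phi * (k theta phi)%:C).

Let mk t : measurable_fun setT (k t).
Proof. by apply: continuous_measurable_fun; exact: k_phi. Qed.

Let ck t : cmeasurable (fun phi => (k t phi)%:C).
Proof. by apply: cmeasurable_real; exact: mk. Qed.

Let bk t phi : cabs (k t phi)%:C <= c.
Proof. by rewrite cabsR. Qed.

Let c_ge0 : 0 <= c.
Proof. exact: le_trans (normr_ge0 _) (k_bound 0 0). Qed.

Lemma L2S1_kernel t : L2S1 (fun phi => (k t phi)%:C).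
Proof.
have L1 : L2S1 (fun _ : R => 1 : C).
  split => //.
  have := integrable_cst_S1 (1 : R) => /integrableP[_].
  apply: le_lt_trans; apply: ge0_le_integral.
  - exact: mS1.
  - by move=> x _; rewrite lee_fin sqr_ge0.
  - exact: measurable_cst.
  - exact: measurable_cst.
  - move=> x _; rewrite lee_fin; have -> : (1 : C) = (1 : R)%:C by [].
    by rewrite cabsR normr1 expr1n.
have -> : (fun phi => (k t phi)%:C) = (fun phi => 1 * (k t phi)%:C).
  by apply/funext => phi; rewrite mul1r.
by apply: (L2S1_mul L1 _ (ck t) (bk t)) => x; rewrite k_per.
Qed.

(** With a kernel independent of theta, the moment is the scalar product with
    a fixed element of H_Omega, and membership in L^2(S^1, H_Omega) makes it
    measurable. *)
Lemma moment_fixed_kernel t :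
  ae_cmeasurable (fun theta => cintegral leb S1 (fun phi => U theta phi * (k t phi)%:C)).
Proof.
have Lk := L2S1_kernel t; have iG := in_HOmega_dist Omega Lk.
have [_ aeF mF _] := iF; have [g mg gE] := mF _ iG.
exists g => //; apply: (ae_imp2 aeF gE) => theta iFt <-.
have [LU eU] := HOmega_densityP iFt.
rewrite (HOmega_ipE Omega_gt0 iG iFt Lk LU (fun _ _ => erefl) eU).
by apply: eq_cintegral => phi _; rewrite mulrC; congr (_ * _); apply: complex_ext; rewrite /= ?oppr0.
Qed.

Lemma moment_cvg theta : L2S1 (U theta) -> (forall (P : C -> R), (P = (fun z => Re z) \/ P = (fun z => Im z)) ->
  P (cintegral leb S1 (fun phi => U theta phi * (k (floor_step n theta) phi)%:C)) @[n --> \oo]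
    --> P (moment theta)).
Proof.
move=> LU; have [_ mU _] := LU.
have iU := L2S1_integrable_abs LU.
have main (f : R -> R) : measurable_fun setT f -> (forall phi, `|f phi| <= cabs (U theta phi)) ->
    \int[leb]_(phi in S1) (f phi * k (floor_step n theta) phi) @[n --> \oo] -->
    \int[leb]_(phi in S1) (f phi * k theta phi).
  move=> mf bf.
  apply: (@Rdominated_convergence _ _ _ leb S1 _ _ (fun phi => c * cabs (U theta phi))).
  - exact: mS1.
  - by move=> n; apply: measurable_funTS; apply: measurable_funM; [exact: mf|exact: mk].
  - by apply: measurable_funTS; apply: measurable_funM; [exact: mf|exact: mk].
  - apply: aeW => phi _; apply: cvgMr.
    have := cvg_comp _ (fun t => k t phi) (@floor_step_cvg R theta) (@k_theta phi theta).
    exact.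
  - by move=> n phi _; rewrite normrM mulrC; apply: ler_pM.
  - by apply: integrableZ_fun; [exact: mS1|exact: iU].
move=> P [->|->].
  have e t : Re (cintegral leb S1 (fun phi => U theta phi * (k t phi)%:C)) =
      \int[leb]_(phi in S1) (Re (U theta phi) * k t phi).
    by apply: eq_Rintegral => phi _; rewrite !cE /= mulr0 subr0.
  rewrite /moment e; under eq_fun do rewrite e.
  by apply: main => [|phi]; [exact: (proj1 mU)|exact: cabs_Re].
have e t : Im (cintegral leb S1 (fun phi => U theta phi * (k t phi)%:C)) =
    \int[leb]_(phi in S1) (Im (U theta phi) * k t phi).
  by apply: eq_Rintegral => phi _; rewrite !cE /= mulr0 add0r.
rewrite /moment e; under eq_fun do rewrite e.
by apply: main => [|phi]; [exact: (proj2 mU)|exact: cabs_Im].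
Qed.

(** Rounding theta in the kernel, but not in the density, uses countably many
    fixed kernels; a common null set can then be removed before passing to the
    limit. *)
Lemma moment_ae_cmeasurable : ae_cmeasurable moment.
Proof.
have [_ aeF _ _] := iF.
have /choice[g gP] (nj : nat * int) : exists g : R -> C, cmeasurable g /\
    {ae leb, forall theta, cintegral leb S1
      (fun phi => U theta phi * (k (nj.2%:~R / nj.1.+1%:R) phi)%:C) = g theta}.
  by have [g mg gE] := moment_fixed_kernel (nj.2%:~R / nj.1.+1%:R); exists g.
have aeg := ae_forall_countable (fun nj => proj2 (gP nj)).
pose good theta := L2S1 (U theta) /\ (forall nj : nat * int, cintegral leb S1
      (fun phi => U theta phi * (k (nj.2%:~R / nj.1.+1%:R) phi)%:C) = g nj theta).
have [A [mA A0 goodA]] : {ae leb, forall theta, good theta}.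
  by apply: (ae_imp2 aeF aeg) => theta /HOmega_densityP[LU _] gE; split.
pose m theta : C := (\1_(~` A) theta : R)%:C * moment theta.
have gA theta : ~ A theta -> good theta.
  by move=> nA; apply: contrapT => ng; apply: nA; exact: goodA.
exists m; last first.
  exists A; split => // theta; rewrite /= /m => h; apply: contrapT => nA; apply: h.
  by rewrite indicE mem_set//= mul1r.
have main (P : C -> R) : (P = (fun z => Re z) \/ P = (fun z => Im z)) ->
    (forall nj, measurable_fun setT (fun x => P (g nj x))) ->
    measurable_fun setT (fun theta => \1_(~` A) theta * P (moment theta)).
  move=> hP mP.
  apply: (@measurable_fun_cvg _ _ _ _ (fun n theta =>
     \1_(~` A) theta * P (g (n, Num.floor (n.+1%:R * theta)) theta))).
    move=> n; apply: measurable_funM.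
      by apply: measurable_indic; exact: measurableC.
    apply: (@measurable_floor_select _ _ _ (fun theta : R => n.+1%:R * theta)
      (fun j theta => P (g (n, j) theta))) => //.
    exact: measurable_funM.
  move=> theta _; have [nA|] := pselect ((~` A) theta); last first.
    by move=> h; rewrite indicE memNset//; under eq_fun do rewrite mul0r; rewrite mul0r; exact: cvg_cst.
  apply: cvgMr; have [LU gE] := gA _ nA.
  have := moment_cvg LU hP.
  have e n : g (n, Num.floor (n.+1%:R * theta)) theta =
    cintegral leb S1 (fun phi => U theta phi * (k (floor_step n theta) phi)%:C) by rewrite -gE.
  by under [X in X @ _ --> _]eq_fun do rewrite -e.
have e1 : (fun theta => Re (m theta)) = (fun theta => \1_(~` A) theta * Re (moment theta)).
  by apply/funext => theta; rewrite /m !cE /= mul0r subr0.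
have e2 : (fun theta => Im (m theta)) = (fun theta => \1_(~` A) theta * Im (moment theta)).
  by apply/funext => theta; rewrite /m !cE /= mul0r addr0.
split.
  by rewrite e1; apply: main => [|nj]; [left|exact: (proj1 (proj1 (gP nj)))].
by rewrite e2; apply: main => [|nj]; [right|exact: (proj2 (proj1 (gP nj)))].
Qed.

Lemma moment_bound theta : L2S1 (U theta) ->
  cabs (moment theta) <= 2 * c * twopi * (1 + HOmega_norm Omega (F theta) ^+ 2).
Proof.
move=> LU; have [_ mU _] := LU.
have i2 := L2S1_integrable_sqr LU.
have i1 := integrable_cst_S1 (1 : R).
have i12 : leb.-integrable S1 (EFin \o (fun phi => c * (1 + cabs (U theta phi) ^+ 2))).
  apply: integrableZ_fun; first exact: mS1.
  by apply: integrableD_fun => //; exact: mS1.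
have := @cabs_cintegral_le R _ _ leb S1 mS1 (fun phi => U theta phi * (k theta phi)%:C)
  (fun phi => c * (1 + cabs (U theta phi) ^+ 2)) (cmeasurableM mU (ck theta)) _ i12.
move=> h; apply: (le_trans (h _)).
  move=> phi _; rewrite cabsM cabsR mulrC; apply: ler_pM => //; first exact: cabs_ge0.
  by have := sqr_ge0 (cabs (U theta phi) - 1); have := sqr_ge0 (cabs (U theta phi)); nra.
have i0 : leb.-integrable S1 (EFin \o (fun phi => 1 + cabs (U theta phi) ^+ 2)).
  by apply: integrableD_fun => //; exact: mS1.
rewrite (RintegralZl (mu := leb) c mS1 i0) (RintegralD (mu := leb) mS1 i1 i2).
rewrite Rintegral_cst_S1 mul1r /HOmega_norm sqr_sqrt_L2ip.
set I := (X in twopi + X); have I0 : 0 <= I.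
  by apply: Rintegral_ge0 => phi _; exact: sqr_ge0.
have t1 : 1 <= twopi by have := @pi_ge2 R; rewrite mulr2n; lra.
rewrite -!mulrA ler_pM2l// ler_wpM2l//.
by rewrite mulrDr mulr1 lerD2l ler_peMl.
Qed.

(** As theta |-> |F(theta)|^2 need not be measurable, its integral is only a
    lower integral, which is monotone but not additive. Hence the truncation
    max(|m| / K - 1, 0): it is measurable, and below |F(theta)|^2 almost
    everywhere by moment_bound. *)
Lemma moment_integrable : exists m, [/\ cmeasurable m, cintegrable leb S1 m,
  leb.-integrable S1 (EFin \o (fun x => cabs (m x))) &
  {ae leb, forall theta, moment theta = m theta}].
Proof.
have [m mm mE] := moment_ae_cmeasurable; exists m.
have [_ aeF _ fin] := iF.
pose K := 2 * c * twopi + 1.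
have K0 : 0 < K by rewrite ltr_wpDl// mulr_ge0 ?mulr_ge0// ltW// twopi_gt0.
pose w x := Num.max (cabs (m x) / K - 1) 0.
have mw : measurable_fun setT w.
  apply: measurable_maxr => //; apply: measurable_funB => //.
  by apply: measurable_funM => //; exact: measurable_cabs.
have w0 x : 0 <= w x by rewrite le_max lexx orbT.
have [A [mA A0 hA]] : {ae leb, forall theta, w theta <= HOmega_norm Omega (F theta) ^+ 2}.
  apply: (ae_imp2 aeF mE) => theta /HOmega_densityP[LU _] e.
  rewrite ge_max sqr_ge0 andbT lerBlDr ler_pdivrMr// -e.
  apply: (le_trans (moment_bound LU)); rewrite /K mulrC addrC ler_wpM2l//; last by rewrite lerDl.
  by rewrite addr_ge0// sqr_ge0.
have iw : leb.-integrable S1 (EFin \o w).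
  apply/integrableP; split; first by apply/measurable_EFinP; exact: measurable_funTS.
  apply: le_lt_trans fin; apply: (@le_integral_lower_ae _ _ _ leb S1 A) => //.
  - by move=> x _; rewrite lee_fin sqr_ge0.
  - move=> x _ nA; rewrite /= lee_fin ger0_norm//.
    by apply: contrapT => h; apply: nA; exact: hA.
have i1 : leb.-integrable S1 (EFin \o (fun x => K * (1 + w x))).
  apply: integrableZ_fun; first exact: mS1.
  by apply: integrableD_fun => //; [exact: mS1|exact: integrable_cst_S1].
have mK x : cabs (m x) <= K * (1 + w x).
  have : cabs (m x) / K - 1 <= w x by rewrite le_max lexx.
  by rewrite lerBlDr ler_pdivrMr// => h; rewrite mulrC addrC.
have ia : leb.-integrable S1 (EFin \o (fun x => cabs (m x))).
  apply: (@integrable_fun_dom _ _ _ leb _ _ (fun x => K * (1 + w x))) => //; first exact: mS1.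
    by apply: measurable_funTS; exact: measurable_cabs.
  by move=> x _; rewrite ger0_norm ?cabs_ge0.
split => //.
by apply: (@cintegrable_dom _ _ _ leb S1 mS1 m (fun x => cabs (m x))).
Qed.

End KernelMoments.

(** * Surjectivity *)

Section TrigonometricConstancy.
Variable R : realType.
Local Notation leb := (@lebesgue_measure R).
Local Notation S1 := (@S1 R).
Local Notation mS1 := (@measurable_S1 R).
Local Notation twopi := (pi *+ 2 : R).

Lemma continuous_cos_affine (w b : R) : continuous (fun x : R => cos (w * x + b)).
Proof. by apply: continuous_comp_fun; [exact: continuous_affine|exact: continuous_cos]. Qed.

Lemma Rintegral_cos_int (k : int) (b : R) : k != 0 ->
  \int[leb]_(x in S1) cos (k%:~R * x + b) = 0.
Proof.
move=> k0; have k0' : (k%:~R : R) != 0 by rewrite intr_eq0.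
pose h (x : R) : R[i] := ((k%:~R)^-1 * cos (k%:~R * x + (b - pi / 2)))%:C.
have dh (x : R) : cdir x (1 : R) h (cos (k%:~R * x + b))%:C.
  apply: cdir_real.
  apply: dir_ext (dirZ (k%:~R)^-1 (dir_cos (dir_affine k%:~R (b - pi / 2) x))) => //.
  rewrite addrA sinBpihalf; field; exact: k0'.
have := @cintegral_circle_derive R h (fun x => (cos (k%:~R * x + b))%:C) dh.
move=> H; have : cintegral leb S1 (fun x => (cos (k%:~R * x + b))%:C) = 0.
  apply: H.
    split => /=; first exact: continuous_cos_affine.
    exact: continuous_cst_fun.
  by rewrite /h -[in LHS](add0r twopi) cos_int_periodic.
by move/(congr1 (fun z => Re z)).
Qed.

Variable v : R -> R.
Hypotheses (mv : measurable_fun setT v) (iv : leb.-integrable S1 (EFin \o v)).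

Lemma trig_constant_ae :
  (forall (k : int) (b : R), k != 0 -> \int[leb]_(x in S1) (v x * cos (k%:~R * x + b)) = 0) ->
  {ae leb, forall x, S1 x -> v x = (\int[leb]_(x in S1) v x) / twopi}.
Proof.
move=> orth; set a := _ / _.
have t0 : twopi != 0 by rewrite gt_eqF// twopi_gt0.
pose u x := v x + (-1) * a.
have mu : measurable_fun setT u by apply: measurable_funD.
have ia := integrable_cst_S1 (-1 * a : R).
have iu : leb.-integrable S1 (EFin \o u).
  by apply: integrableD_fun; [exact: mS1|exact: iv|exact: ia].
have Iu : \int[leb]_(x in S1) u x = 0.
  rewrite (RintegralD (mu := leb) mS1 iv ia) Rintegral_cst_S1 mulN1r /a mulNr divfK//.
  by rewrite subrr.
suff : {ae leb, forall x, S1 x -> u x = 0}.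
  move=> aeu; apply: (ae_imp aeu) => x ux Sx; have := ux Sx.
  by rewrite /u mulN1r => /eqP; rewrite subr_eq0 => /eqP.
apply: (trig_orthogonal_ae mu iu) => k b.
have [->|k0] := eqVneq k 0.
  transitivity (\int[leb]_(x in S1) (cos b * u x)).
    by apply: eq_Rintegral => x _; rewrite mul0r add0r mulrC.
  by rewrite (RintegralZl (mu := leb) _ mS1 iu) Iu mulr0.
have ic : leb.-integrable S1 (EFin \o (fun x => cos (k%:~R * x + b))).
  by apply: continuous_integrable_itv; exact: continuous_cos_affine.
have iac : leb.-integrable S1 (EFin \o (fun x => (-1 * a) * cos (k%:~R * x + b))).
  by apply: integrableZ_fun; [exact: mS1|exact: ic].
have mc : measurable_fun setT (fun x : R => cos (k%:~R * x + b)).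
  by apply: continuous_measurable_fun; exact: continuous_cos_affine.
have ivc : leb.-integrable S1 (EFin \o (fun x => v x * cos (k%:~R * x + b))).
  apply: (@integrable_fun_dom _ _ _ leb _ _ (fun x => `|v x|)); first exact: mS1.
  - by apply: measurable_funTS; apply: measurable_funM; [exact: mv|exact: mc].
  - by move=> x _; rewrite normrM ler_piMr// ler_norml cos_geN1 cos_le1.
  - exact: integrable_norm.
transitivity (\int[leb]_(x in S1) (v x * cos (k%:~R * x + b) + (-1 * a) * cos (k%:~R * x + b))).
  by apply: eq_Rintegral => x _; rewrite /u mulrDl.
rewrite (RintegralD (mu := leb) mS1 ivc iac) (RintegralZl (mu := leb) _ mS1 ic).
by rewrite orth// Rintegral_cos_int// mulr0 addr0.
Qed.

End TrigonometricConstancy.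

Section Surjectivity.
Variable R : realType.
Local Notation C := R[i].
Local Notation leb := (@lebesgue_measure R).
Local Notation S1 := (@S1 R).
Local Notation mS1 := (@measurable_S1 R).
Local Notation twopi := (pi *+ 2 : R).
Variables Omega mu : R.
Hypothesis (Omega_gt0 : 0 < Omega).
Variable F : R -> tdist R.
Hypotheses (iF : in_HSE2 Omega F) (crF : CR (mu / Omega) F).
Local Notation U theta := (HOmega_density Omega (F theta)).
Local Notation circ phi := (Omega * cos phi, Omega * sin phi).

Section FixedExponent.
Variable s : R * R.
Local Notation chi := (test_mode Omega mu s).
Local Notation A := (mode_const Omega mu s).
Local Notation prof := (mode_profile mu s).

(** What X1 makes of the profile, up to the factor i Omega. *)
Definition sin_profile (theta phi : R) : R := sin (phi - theta) * prof theta phi.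

Lemma mode_profile_bound theta phi :
  `|prof theta phi| <= expR (`|s.1| + `|s.2| + `|mu|).
Proof.
rewrite (gtr0_norm (expR_gt0 _)) ler_expR.
have h (a c : R) : -1 <= c <= 1 -> a * c <= `|a|.
  move=> hc; apply: (le_trans (ler_norm _)); rewrite normrM ler_piMr//.
  by rewrite ler_norml.
apply: lerD; first apply: lerD; try by apply: h; rewrite ?cos_geN1 ?cos_le1 ?sin_geN1 ?sin_le1.
by rewrite -mulNr -normrN; apply: h; rewrite cos_geN1 cos_le1.
Qed.

Lemma sin_profile_bound theta phi :
  `|sin_profile theta phi| <= expR (`|s.1| + `|s.2| + `|mu|).
Proof.
rewrite normrM; apply: le_trans (mode_profile_bound theta phi).
by rewrite ler_piMl// ler_norml sin_geN1 sin_le1.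
Qed.

Let cdiffl phi : continuous (fun t : R => phi - t).
Proof. by under eq_fun do rewrite addrC -mulN1r; exact: continuous_affine. Qed.

Let cdiffr theta : continuous (fun t : R => t - theta).
Proof. by under eq_fun do rewrite -[X in X - _]mul1r; exact: continuous_affine. Qed.

Lemma continuous_mode_profile theta : continuous (prof theta).
Proof.
apply: continuous_comp_fun; last exact: continuous_expR.
apply: continuousB_fun.
  apply: continuousD_fun; apply: continuousM_fun; try exact: continuous_cst_fun.
    exact: continuous_cos.
  exact: continuous_sin.
apply: continuousM_fun; first exact: continuous_cst_fun.
by apply: continuous_comp_fun; [exact: cdiffr|exact: continuous_cos].
Qed.

Lemma continuous_mode_profile_theta phi : continuous (fun t => prof t phi).
Proof.
apply: continuous_comp_fun; last exact: continuous_expR.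
apply: continuousB_fun; first exact: continuous_cst_fun.
apply: continuousM_fun; first exact: continuous_cst_fun.
by apply: continuous_comp_fun; [exact: cdiffl|exact: continuous_cos].
Qed.

Lemma continuous_sin_profile theta : continuous (sin_profile theta).
Proof.
apply: continuousM_fun; last exact: continuous_mode_profile.
by apply: continuous_comp_fun; [exact: cdiffr|exact: continuous_sin].
Qed.

Lemma continuous_sin_profile_theta phi : continuous (fun t => sin_profile t phi).
Proof.
apply: continuousM_fun; last exact: continuous_mode_profile_theta.
by apply: continuous_comp_fun; [exact: cdiffl|exact: continuous_sin].
Qed.

Lemma mode_profile_periodic theta : periodic (prof theta) twopi.
Proof.
move=> phi; rewrite /mode_profile cosD2pi sinD2pi.
by rewrite (addrAC phi) cosD2pi.
Qed.

Lemma sin_profile_periodic theta : periodic (sin_profile theta) twopi.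
Proof.
move=> phi; rewrite /sin_profile mode_profile_periodic.
by rewrite (addrAC phi) sinD2pi.
Qed.

(** Expresses the values of F on the test modes and on their derivatives by
    moments of two kernels. *)
Lemma pairing_split theta psi (a b : C) : in_HOmega Omega (F theta) -> schwartz2 psi ->
  (forall phi, fourier2 psi (circ phi) =
     a * (prof theta phi)%:C + b * (sin_profile theta phi)%:C) ->
  F theta psi = conjc a * moment Omega F prof theta + conjc b * moment Omega F sin_profile theta.
Proof.
move=> iFt sp fE; have [LU eU] := HOmega_densityP iFt; have [_ mU _] := LU.
have iU := L2S1_integrable_abs LU.
have i1 : cintegrable leb S1 (fun phi => U theta phi * (prof theta phi)%:C).
  apply: (@cintegrable_mul_bounded _ _ _ (expR (`|s.1| + `|s.2| + `|mu|)) mU iU).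
    by apply: cmeasurable_real; apply: continuous_measurable_fun; exact: continuous_mode_profile.
  by move=> x; rewrite cabsR mode_profile_bound.
have i2 : cintegrable leb S1 (fun phi => U theta phi * (sin_profile theta phi)%:C).
  apply: (@cintegrable_mul_bounded _ _ _ (expR (`|s.1| + `|s.2| + `|mu|)) mU iU).
    by apply: cmeasurable_real; apply: continuous_measurable_fun; exact: continuous_sin_profile.
  by move=> x; rewrite cabsR sin_profile_bound.
rewrite (eU _ sp) HOmega_distE /moment -(cintegralZ mS1 _ i1) -(cintegralZ mS1 _ i2).
rewrite -(cintegralD mS1 (cintegrableZ mS1 _ i1) (cintegrableZ mS1 _ i2)).
apply: eq_cintegral => phi _; rewrite /on_circle fE.
move: (U theta phi) (prof theta phi) (sin_profile theta phi) => z x y.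
by apply: complex_ext; rewrite !cE /=; ring.
Qed.

Lemma fourier2_X1_test_mode w beta theta phi :
  fourier2 (fun q => X1 (chi w beta) (q, theta)) (circ phi) =
  (0 +i* (Omega * cos (w * theta + beta) * A)) * (sin_profile theta phi)%:C.
Proof.
rewrite (fourier2_X1_circle Omega theta phi (test_mode_rapid Omega mu s w beta)).
rewrite fourier2_test_mode//.
by apply: complex_ext; rewrite !cE /= /sin_profile; ring.
Qed.

Lemma fourier2_X2_test_mode w beta theta phi :
  fourier2 (fun q => X2 (chi w beta) (q, theta)) (circ phi) =
  (w * cos (w * theta + (beta + pi / 2)) * A)%:C * (prof theta phi)%:C +
  (- (mu * cos (w * theta + beta) * A))%:C * (sin_profile theta phi)%:C.
Proof.
have -> : (fun q => X2 (chi w beta) (q, theta)) =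
    (fun q => w%:C * chi w (beta + pi / 2) (q, theta) +
       (0 +i* (mu / Omega)) * X1 (chi w beta) (q, theta)).
  by apply/funext => q; exact: X2_test_mode.
have [c1 d1] := rapid_decays (test_mode_rapid Omega mu s w (beta + pi / 2)).
have [c2 d2] := rapid_decays (gaussian_class_rapid (X1_class (test_mode_class Omega mu s w beta))).
have d2' : decays (cabs (0 +i* (mu / Omega)) * c2)
    (fun q => (0 +i* (mu / Omega)) * X1 (chi w beta) (q, theta)).
  have [m h] := d2 theta; split.
    by apply: cmeasurableM; [exact: cmeasurable_cst|exact: m].
  by move=> z; rewrite cabsM -mulrA; apply: ler_wpM2l; [exact: cabs_ge0|exact: h].
rewrite (fourier2D (circ phi) w%:C (d1 theta) d2').
rewrite (fourier2Z (circ phi) (0 +i* (mu / Omega)) (d2 theta)).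
rewrite fourier2_X1_test_mode fourier2_test_mode//.
have O0 : Omega != 0 by rewrite gt_eqF.
by apply: complex_ext; rewrite !cE /=; field.
Qed.

Lemma testSE2_mode (k : int) beta : testSE2 (chi k%:~R beta).
Proof.
have [sm bd] := test_mode_rapid Omega mu s k%:~R beta.
by split => // q theta; exact: test_mode_periodic.
Qed.

(** Tested on the mode with trigonometric factor cos(k theta + beta), the two
    occurrences of X1 in the Cauchy-Riemann equation cancel, and what remains
    says that the moment is orthogonal to the derivative of this factor: its
    nonconstant Fourier coefficients vanish. *)
Lemma moment_constant : exists c : C,
  {ae leb, forall theta, S1 theta -> moment Omega F prof theta = c}.
Proof.
have [m [mm im am mE]] := moment_integrable Omega_gt0 iF continuous_mode_profile_theta
  continuous_mode_profile mode_profile_periodic mode_profile_bound.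
have [n [mn in_ an nE]] := moment_integrable Omega_gt0 iF continuous_sin_profile_theta
  continuous_sin_profile sin_profile_periodic sin_profile_bound.
have [_ aeF _ _] := iF.
have A0 : A != 0 by rewrite gt_eqF// mode_const_gt0.
have O0 : Omega != 0 by rewrite gt_eqF.
have ctrig (f : R -> C) w b : cmeasurable f -> leb.-integrable S1 (EFin \o (fun x => cabs (f x))) ->
    cintegrable leb S1 (fun x => f x * (cos (w * x + b))%:C).
  move=> mf af; apply: (@cintegrable_mul_bounded _ _ _ 1 mf af).
    by apply: cmeasurable_real; apply: continuous_measurable_fun; exact: continuous_cos_affine.
  by move=> x; rewrite cabsR ler_norml cos_geN1 cos_le1.
have key (k : int) (b : R) : k != 0 ->
    cintegral leb S1 (fun x => m x * (cos (k%:~R * x + b))%:C) = 0.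
  move=> k0; pose beta := b - pi / 2.
  (* Differentiating the factor of phase beta gives the phase b. *)
  have := crF (testSE2_mode k beta).
  have bE : beta + pi / 2 = b by rewrite /beta subrK.
  set w : R := k%:~R.
  have i1 := ctrig _ w b mm am; have i2 := ctrig _ w beta mn an.
  have rc := test_mode_rapid Omega mu s w beta.
  rewrite /dist_X2 /dist_X1.
  have -> : distSE2 F (X2 (chi w beta)) =
      (w * A)%:C * cintegral leb S1 (fun x => m x * (cos (w * x + b))%:C) +
      (- (mu * A))%:C * cintegral leb S1 (fun x => n x * (cos (w * x + beta))%:C).
    rewrite -(cintegralZ mS1 _ i1) -(cintegralZ mS1 _ i2).
    rewrite -(cintegralD mS1 (cintegrableZ mS1 _ i1) (cintegrableZ mS1 _ i2)).
    apply: eq_cintegral_ae; apply: (ae_imp3 aeF mE nE) => theta iFt e1 e2 _.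
    have sp := rapid_slice theta (rapid_cderive (dtheta_basis3 R) rc).
    rewrite (pairing_split iFt sp (fourier2_X2_test_mode w beta theta)) e1 e2 bE.
    move: (m theta) (n theta) (cos _) (cos _) => z z' x x'.
    by apply: complex_ext; rewrite !cE /=; ring.
  have -> : distSE2 F (X1 (chi w beta)) =
      (0 +i* (- (Omega * A))) * cintegral leb S1 (fun x => n x * (cos (w * x + beta))%:C).
    rewrite -(cintegralZ mS1 _ i2).
    apply: eq_cintegral_ae; apply: (ae_imp2 aeF nE) => theta iFt e2 _.
    have sp := rapid_slice theta
      (gaussian_class_rapid (X1_class (test_mode_class Omega mu s w beta))).
    have fE phi : fourier2 (fun q => X1 (chi w beta) (q, theta)) (circ phi) =
        0 * (prof theta phi)%:C +
        (0 +i* (Omega * cos (w * theta + beta) * A)) * (sin_profile theta phi)%:C.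
      by rewrite mul0r add0r fourier2_X1_test_mode.
    rewrite (pairing_split iFt sp fE) e2.
    move: (moment _ _ _ _) (n theta) (cos _) => z z' x.
    by apply: complex_ext; rewrite !cE /=; ring.
  move: (cintegral _ _ _) (cintegral _ _ _) => z' z h.
  have {h} : (w * A)%:C * z = 0.
    apply: (oppr_inj (V := C)); rewrite [RHS]oppr0 -[RHS]h.
    by apply: complex_ext; rewrite !cE /=; field.
  have w0 : w * A != 0 by rewrite mulf_neq0// intr_eq0.
  move=> h; apply: (mulfI (x := (w * A)%:C)); last by rewrite mulr0.
  by rewrite fmorph_eq0.
have keyRe (k : int) (b : R) : k != 0 ->
    \int[leb]_(x in S1) (Re (m x) * cos (k%:~R * x + b)) = 0.
  move=> k0; have /(congr1 (fun z => Re z)) /= := key k b k0.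
  move=> <-; apply: eq_Rintegral => x _; by rewrite !cE /= mulr0 subr0.
have keyIm (k : int) (b : R) : k != 0 ->
    \int[leb]_(x in S1) (Im (m x) * cos (k%:~R * x + b)) = 0.
  move=> k0; have /(congr1 (fun z => Im z)) /= := key k b k0.
  move=> <-; apply: eq_Rintegral => x _; by rewrite !cE /= mulr0 add0r.
have [m1 m2] := mm; have [j1 j2] := im.
have c1 := trig_constant_ae m1 j1 keyRe; have c2 := trig_constant_ae m2 j2 keyIm.
eexists (_ +i* _); apply: (ae_imp3 mE c1 c2) => theta e e1 e2 St.
rewrite e; apply: complex_ext => /=; [exact: e1|exact: e2].
Qed.

End FixedExponent.

(** Almost every theta is good for all the exponents s of a lattice at once.
    For two good angles the functions U(theta, phi) exp(- mu cos(phi - theta))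
    have the same moments against exponentials, hence agree; dividing by 2pi
    c_mu yields Phi. *)
Lemma CR_surjective : exists2 Phi : R -> C, L2S1 Phi &
  HSE2_eq F (HSE2_of_fun (analysis_op Omega (u_mu mu) Phi)).
Proof.
pose s (x : int * int * nat) : R * R := (x.1.1%:~R / x.2.+1%:R, x.1.2%:~R / x.2.+1%:R).
have /choice[c cP] (x : int * int * nat) := moment_constant (s x).
have aec := ae_forall_countable cP.
have [pF aeF _ _] := iF.
pose good theta := in_HOmega Omega (F theta) /\
  (S1 theta -> forall x, moment Omega F (mode_profile mu (s x)) theta = c x).
have aeg : {ae leb, forall theta, good theta}.
  by apply: (ae_imp2 aeF aec) => theta iFt h; split => // St x; exact: h.
have [t0 St0 [iF0 E0]] : exists2 theta, S1 theta & good theta.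
  apply: contrapT => no; have [B [mB B0 hB]] := aeg.
  have SB : S1 `<=` B.
    by move=> x Sx; apply: hB => gx; apply: no; exists x.
  have := subset_measure0 mS1 mB SB B0.
  rewrite /Defs.S1; have := @lebesgue_measure_itv R `[0, pi *+ 2].
  rewrite /= lte_fin twopi_gt0 sube0 => -> /eqP.
  by rewrite eqe gt_eqF ?twopi_gt0.
have [L0 _] := HOmega_densityP iF0.
have cm0 : 0 < c_mu mu := c_mu_gt0 mu.
pose wt theta phi : R := mode_profile mu (0, 0) theta phi.
have wtb theta phi : `|wt theta phi| <= _ := mode_profile_bound (0, 0) theta phi.
have mwt theta : cmeasurable (fun phi => (wt theta phi)%:C).
  by apply: cmeasurable_real; apply: continuous_measurable_fun; exact: continuous_mode_profile.
have wt_split (a b theta phi : R) :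
    mode_profile mu (a, b) theta phi = wt theta phi * expR (a * cos phi + b * sin phi).
  by rewrite /wt /mode_profile /= -expRD; congr expR; ring.
have wtE theta phi : wt theta phi * expR (mu * cos (phi - theta)) = 1.
  by rewrite /wt /mode_profile /= -expRD -[RHS]expR0; congr expR; ring.
(* c_mu exp(mu cos(phi - t0)) is u^mu(phi - t0), and wt is the inverse of the
   exponential. *)
pose Phi phi := U t0 phi * ((wt t0 phi) / (twopi * c_mu mu))%:C.
have T0 : 0 < twopi * c_mu mu by rewrite mulr_gt0// twopi_gt0.
have LPhi : L2S1 Phi.
  apply: (@L2S1_mul _ _ _ (expR (`|0| + `|0| + `|mu|) / (twopi * c_mu mu)) L0).
  - by move=> phi; rewrite /wt mode_profile_periodic.
  - apply: cmeasurable_real; apply: measurable_funM => //.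
    exact: (proj1 (mwt t0)).
  - move=> phi; rewrite cabsR normrM (gtr0_norm (x := _^-1)) ?invr_gt0//.
    by rewrite ler_wpM2r ?invr_ge0 ?(ltW T0)//; exact: wtb.
exists Phi => //.
apply: ae_periodic.
  move=> theta; split => h psi sp.
    have [pA _ _ _] := analysis_in_HSE2 Omega_gt0 (L2S1_u_mu mu) LPhi.
    by rewrite -(pF theta psi sp) (h psi sp) (pA theta psi sp).
  have [pA _ _ _] := analysis_in_HSE2 Omega_gt0 (L2S1_u_mu mu) LPhi.
  by rewrite (pF theta psi sp) (h psi sp) -(pA theta psi sp).
apply: (ae_imp aeg) => theta [iFt Et] St.
have [Lt et] := HOmega_densityP iFt.
have aeU : {ae leb, forall phi, S1 phi ->
    U theta phi * (wt theta phi)%:C + (-1) * (U t0 phi * (wt t0 phi)%:C) = 0}.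
  have mv (th : R) : L2S1 (U th) -> L2S1 (fun phi => U th phi * (wt th phi)%:C).
    move=> L; apply: (@L2S1_mul _ _ _ (expR (`|0| + `|0| + `|mu|)) L) => [phi| |phi].
    - by rewrite /wt mode_profile_periodic.
    - exact: mwt.
    - by rewrite cabsR; exact: wtb.
  have [_ m1 _] := mv _ Lt; have [_ m2 _] := mv _ L0.
  have i1 := L2S1_integrable_abs (mv _ Lt); have i2 := L2S1_integrable_abs (mv _ L0).
  have md : cmeasurable (fun phi =>
      U theta phi * (wt theta phi)%:C + (-1) * (U t0 phi * (wt t0 phi)%:C)).
    by apply: cmeasurableD => //; apply: cmeasurableM => //; exact: cmeasurable_cst.
  apply: (complex_exp_orthogonal md).
    apply: (@integrable_fun_dom _ _ _ leb _ _ (fun phi =>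
      cabs (U theta phi * (wt theta phi)%:C) + cabs (U t0 phi * (wt t0 phi)%:C))).
    - exact: mS1.
    - by apply: measurable_funTS; exact: measurable_cabs.
    - move=> x _; rewrite ger0_norm ?cabs_ge0//; apply: (le_trans (cabsD _ _)).
      rewrite lerD2l [leLHS]cabsM; have -> : (-1 : C) = (-1 : R)%:C by rewrite rmorphN rmorph1.
      by rewrite cabsR normrN1 mul1r.
    - by apply: integrableD_fun; [exact: mS1|exact: i1|exact: i2].
  move=> i j n; pose e (phi : R) : R := expR (i%:~R / n.+1%:R * cos phi + j%:~R / n.+1%:R * sin phi).
  have mo (th : R) : S1 th -> (S1 th -> forall x, moment Omega F (mode_profile mu (s x)) th = c x) ->
      cintegral leb S1 (fun phi => (U th phi * (wt th phi)%:C) * (e phi)%:C) = c (i, j, n).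
    move=> Sth h; rewrite -(h Sth (i, j, n)); apply: eq_cintegral => phi _.
    rewrite wt_split -/(e phi); move: (U th phi) (wt th phi) (e phi) => z x y.
    by apply: complex_ext; rewrite !cE /=; ring.
  have ie (th : R) : L2S1 (U th) ->
      cintegrable leb S1 (fun phi => (U th phi * (wt th phi)%:C) * (e phi)%:C).
    move=> L; have [_ mL _] := mv _ L; have iL := L2S1_integrable_abs (mv _ L).
    apply: (@cintegrable_mul_bounded _ _ _ (expR (`|i%:~R / n.+1%:R| + `|j%:~R / n.+1%:R|)) mL iL).
      apply: cmeasurable_real; apply: continuous_measurable_fun.
      exact: continuous_expR_cos_sin.
    by move=> x; rewrite cabsR (gtr0_norm (expR_gt0 _)); exact: expR_cos_sin_bound.
  transitivity (cintegral leb S1 (fun phi => (U theta phi * (wt theta phi)%:C) * (e phi)%:C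
      + (-1) * ((U t0 phi * (wt t0 phi)%:C) * (e phi)%:C))).
    by apply: eq_cintegral => phi _; rewrite [LHS]mulrDl; congr (_ + _); rewrite [RHS]mulrA.
  rewrite (cintegralD mS1 (ie _ Lt) (cintegrableZ mS1 (-1) (ie _ L0))).
  by rewrite (cintegralZ mS1 (-1) (ie _ L0)) mo// mo// mulN1r subrr.
move=> psi sp.
rewrite (et psi sp) (analysis_tdist_eq Omega (L2S1_u_mu mu) LPhi theta sp).
apply: HOmega_dist_ae; apply: (ae_imp aeU) => phi h Sphi; have {h} := h Sphi.
rewrite mulN1r => /eqP; rewrite subr_eq0 => /eqP h.
have e : u_mu mu (phi - theta) = (c_mu mu * expR (mu * cos (phi - theta)))%:C by [].
rewrite /analysis_density e /Phi.
have w1 := wtE theta phi; move: (expR _) w1 => E w1.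
have -> : U theta phi = (U theta phi * (wt theta phi)%:C) * E%:C.
  by rewrite -mulrA -rmorphM /= w1 rmorph1 mulr1.
rewrite h; move: (U t0 phi) (wt t0 phi) (twopi_gt0 R) => z x.
move: (pi *+ 2) (c_mu mu) cm0 => t cm cm_gt0 t_gt0.
by apply: complex_ext; rewrite !cE /=; field; rewrite !gt_eqF.
Qed.

End Surjectivity.

(** * The theorem *)

Theorem theorem1p1 (R : realType) (Omega mu : R)
    (Omega_gt0 : 0 < Omega) (mu_neq0 : mu != 0) :
  (forall u0 : R -> R[i], L2S1 u0 -> L2norm u0 = 1 ->
     forall Phi : R -> R[i], L2S1 Phi ->
       in_HSE2 Omega (HSE2_of_fun (analysis_op Omega u0 Phi)) /\
       HSE2_norm Omega (HSE2_of_fun (analysis_op Omega u0 Phi))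
         = pi *+ 2 * L2norm Phi) /\
  (forall Phi : R -> R[i], L2S1 Phi ->
     in_HSE2 Omega (HSE2_of_fun (analysis_op Omega (u_mu mu) Phi)) /\
     CR (mu / Omega) (HSE2_of_fun (analysis_op Omega (u_mu mu) Phi))) /\
  (forall F : R -> tdist R, in_HSE2 Omega F -> CR (mu / Omega) F ->
     exists2 Phi : R -> R[i], L2S1 Phi &
       HSE2_eq F (HSE2_of_fun (analysis_op Omega (u_mu mu) Phi))).
Proof.
split; last split.
- move=> u0 Lu0 u1 Phi LPhi; split; first exact: analysis_in_HSE2.
  exact: analysis_norm_unit.
- move=> Phi LPhi; split; last exact: CR_analysis.
  by apply: analysis_in_HSE2 => //; exact: L2S1_u_mu.
- by move=> F iF crF; exact: (CR_surjective Omega_gt0 iF crF).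
Qed.
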